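(* Let $\theta:(0,1)\to(0,\infty)$ be a positive nonincreasing function and $\rho_\theta(t)=te^{\theta(t)}$. (a) Suppose that $\{z_k\}\subset\mathbb{D}$ is a separated sequence, let $N_m$ be the number of points $z_k$ in $Y_m$ ($m=1,2,\dots$), and suppose that $$\sum_{m\notin\mathcal J}N_m\,\rho_\theta(2^{-m})\exp\{-\gamma 2^m/N_m\}=\infty$$ for every $\gamma>0$ and for every set $\mathcal J$ of indices with $\sum_{m\in\mathcal J}N_m2^{-m}<\infty$. Then $\{z_k\}\notin\Lambda_\theta$. (b) Suppose that an infinite set $\mathcal L$ of indices and nonnegative integers $N_m$, $m\in\mathcal L$, are such that, along $m\in\mathcal L$, $m\to\infty$, $N_m$ is nondecreasing and tends to $\infty$ and $N_m2^{-m}$ is nonincreasing and tends to $0$, and $$\sum_{m\in\mathcal L}N_m\,\rho_\theta(2^{-m})\exp\{-\gamma2^m/N_m\}<\infty\quad\text{for some }\gamma>0 .$$ Then there exists a separated $\theta$-thin sequence $\{z_k\}\subset\mathbb{D}$ such that, for every $m\in\mathcal L$, the number of points $z_k$ in $Y_m$ is exactly the given number $N_m$.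
   Context: $\mathbb{D}=\{z\in\mathbb{C}:|z|<1\}$, and $H^\infty$ is the space of bounded holomorphic functions on $\mathbb{D}$. All sequences $\{z_k\}\subset\mathbb{D}$ are infinite and satisfy $|z_k|\to1$. A sequence $\{z_k\}$ is separated if $\inf_{n\neq k}\left|\frac{z_n-z_k}{1-\overline{z}_n z_k}\right|>0$. A sequence $\{z_k\}$ is $\theta$-thin if there exists $f\in H^\infty$, $f\not\equiv0$, with $\sum_k\rho_\theta(1-|z_k|)|f(z_k)|<\infty$ (if some $z_k=0$, the corresponding term is omitted). $\Lambda_\theta$ denotes the class of all separated $\theta$-thin sequences. For $m=1,2,\dots$, $Y_m=\{z:1-2^{-m}\le|z|<1-2^{-m-1}\}$. ''Indices'' are positive integers $m$. Terms $N_m\rho_\theta(2^{-m})\exp\{-\gamma2^m/N_m\}$ with $N_m=0$ are read as $0$. *)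

(* Defs.v *)
From Stdlib Require Import Reals List ClassicalEpsilon.
From Coquelicot Require Import Coquelicot.
Open Scope R_scope.

Definition disk (z : C) : Prop := Cmod z < 1.

Definition holomorphic_disk (f : C -> C) : Prop :=
  forall z : C, disk z -> ex_derive (K := C_AbsRing) (V := C_NormedModule) f z.

(* Functions on the disk are total functions on C, of which only the values on
   the disk matter. *)
Definition Hinfty (f : C -> C) : Prop :=
  holomorphic_disk f /\
  exists M : R, forall z : C, disk z -> Cmod (f z) <= M.

Definition nonzero_on_disk (f : C -> C) : Prop :=
  exists z : C, disk z /\ f z <> RtoC 0.

Definition disk_sequence (z : nat -> C) : Prop :=
  (forall k : nat, disk (z k)) /\ is_lim_seq (fun k => Cmod (z k)) 1.

Definition separated (z : nat -> C) : Prop :=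
  Rbar_lt 0
    (Glb_Rbar (fun d : R => exists n k : nat, n <> k /\
       d = Cmod ((z n - z k) / (1 - Cconj (z n) * z k))%C)).

(* [theta] is a function on (0,1), encoded as a total function on R: it is
   constrained, and evaluated below, only at points of (0,1). *)
Definition admissible_weight (theta : R -> R) : Prop :=
  (forall t : R, 0 < t < 1 -> 0 < theta t) /\
  (forall s t : R, 0 < s -> s <= t -> t < 1 -> theta t <= theta s).

Definition rho (theta : R -> R) (t : R) : R := t * exp (theta t).

Definition theta_thin (theta : R -> R) (z : nat -> C) : Prop :=
  exists f : C -> C, Hinfty f /\ nonzero_on_disk f /\
    ex_series (fun k : nat =>
      if Ceq_dec (z k) (RtoC 0) then 0
      else rho theta (1 - Cmod (z k)) * Cmod (f (z k))).

Definition Lambda (theta : R -> R) (z : nat -> C) : Prop :=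
  disk_sequence z /\ separated z /\ theta_thin theta z.

Definition Y (m : nat) (z : C) : Prop :=
  1 - / 2 ^ m <= Cmod z < 1 - / 2 ^ (m + 1).

Definition has_card {T : Type} (P : T -> Prop) (n : nat) : Prop :=
  exists l : list T, NoDup l /\ length l = n /\ forall x : T, In x l <-> P x.

(* The number of points of the sequence in [Y m], counted as indices; for a
   separated sequence the points are pairwise distinct. *)
Definition count_in_Y (z : nat -> C) (m n : nat) : Prop :=
  has_card (fun k : nat => Y m (z k)) n.

Definition index_set (A : nat -> Prop) : Prop :=
  forall m : nat, A m -> (1 <= m)%nat.

(* Sums over a set [A] of integers are sums over nat of [restrict A a]; all the
   terms summed in this way are nonnegative. *)
Definition restrict (A : nat -> Prop) (a : nat -> R) (m : nat) : R :=
  if excluded_middle_informative (A m) then a m else 0.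

Definition sum_finite (A : nat -> Prop) (a : nat -> R) : Prop :=
  ex_series (restrict A a).

Definition sum_infinite (A : nat -> Prop) (a : nat -> R) : Prop :=
  is_lim_seq (sum_n (restrict A a)) p_infty.

Definition density (N : nat -> nat) (m : nat) : R := INR (N m) * / 2 ^ m.

(* When [N m = 0] the first factor, hence the term, is 0. *)
Definition term (theta : R -> R) (N : nat -> nat) (gamma : R) (m : nat) : R :=
  INR (N m) * rho theta (/ 2 ^ m) * exp (- (gamma * 2 ^ m / INR (N m))).

(* Main.v *)
(* (a) Let f be bounded on the disk. Goursat's theorem in the coordinate log z makes the
   Fejer means of f polynomials, so f may be replaced by polynomials q with |q| <= 1 and
   -ln |q 0| <= V. Call the level m bad if |f| < exp (-gamma 2^m / N_m) at more than half
   of the N_m points. Near a point of a bad level, within a small multiple of 2^-m, either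
   q has a zero or, by Harnack, -ln |q| is at least half of its value at the point. By
   Jensen's formula the points of the second kind contribute at least
   (number of points) (gamma / N_m) to circular means bounded by V, so for gamma large
   they are at most N_m / 4, while the points of the first kind, being separated, are
   charged to distinct zeros, whose total distance to the circle is at most V. So the sum
   of N_m 2^-m over bad levels is finite; on the other levels the given series is dominated
   by the sum of rho (1 - |z_k|) |f z_k|.

   (b) The monotonicity of N_m and N_m 2^-m permits a Cantor set made at scale 2^-m of
   2^e intervals of length 2^-m, e = floor (log2 N_m), for all large m in L. With its uniform
   measure mu, g z = int (1 - z e^(-ix))^-1 dmu(x) has positive real part, and
   Re g >= 2^m / (4 N_m) at the points of modulus 1 - 2^-m above these intervals. The
   points are placed there, two per interval, and f = exp (-4 gamma g). *)

Require Import Defs.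
From Stdlib Require Import Reals Psatz List ClassicalEpsilon Arith.
From Coquelicot Require Import Coquelicot.
Open Scope R_scope.

(** * Complex differentiability *)

(** The function theory rests on one fact. After z = e^w a holomorphic function is periodic in Im w,
    the horizontal sides of a rectangle one period high cancel, and Goursat's theorem says that
    circular means do not depend on the radius. This asks nothing at 0, so it applies to f / z^n and
    yields coefficients, mean values and roots of polynomials.

    For a polynomial, ln |q| is a finite sum of terms ln |1 - b z|, so Jensen and Harnack reduce to
    the Fourier series of one factor. In return every bound must be uniform in the approximation: V
    depends on f alone, gamma on V and the separation constant; only then come a finite set of
    levels and a polynomial still small at their points. If f vanishes to order k at 0, the means
    are divided by z^k and can be normalised only on |z| >= 1/4, which contains the levels m >= 1
    and the small discs used.

    In (b), floor (log2 N_m) has to be extended to a function rising by 0 or 1 at every scale; its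
    rises are the free binary digits. An interval of scale 2^-m then has mass 2^-e >= 1 / N_m, and
    the kernel has real part at least 2^m / 4 on it. *)

Definition pick {A : Type} {P : A -> Prop} (H : exists a, P a) : A :=
  proj1_sig (constructive_indefinite_description P H).

Lemma pick_spec {A : Type} {P : A -> Prop} (H : exists a, P a) : P (pick H).
Proof. exact (proj2_sig (constructive_indefinite_description P H)). Qed.

(** The remainder bound is not strict, so [h = 0] needs no exception; derivatives are both produced
    and consumed below in this form. *)
Definition cdiff (f : C -> C) (z l : C) : Prop :=
  forall eps : R, 0 < eps -> exists d : R, 0 < d /\ forall h : C, Cmod h < d ->
    Cmod (f (z + h) - f z - l * h)%C <= eps * Cmod h.

Lemma is_derive_cdiff (f : C -> C) (z l : C) :
  is_derive (K := C_AbsRing) (V := C_NormedModule) f z l <-> cdiff f z l.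
Proof.
split.
- intros [_ H] eps Heps.
  specialize (H z (fun P HP => HP) (mkposreal eps Heps)).
  apply (locally_le_locally_norm (V := AbsRing_NormedModule C_AbsRing)) in H.
  destruct H as [d Hd]. exists d; split; [apply d|].
  intros h Hh.
  assert (E : (z + h - z = h)%C) by ring.
  specialize (Hd (z + h)%C).
  unfold ball_norm in Hd.
  change (Cmod (z + h - z) < d ->
    Cmod (f (z + h) - f z - (z + h - z) * l)%C <= eps * Cmod (z + h - z)) in Hd.
  rewrite E in Hd. specialize (Hd Hh).
  replace (l * h)%C with (h * l)%C by ring. exact Hd.
- intros H. split; [apply is_linear_scal_l|].
  intros x Hx. apply (is_filter_lim_locally_unique (V := AbsRing_NormedModule C_AbsRing)) in Hx.
  subst x. intros eps.
  destruct (H eps (cond_pos eps)) as [d [Hd H']].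
  apply (locally_norm_le_locally (V := AbsRing_NormedModule C_AbsRing)).
  exists (mkposreal d Hd). intros y Hy.
  change (Cmod (y - z) < d) in Hy.
  specialize (H' (y - z)%C Hy).
  change (Cmod (f y - f z - (y - z) * l)%C <= eps * Cmod (y - z)).
  assert (E1 : forall y : C, (z + (y - z))%C = y) by (intros; ring).
  assert (E2 : forall y : C, ((y - z) * l)%C = (l * (y - z))%C) by (intros; ring).
  rewrite E1 in H'. rewrite E2. exact H'.
Qed.

(* The two normed module structures of Coquelicot on C have different balls, and
   [is_derive_mult] and [is_derive_comp] use the one of [AbsRing_NormedModule]. *)
Lemma is_derive_ring_cdiff (f : C -> C) (z l : C) :
  is_derive (K := C_AbsRing) (V := AbsRing_NormedModule C_AbsRing) f z l <-> cdiff f z l.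
Proof.
rewrite <- is_derive_cdiff.
split; intros [_ H]; (split; [apply is_linear_scal_l|exact H]).
Qed.

Lemma cdiff_const (c z : C) : cdiff (fun _ => c) z 0.
Proof.
intros eps He. exists 1; split; [lra|]. intros h _.
replace (c - c - 0 * h)%C with (RtoC 0) by ring. rewrite Cmod_0.
apply Rmult_le_pos; [lra|apply Cmod_ge_0].
Qed.

Lemma cdiff_id (z : C) : cdiff (fun w => w) z 1.
Proof.
intros eps He. exists 1; split; [lra|]. intros h _.
replace (z + h - z - 1 * h)%C with (RtoC 0) by ring. rewrite Cmod_0.
apply Rmult_le_pos; [lra|apply Cmod_ge_0].
Qed.

Lemma cdiff_plus (f g : C -> C) (z a b : C) :
  cdiff f z a -> cdiff g z b -> cdiff (fun w => f w + g w)%C z (a + b)%C.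
Proof.
rewrite <- !is_derive_cdiff. apply (is_derive_plus (K := C_AbsRing) (V := C_NormedModule)).
Qed.

Lemma cdiff_mult (f g : C -> C) (z a b : C) :
  cdiff f z a -> cdiff g z b ->
  cdiff (fun w => f w * g w)%C z (a * g z + f z * b)%C.
Proof.
rewrite <- !is_derive_ring_cdiff. intros Ha Hb.
apply (is_derive_mult (K := C_AbsRing) f g z a b Ha Hb Cmult_comm).
Qed.

Lemma cdiff_comp (f g : C -> C) (z a b : C) :
  cdiff f (g z) a -> cdiff g z b -> cdiff (fun w => f (g w)) z (a * b)%C.
Proof.
rewrite <- !is_derive_ring_cdiff. intros Ha Hb.
replace (a * b)%C with (b * a)%C by ring.
apply (is_derive_comp (K := C_AbsRing) (V := AbsRing_NormedModule C_AbsRing) f g z a b Ha).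
exact Hb.
Qed.

Lemma cdiff_ccont (f : C -> C) (z l : C) :
  cdiff f z l -> forall eps, 0 < eps -> exists d, 0 < d /\
    forall w, Cmod (w - z) < d -> Cmod (f w - f z) < eps.
Proof.
intros H eps He. destruct (H 1 Rlt_0_1) as [d [Hd H']].
pose proof (Cmod_ge_0 l) as Hl.
exists (Rmin d (eps / (2 + Cmod l))). split.
- apply Rmin_pos; [exact Hd|]. apply Rdiv_lt_0_compat; lra.
- intros w Hw. specialize (H' (w - z)%C).
  replace (z + (w - z))%C with w in H' by ring.
  destruct (Rmin_Rgt_l _ _ _ Hw) as [H1 H2].
  specialize (H' H1).
  replace (f w - f z)%C with ((f w - f z - l * (w - z)) + l * (w - z))%C by ring.
  eapply Rle_lt_trans; [apply Cmod_triangle|]. rewrite Cmod_mult.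
  apply (Rmult_lt_compat_r (2 + Cmod l)) in H2; [|lra].
  unfold Rdiv in H2. rewrite Rmult_assoc, Rinv_l, Rmult_1_r in H2 by lra.
  pose proof (Cmod_ge_0 (w - z)%C). nra.
Qed.

Lemma Cmod_sub_le (a b : C) : Cmod a - Cmod b <= Cmod (a - b).
Proof.
pose proof (Cmod_triangle (a - b) b)%C as T. replace (a - b + b)%C with a in T by ring. lra.
Qed.

Lemma Cmod_sub_comm (a b : C) : Cmod (a - b) = Cmod (b - a).
Proof. rewrite <- Cmod_opp. f_equal. ring. Qed.

Lemma Cmod_triangle_sub (a b : C) : Rabs (Cmod a - Cmod b) <= Cmod (a - b).
Proof.
pose proof (Cmod_sub_le a b). pose proof (Cmod_sub_le b a) as T.
rewrite Cmod_sub_comm in T. apply Rabs_le. lra.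
Qed.

Lemma one_sub_Cmod_le (w : C) : 1 - Cmod w <= Cmod (1 - w).
Proof. rewrite <- Cmod_1 at 1. apply Cmod_sub_le. Qed.

Lemma cdiff_inv (z : C) : z <> 0 -> cdiff (fun w => / w)%C z (- / (z * z))%C.
Proof.
intros Hz. assert (Hm := proj1 (Cmod_gt_0 z) Hz).
intros eps He. set (m := Cmod z) in *.
(* The remainder is h^2 / (z^2 (z + h)). The first radius keeps |z + h| above m / 2, so the
   remainder is at most 2 |h|^2 / m^3; the second makes this at most eps |h|. *)
exists (Rmin (m / 2) (eps * m ^ 3 / 2)). split.
- apply Rmin_pos; [lra|]. assert (0 < m ^ 3) by (apply pow_lt; lra). nra.
- intros h Hh.
  destruct (Rmin_Rgt_l _ _ _ Hh) as [H1 H2].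
  assert (Hzh : m / 2 < Cmod (z + h)).
  { pose proof (Cmod_sub_le z (- h))%C as T. rewrite Cmod_opp in T.
    replace (z - - h)%C with (z + h)%C in T by ring. fold m in T. lra. }
  assert (Hn : (z + h)%C <> 0) by (apply Cmod_gt_0; lra).
  replace (/ (z + h) - / z - - / (z * z) * h)%C with (h * h * / (z * z * (z + h)))%C
    by (field; auto).
  rewrite !Cmod_mult, Cmod_inv, !Cmod_mult
    by (repeat apply Cmult_neq_0; assumption).
  fold m. set (k := Cmod (z + h)) in *. pose proof (Cmod_ge_0 h) as Hh0.
  set (x := Cmod h) in *.
  assert (Hk : / (m * m * k) <= / (m ^ 3 / 2)).
  { apply Rinv_le_contravar; nra. }
  assert (0 < m ^ 3) by (apply pow_lt; lra).
  assert (x * / (m ^ 3 / 2) <= eps).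
  { apply (Rmult_le_reg_r (m ^ 3 / 2)); [lra|]. rewrite Rmult_assoc, Rinv_l by lra. lra. }
  assert (0 < / (m ^ 3 / 2)) by (apply Rinv_0_lt_compat; lra).
  assert (x * / (m * m * k) <= eps) by nra.
  nra.
Qed.

(** * The complex exponential and polar coordinates *)

Definition cexp (z : C) : C := (exp (Re z) * cos (Im z), exp (Re z) * sin (Im z)).

Definition cis (t : R) : C := (cos t, sin t).

Lemma C_ext (a b : C) : Re a = Re b -> Im a = Im b -> a = b.
Proof. destruct a, b; simpl; intros; subst; reflexivity. Qed.

Lemma cexp_plus (a b : C) : cexp (a + b) = (cexp a * cexp b)%C.
Proof.
destruct a as [x y], b as [u v]. unfold cexp, Cmult, Cplus; simpl.
rewrite exp_plus, cos_plus, sin_plus. apply C_ext; simpl; ring.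
Qed.

Lemma Cmod_cexp (z : C) : Cmod (cexp z) = exp (Re z).
Proof.
unfold cexp, Cmod; simpl.
replace (_ + _) with ((exp (Re z)) ^ 2 * ((sin (Im z))² + (cos (Im z))²))
  by (unfold Rsqr; ring).
rewrite sin2_cos2, Rmult_1_r, sqrt_pow2; [reflexivity|]. left; apply exp_pos.
Qed.

Lemma Cmod_cis (t : R) : Cmod (cis t) = 1.
Proof.
unfold cis, Cmod; simpl.
replace (_ + _) with ((sin t)² + (cos t)²) by (unfold Rsqr; ring).
rewrite sin2_cos2. apply sqrt_1.
Qed.

Lemma Cmod_polar (r t : R) : 0 <= r -> Cmod (r * cis t) = r.
Proof. intros Hr. rewrite Cmod_mult, Cmod_cis, Cmod_R, Rabs_pos_eq; lra. Qed.

Lemma RtoC_neq_0 (r : R) : r <> 0 -> RtoC r <> 0.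
Proof. intros H E. now apply RtoC_inj in E. Qed.

Lemma cexp_neq_0 (z : C) : cexp z <> 0.
Proof. apply Cmod_gt_0. rewrite Cmod_cexp. apply exp_pos. Qed.

(** Only the real derivatives of exp, sin and cos at 0 enter; the addition formula carries the
    estimate to every other point. *)
Lemma cexp_small (eps : R) : 0 < eps -> exists d, 0 < d /\
  forall h : C, Cmod h < d -> Cmod (cexp h - 1 - h) <= eps * Cmod h.
Proof.
intros He.
assert (D1 : derivable_pt_lim exp 0 1).
{ pose proof (derivable_pt_lim_exp 0) as H. now rewrite exp_0 in H. }
assert (D2 : derivable_pt_lim sin 0 1).
{ pose proof (derivable_pt_lim_sin 0) as H. now rewrite cos_0 in H. }
assert (D3 : derivable_pt_lim cos 0 0).
{ pose proof (derivable_pt_lim_cos 0) as H. rewrite sin_0, Ropp_0 in H. exact H. }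
assert (G : forall f l e, derivable_pt_lim f 0 l -> 0 < e -> exists d, 0 < d /\
   forall h, Rabs h < d -> Rabs (f h - f 0 - l * h) <= e * Rabs h).
{ intros f l e H E. destruct (H e E) as [d Hd]. exists d; split; [apply d|].
  intros h Hh. destruct (Req_dec h 0) as [->|Hn].
  - rewrite Rabs_R0, Rmult_0_r, Rmult_0_r, Rminus_0_r, Rminus_diag, Rabs_R0. lra.
  - specialize (Hd h Hn Hh). rewrite Rplus_0_l in Hd.
    replace (f h - f 0 - l * h) with (((f h - f 0) / h - l) * h) by (field; exact Hn).
    rewrite Rabs_mult. apply Rmult_le_compat_r; [apply Rabs_pos|lra]. }
(* Each coordinate of the remainder will be at most 6 e |h|, and the modulus is at most sqrt 2 <= 2
   times the larger one: hence 12. *)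
set (e := Rmin 1 (eps / 12)).
assert (E0 : 0 < e) by (apply Rmin_pos; lra).
assert (E1 : e <= 1) by apply Rmin_l.
assert (E2 : e <= eps / 12) by apply Rmin_r.
destruct (G _ _ e D1 E0) as [d1 [P1 H1]].
destruct (G _ _ e D2 E0) as [d2 [P2 H2]].
destruct (G _ _ e D3 E0) as [d3 [P3 H3]].
exists (Rmin (Rmin d1 e) (Rmin d2 d3)). split.
{ repeat apply Rmin_pos; lra. }
intros h Hh.
destruct (Rmin_Rgt_l _ _ _ Hh) as [Q1 Q2].
destruct (Rmin_Rgt_l _ _ _ Q1) as [B1 B2].
destruct (Rmin_Rgt_l _ _ _ Q2) as [B3 B4].
pose proof (Rmax_Cmod h) as M. destruct h as [a b]; simpl in M.
pose proof (Rle_trans _ _ _ (Rmax_l _ _) M) as Ma.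
pose proof (Rle_trans _ _ _ (Rmax_r _ _) M) as Mb.
set (x := Cmod (a, b)) in *.
specialize (H1 a ltac:(lra)). specialize (H2 b ltac:(lra)). specialize (H3 b ltac:(lra)).
rewrite exp_0 in H1. rewrite sin_0 in H2. rewrite cos_0 in H3.
rewrite !Rminus_0_r, Rmult_1_l in H2. rewrite Rmult_1_l in H1.
rewrite Rmult_0_l, Rminus_0_r in H3.
assert (X0 : 0 <= x) by apply Cmod_ge_0.
set (ea := exp a - 1 - a) in *. set (sb := sin b - b) in *. set (cb := cos b - 1) in *.
(* The product of [exp a = 1 + a + ea] with [cos b = 1 + cb] and [sin b = b + sb]: each term left
   contains a remainder or is a product of two small factors. *)
replace (cexp (a, b) - 1 - (a, b))%C
  with (ea + (1 + a + ea) * cb, sb + (a + ea) * (b + sb)).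
2:{ apply C_ext; unfold cexp, ea, sb, cb; simpl; ring. }
eapply Rle_trans; [apply Cmod_2Rmax|]. simpl fst; simpl snd.
assert (S2 : sqrt 2 <= 2).
{ rewrite <- (sqrt_pow2 2) at 2 by lra. apply sqrt_le_1; lra. }
assert (A1 : Rabs ea <= e * x).
{ eapply Rle_trans; [exact H1|]. apply Rmult_le_compat_l; lra. }
assert (A2 : Rabs sb <= e * x).
{ eapply Rle_trans; [exact H2|]. apply Rmult_le_compat_l; lra. }
assert (A3 : Rabs cb <= e * x).
{ eapply Rle_trans; [exact H3|]. apply Rmult_le_compat_l; lra. }
assert (C1 : Rabs (ea + (1 + a + ea) * cb) <= 4 * (e * x)).
{ eapply Rle_trans; [apply Rabs_triang|]. rewrite Rabs_mult.
  assert (Rabs (1 + a + ea) <= 3).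
  { eapply Rle_trans; [apply Rabs_triang|].
    pose proof (Rabs_triang 1 a) as T. rewrite Rabs_R1 in T. nra. }
  pose proof (Rabs_pos cb). pose proof (Rabs_pos (1 + a + ea)). nra. }
assert (C2 : Rabs (sb + (a + ea) * (b + sb)) <= 6 * (e * x)).
{ eapply Rle_trans; [apply Rabs_triang|]. rewrite Rabs_mult.
  pose proof (Rabs_triang a ea) as T1. pose proof (Rabs_triang b sb) as T2.
  assert (Rabs (a + ea) <= 2 * x) by nra.
  assert (Rabs (b + sb) <= 2 * e) by nra.
  pose proof (Rabs_pos (a + ea)). pose proof (Rabs_pos (b + sb)). nra. }
assert (M6 : Rmax (Rabs (ea + (1 + a + ea) * cb)) (Rabs (sb + (a + ea) * (b + sb)))
             <= 6 * (e * x)).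
{ apply Rmax_lub; nra. }
pose proof (Rle_trans _ _ _ (Rabs_pos _) (Rmax_l (Rabs (ea + (1 + a + ea) * cb)) (Rabs (sb + (a + ea) * (b + sb))))).
pose proof (sqrt_pos 2). nra.
Qed.

Lemma cdiff_cexp (z : C) : cdiff cexp z (cexp z).
Proof.
intros eps He. pose proof (exp_pos (Re z)) as Hp.
destruct (cexp_small (eps / exp (Re z))) as [d [Hd H]].
{ apply Rdiv_lt_0_compat; lra. }
exists d; split; [exact Hd|]. intros h Hh. specialize (H h Hh).
rewrite cexp_plus.
replace (cexp z * cexp h - cexp z - cexp z * h)%C
  with (cexp z * (cexp h - 1 - h))%C by ring.
rewrite Cmod_mult, Cmod_cexp.
apply (Rmult_le_compat_l (exp (Re z))) in H; [|lra].
eapply Rle_trans; [exact H|]. right. field. lra.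
Qed.

Lemma polar (z : C) : exists t, 0 <= t < 2 * PI /\ z = (Cmod z * cis t)%C.
Proof.
destruct (Ceq_dec z 0) as [->|Hz].
- exists 0. split; [pose proof PI_RGT_0; lra|]. rewrite Cmod_0. ring.
- assert (Hm := proj1 (Cmod_gt_0 z) Hz).
  destruct z as [x y]. set (m := Cmod (x, y)) in *.
  assert (E : (x / m) ^ 2 + (y / m) ^ 2 = 1).
  { assert (m * m = x * x + y * y).
    { unfold m, Cmod; simpl. rewrite sqrt_sqrt; [ring|nra]. }
    field_simplify_eq; [simpl; lra|lra]. }
  set (u := x / m) in *. set (v := y / m) in *.
  assert (Hu : -1 <= u <= 1) by (split; nra).
  pose proof (acos_bound u) as HB. pose proof PI_RGT_0 as HPI.
  assert (Hs : sin (acos u) = Rabs v).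
  { rewrite sin_acos by exact Hu. rewrite <- sqrt_Rsqr_abs. f_equal. unfold Rsqr. nra. }
  destruct (Rle_lt_dec 0 v) as [Hv|Hv].
  + exists (acos u). split; [lra|]. unfold cis.
    rewrite Hs, cos_acos, Rabs_pos_eq by assumption.
    apply C_ext; simpl; unfold u, v; field; lra.
  + exists (2 * PI - acos u). split.
    { assert (acos u <> 0).
      { intros E0. rewrite E0, sin_0 in Hs. symmetry in Hs.
        apply Rabs_eq_0 in Hs. lra. }
      lra. }
    unfold cis.
    rewrite cos_minus, sin_minus, cos_2PI, sin_2PI, Hs, cos_acos by assumption.
    rewrite Rabs_left by assumption.
    apply C_ext; simpl; unfold u, v; field; lra.
Qed.

(** * Goursat's theorem *)

Definition rdiff2 (P : R -> R -> R) (s t p k : R) : Prop :=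
  forall eps, 0 < eps -> exists d, 0 < d /\ forall x y,
    Rabs (x - s) < d -> Rabs (y - t) < d ->
    Rabs (P x y - P s t - p * (x - s) - k * (y - t)) <= eps * (Rabs (x - s) + Rabs (y - t)).

(** The shared [k] is at once the t-derivative of [P] and the s-derivative of [Q]: the form P ds + Q
    dt is closed at the point. No continuity of the derivatives is assumed, hence the subdivision
    argument below. *)
Definition closed_form (P Q : R -> R -> R) (s t : R) : Prop :=
  exists p k q, rdiff2 P s t p k /\ rdiff2 Q s t k q.

Definition Rint (f : R -> R) (a b : R) : R := RInt f a b.

(* The integral of [P ds + Q dt] along the boundary of [[a,b] x [c,d]]. *)
Definition boundary_int (P Q : R -> R -> R) (a b c d : R) : R :=
  Rint (fun s => P s c - P s d) a b + Rint (fun t => Q b t - Q a t) c d.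

Lemma continuous_eps (f : R -> R) (x : R) :
  (forall eps, 0 < eps -> exists d, 0 < d /\ forall y, Rabs (y - x) < d -> Rabs (f y - f x) < eps) ->
  continuous f x.
Proof.
intros H. apply continuity_pt_filterlim. intros eps He.
destruct (H eps He) as [d [Hd H']]. exists d; split; [exact Hd|].
intros y [_ Hy]. apply H'. exact Hy.
Qed.

Lemma rdiff2_cont (P : R -> R -> R) s t p k : rdiff2 P s t p k ->
  forall eps, 0 < eps -> exists d, 0 < d /\ forall x y,
    Rabs (x - s) < d -> Rabs (y - t) < d -> Rabs (P x y - P s t) < eps.
Proof.
intros H eps He. destruct (H 1 Rlt_0_1) as [d [Hd H']].
pose proof (Rabs_pos p) as Hp. pose proof (Rabs_pos k) as Hk.
set (B := 2 + Rabs p + Rabs k).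
exists (Rmin d (eps / B)). split.
{ apply Rmin_pos; [exact Hd|apply Rdiv_lt_0_compat; unfold B; lra]. }
intros x y Hx Hy.
destruct (Rmin_Rgt_l _ _ _ Hx) as [X1 X2]. destruct (Rmin_Rgt_l _ _ _ Hy) as [Y1 Y2].
specialize (H' x y X1 Y1).
replace (P x y - P s t) with ((P x y - P s t - p * (x - s) - k * (y - t)) + (p * (x - s) + k * (y - t))) by ring.
eapply Rle_lt_trans; [apply Rabs_triang|].
pose proof (Rabs_triang (p * (x - s)) (k * (y - t))) as T. rewrite !Rabs_mult in T.
assert (E : eps = B * (eps / B)) by (field; unfold B; lra).
rewrite E. set (e := eps / B) in *.
pose proof (Rabs_pos (x - s)). pose proof (Rabs_pos (y - t)). unfold B. nra.
Qed.

Lemma rdiff2_cont_1 (P : R -> R -> R) s t p k :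
  rdiff2 P s t p k -> continuous (fun x => P x t) s.
Proof.
intros H. apply continuous_eps. intros eps He.
destruct (rdiff2_cont _ _ _ _ _ H eps He) as [d [Hd H']]. exists d; split; [exact Hd|].
intros y Hy. apply H'; [exact Hy|]. now rewrite Rminus_diag, Rabs_R0.
Qed.

Lemma rdiff2_cont_2 (P : R -> R -> R) s t p k :
  rdiff2 P s t p k -> continuous (fun y => P s y) t.
Proof.
intros H. apply continuous_eps. intros eps He.
destruct (rdiff2_cont _ _ _ _ _ H eps He) as [d [Hd H']]. exists d; split; [exact Hd|].
intros y Hy. apply H'; [|exact Hy]. now rewrite Rminus_diag, Rabs_R0.
Qed.

Lemma ex_RInt_ct (f : R -> R) a b :
  a <= b -> (forall x, a <= x <= b -> continuous f x) -> ex_RInt f a b.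
Proof.
intros Hab H. apply (ex_RInt_continuous (V := R_CompleteNormedModule)).
rewrite Rmin_left, Rmax_right by exact Hab. exact H.
Qed.

Lemma RInt_abs_le (f : R -> R) a b M :
  a <= b -> (forall x, a <= x <= b -> continuous f x) ->
  (forall x, a <= x <= b -> Rabs (f x) <= M) -> Rabs (Rint f a b) <= M * (b - a).
Proof.
intros Hab Hc HM.
assert (Hex := ex_RInt_ct f a b Hab Hc).
pose proof (norm_RInt_le_const (V := R_NormedModule) f a b (RInt f a b) M Hab HM
  (RInt_correct (V := R_CompleteNormedModule) f a b Hex)) as H.
rewrite Rmult_comm. exact H.
Qed.

Lemma continuous_Rminus (f g : R -> R) x :
  continuous f x -> continuous g x -> continuous (fun y => f y - g y) x.
Proof. intros; apply (continuous_minus (V := R_NormedModule)); assumption. Qed.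

Lemma Rint_plus (f g : R -> R) a b : ex_RInt f a b -> ex_RInt g a b ->
  Rint (fun x => f x + g x) a b = Rint f a b + Rint g a b .
Proof. exact (RInt_plus (V := R_CompleteNormedModule) f g a b). Qed.

Lemma Rint_minus (f g : R -> R) a b : ex_RInt f a b -> ex_RInt g a b ->
  Rint (fun x => f x - g x) a b = Rint f a b - Rint g a b .
Proof. exact (RInt_minus (V := R_CompleteNormedModule) f g a b). Qed.

Lemma Rint_scal (f : R -> R) a b (k : R) : ex_RInt f a b ->
  Rint (fun x => k * f x) a b = k * Rint f a b .
Proof. exact (RInt_scal (V := R_CompleteNormedModule) f a b k). Qed.

Lemma Rint_const a b (k : R) : Rint (fun _ => k) a b = (b - a) * k .
Proof. exact (RInt_const (V := R_CompleteNormedModule) a b k). Qed.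

Lemma Rint_ext (f g : R -> R) a b : (forall x, f x = g x) -> Rint f a b = Rint g a b .
Proof. intros H. apply (RInt_ext (V := R_CompleteNormedModule)). intros x _. apply H. Qed.

Lemma Rint_ext_in (f g : R -> R) a b : a <= b -> (forall x, a < x < b -> f x = g x) ->
  Rint f a b = Rint g a b.
Proof.
intros Hab H. apply (RInt_ext (V := R_CompleteNormedModule)).
rewrite Rmin_left, Rmax_right by exact Hab. exact H.
Qed.

Lemma Rint_Chasles (f : R -> R) a b c : ex_RInt f a b -> ex_RInt f b c ->
  Rint f a c = Rint f a b + Rint f b c .
Proof. intros; symmetry. now apply (RInt_Chasles (V := R_CompleteNormedModule) f a b c). Qed.

Lemma Rint_near_const (f : R -> R) a b k M :
  a <= b -> (forall x, a <= x <= b -> continuous f x) ->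
  (forall x, a <= x <= b -> Rabs (f x - k) <= M) -> Rabs (Rint f a b - k * (b - a)) <= M * (b - a).
Proof.
intros Hab Hc HM.
replace (Rint f a b - k * (b - a)) with (Rint (fun x => f x - k) a b).
- apply RInt_abs_le; [exact Hab| |exact HM].
  intros x Hx. apply continuous_Rminus; [now apply Hc|apply continuous_const].
- rewrite (Rint_minus f (fun _ => k)), Rint_const; [ring|now apply ex_RInt_ct|apply ex_RInt_const].
Qed.

Section Goursat.

Variables (P Q : R -> R -> R) (sigma : R).
Hypothesis D : forall s t, s < sigma -> closed_form P Q s t.

Let J := boundary_int P Q.

Lemma cont_P1 c s : s < sigma -> continuous (fun x => P x c) s.
Proof. intros H. destruct (D s c H) as (p & k & q & H1 & H2). eapply rdiff2_cont_1; eauto. Qed.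

Lemma cont_Q2 b t : b < sigma -> continuous (fun y => Q b y) t.
Proof. intros H. destruct (D b t H) as (p & k & q & H1 & H2). eapply rdiff2_cont_2; eauto. Qed.

Lemma exP a b c d : a <= b -> b < sigma -> ex_RInt (fun s => P s c - P s d) a b.
Proof.
intros. apply ex_RInt_ct; [assumption|]. intros. apply continuous_Rminus; apply cont_P1; lra.
Qed.

Lemma exQ a b c d : a < sigma -> b < sigma -> c <= d -> ex_RInt (fun t => Q b t - Q a t) c d.
Proof.
intros. apply ex_RInt_ct; [assumption|]. intros. apply continuous_Rminus; apply cont_Q2; lra.
Qed.

(** Each inner side is run through twice, in opposite directions. *)
Lemma J_split a m b c n d : a <= m <= b -> b < sigma -> c <= n <= d ->
  J a b c d = J a m c n + J m b c n + (J a m n d + J m b n d).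
Proof.
intros Ham Hb Hcn. unfold J, boundary_int.
rewrite (Rint_Chasles (fun s => P s c - P s d) a m b)
  by (apply exP; lra).
rewrite (Rint_Chasles (fun t => Q b t - Q a t) c n d)
  by (apply exQ; lra).
assert (EP : forall x y, x <= y -> y < sigma ->
  Rint (fun s => P s c - P s d) x y
  = Rint (fun s => P s c - P s n) x y + Rint (fun s => P s n - P s d) x y ).
{ intros x y Hxy Hy.
  rewrite <- Rint_plus by (apply exP; lra).
  apply Rint_ext. intros; ring. }
assert (EQ : forall x y, x <= y ->
  Rint (fun t => Q b t - Q a t) x y
  = Rint (fun t => Q m t - Q a t) x y + Rint (fun t => Q b t - Q m t) x y ).
{ intros x y Hxy.
  rewrite <- Rint_plus by (apply exQ; lra).
  apply Rint_ext. intros; ring. }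
rewrite !EP, !EQ by lra. ring.
Qed.

(** The affine parts of [P] and [Q] at (s, t) contribute k (c - d)(b - a) and k (b - a)(d - c),
    which cancel because [k] is common. What remains is eps times the half-perimeter, integrated
    over the sides. *)
Lemma J_local s t : s < sigma -> forall eps, 0 < eps -> exists dl, 0 < dl /\
  forall a b c d, a <= s <= b -> c <= t <= d -> b < sigma -> b - a < dl -> d - c < dl ->
  Rabs (J a b c d) <= eps * ((b - a) + (d - c)) ^ 2.
Proof.
intros Hs eps He. destruct (D s t Hs) as (p & k & q & H1 & H2).
destruct (H1 (eps / 2) ltac:(lra)) as [d1 [Hd1 B1]].
destruct (H2 (eps / 2) ltac:(lra)) as [d2 [Hd2 B2]].
exists (Rmin d1 d2). split; [apply Rmin_pos; assumption|].
intros a b c d Ha Hc Hb Hab Hcd.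
destruct (Rmin_Rgt_l _ _ _ Hab) as [X1 X2].
destruct (Rmin_Rgt_l _ _ _ Hcd) as [Y1 Y2].
set (L := (b - a) + (d - c)).
assert (A1 : Rabs (Rint (fun s => P s c - P s d) a b - k * (c - d) * (b - a)) <= (eps * L) * (b - a)).
{ apply Rint_near_const; [lra| |].
  - intros x Hx. apply continuous_Rminus; apply cont_P1; lra.
  - intros x Hx.
    assert (U1 := B1 x c ltac:(apply Rabs_def1; lra) ltac:(apply Rabs_def1; lra)).
    assert (U2 := B1 x d ltac:(apply Rabs_def1; lra) ltac:(apply Rabs_def1; lra)).
    replace (P x c - P x d - k * (c - d)) with
      ((P x c - P s t - p * (x - s) - k * (c - t)) - (P x d - P s t - p * (x - s) - k * (d - t))) by ring.
    eapply Rle_trans; [apply Rabs_triang|]. rewrite Rabs_Ropp.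
    assert (Rabs (x - s) <= b - a) by (apply Rabs_le; lra).
    assert (Rabs (c - t) + Rabs (d - t) = d - c) by (rewrite Rabs_left1, Rabs_pos_eq; lra).
    unfold L. nra. }
assert (A2 : Rabs (Rint (fun t => Q b t - Q a t) c d - k * (b - a) * (d - c)) <= (eps * L) * (d - c)).
{ apply Rint_near_const; [lra| |].
  - intros x Hx. apply continuous_Rminus; apply cont_Q2; lra.
  - intros x Hx.
    assert (U1 := B2 a x ltac:(apply Rabs_def1; lra) ltac:(apply Rabs_def1; lra)).
    assert (U2 := B2 b x ltac:(apply Rabs_def1; lra) ltac:(apply Rabs_def1; lra)).
    replace (Q b x - Q a x - k * (b - a)) with
      ((Q b x - Q s t - k * (b - s) - q * (x - t)) - (Q a x - Q s t - k * (a - s) - q * (x - t))) by ring.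
    eapply Rle_trans; [apply Rabs_triang|]. rewrite Rabs_Ropp.
    assert (Rabs (x - t) <= d - c) by (apply Rabs_le; lra).
    assert (Rabs (a - s) + Rabs (b - s) = b - a) by (rewrite Rabs_left1, Rabs_pos_eq; lra).
    unfold L. nra. }
pose proof (Rabs_triang _ _ : Rabs ((Rint (fun s => P s c - P s d) a b - k * (c - d) * (b - a)) +
  (Rint (fun t => Q b t - Q a t) c d - k * (b - a) * (d - c))) <= _) as T.
unfold J, boundary_int. replace (eps * L ^ 2) with (eps * L * (b - a) + eps * L * (d - c)) by (unfold L; ring).
eapply Rle_trans; [|eapply Rle_trans; [exact T|lra]]. right. f_equal. ring.
Qed.

(** Keeps a quarter with at least a fourth of |J|. The last one is not tested: if the other three
    fail, it succeeds by the triangle inequality. *)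
Definition quarter (r : R * R * R * R) : R * R * R * R :=
  let '(a, b, c, d) := r in
  let m := (a + b) / 2 in let n := (c + d) / 2 in
  let j := Rabs (J a b c d) / 4 in
  if Rle_dec j (Rabs (J a m c n)) then (a, m, c, n) else
  if Rle_dec j (Rabs (J m b c n)) then (m, b, c, n) else
  if Rle_dec j (Rabs (J a m n d)) then (a, m, n, d) else (m, b, n, d).

Lemma quarter_spec a b c d : a <= b -> b < sigma -> c <= d ->
  exists a' b' c' d', quarter (a, b, c, d) = (a', b', c', d') /\
    a <= a' /\ b' <= b /\ c <= c' /\ d' <= d /\ b' - a' = (b - a) / 2 /\ d' - c' = (d - c) / 2 /\
    Rabs (J a b c d) / 4 <= Rabs (J a' b' c' d').
Proof.
intros Hab Hb Hcd. unfold quarter.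
set (m := (a + b) / 2). set (n := (c + d) / 2).
assert (Hm : a <= m <= b) by (unfold m; lra). assert (Hn : c <= n <= d) by (unfold n; lra).
pose proof (J_split a m b c n d Hm Hb Hn) as S.
destruct (Rle_dec _ _) as [H1|H1];
[|destruct (Rle_dec _ _) as [H2|H2];[|destruct (Rle_dec _ _) as [H3|H3]]];
do 4 eexists; (split; [reflexivity|]); repeat split; try assumption; try (unfold m, n; lra).
pose proof (Rabs_triang (J a m c n + J m b c n) (J a m n d + J m b n d)) as T1.
pose proof (Rabs_triang (J a m c n) (J m b c n)).
pose proof (Rabs_triang (J a m n d) (J m b n d)). rewrite <- S in T1. lra.
Qed.

Lemma goursat a b c d : a <= b -> b < sigma -> c <= d -> J a b c d = 0.
Proof.
intros Hab Hb Hcd.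
set (seq := fix seq n := match n with O => (a, b, c, d) | S n => quarter (seq n) end).
set (A n := let '(x, _, _, _) := seq n in x).
set (B n := let '(_, x, _, _) := seq n in x).
set (C' n := let '(_, _, x, _) := seq n in x).
set (D' n := let '(_, _, _, x) := seq n in x).
set (Inv n := a <= A n /\ B n <= b /\ c <= C' n /\ D' n <= d /\
   B n - A n = (b - a) / 2 ^ n /\ D' n - C' n = (d - c) / 2 ^ n /\
   Rabs (J a b c d) / 4 ^ n <= Rabs (J (A n) (B n) (C' n) (D' n))).
assert (Next : forall n, Inv n -> Inv (S n) /\
   A n <= A (S n) /\ B (S n) <= B n /\ C' n <= C' (S n) /\ D' (S n) <= D' n).
{ intros n (H1 & H2 & H3 & H4 & H5 & H6 & H7).
  unfold Inv, A, B, C', D' in *. simpl seq.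
  assert (P2 : 0 < / 2 ^ n) by (apply Rinv_0_lt_compat, pow_lt; lra).
  destruct (seq n) as [[[x y] z] w].
  assert (0 <= (b - a) / 2 ^ n) by (unfold Rdiv; nra).
  assert (0 <= (d - c) / 2 ^ n) by (unfold Rdiv; nra).
  destruct (quarter_spec x y z w) as (x' & y' & z' & w' & E & K1 & K2 & K3 & K4 & K5 & K6 & K7);
    try lra.
  rewrite E. simpl pow. unfold Rdiv in *. rewrite !Rinv_mult. repeat split; lra. }
assert (I : forall n, Inv n /\
   A n <= A (S n) /\ B (S n) <= B n /\ C' n <= C' (S n) /\ D' (S n) <= D' n).
{ assert (G0 : forall n, Inv n).
  { induction n as [|n IH]; [|apply (Next n IH)].
    unfold Inv, A, B, C', D'; simpl. repeat split; lra. }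
  intros n. split; [apply G0|apply (Next n (G0 n))]. }
assert (HAB : forall n, A n <= B n).
{ intros n. destruct (I n) as [(_ & _ & _ & _ & H & _) _].
  assert (0 < / 2 ^ n) by (apply Rinv_0_lt_compat, pow_lt; lra). unfold Rdiv in H. nra. }
assert (HCD : forall n, C' n <= D' n).
{ intros n. destruct (I n) as [(_ & _ & _ & _ & _ & H & _) _].
  assert (0 < / 2 ^ n) by (apply Rinv_0_lt_compat, pow_lt; lra). unfold Rdiv in H. nra. }
(* Completeness gives a point (s, t) common to all rectangles, and the local estimate is applied at
   this point only. *)
assert (nest : forall U V : nat -> R, (forall n, U n <= U (S n)) -> (forall n, V (S n) <= V n) ->
   (forall n, U n <= V n) -> exists s, forall n, U n <= s <= V n).
{ intros U V HU HV HUV.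
  assert (MU : forall n k, U n <= U (n + k)%nat).
  { intros n k. induction k; [rewrite Nat.add_0_r; lra|].
    rewrite Nat.add_succ_r. specialize (HU (n + k)%nat). lra. }
  assert (MV : forall n k, V (n + k)%nat <= V n).
  { intros n k. induction k; [rewrite Nat.add_0_r; lra|].
    rewrite Nat.add_succ_r. specialize (HV (n + k)%nat). lra. }
  assert (UV : forall n k, U n <= V k).
  { intros n k. specialize (MU n k). specialize (MV k n). specialize (HUV (n + k)%nat).
    rewrite (Nat.add_comm k n) in MV. lra. }
  destruct (completeness (fun x => exists n, x = U n)) as [s [Hs1 Hs2]].
  - exists (V O). intros x [n ->]. apply UV.
  - exists (U O), O. reflexivity.
  - exists s. intros n. split; [apply Hs1; now exists n|].
    apply Hs2. intros x [k ->]. apply UV. }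
destruct (nest A B) as [s Hs]; [apply I|apply I|exact HAB|].
destruct (nest C' D') as [t Ht]; [apply I|apply I|exact HCD|].
assert (Hss : s < sigma).
{ destruct (I O) as [(_ & H & _) _]. specialize (Hs O). lra. }
set (L := (b - a) + (d - c)).
apply Rabs_eq_0, Rle_antisym; [|apply Rabs_pos].
apply le_epsilon. intros eps He. rewrite Rplus_0_l.
assert (HL : 0 <= L) by (unfold L; lra).
(* At stage n the half-perimeter is L / 2^n, so the local bound is eps / (L^2 + 1) times L^2 / 4^n,
   to be compared with |J| / 4^n: the powers of 4 cancel. The summand 1 covers L = 0. *)
destruct (J_local s t Hss (eps / (L ^ 2 + 1))) as [dl [Hdl H]].
{ apply Rdiv_lt_0_compat; [lra|]. nra. }
destruct (nfloor_ex (L / dl)) as [N HN].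
{ apply Rmult_le_pos; [lra|]. left; now apply Rinv_0_lt_compat. }
assert (HN2 : L / dl < 2 ^ S N).
{ assert (G : forall k, INR k + 1 <= 2 ^ k).
  { induction k as [|k IH]; [simpl; lra|]. rewrite S_INR. simpl.
    pose proof (pos_INR k). lra. }
  specialize (G (S N)). rewrite S_INR in G. lra. }
set (n := S N) in *.
assert (P2 : 0 < 2 ^ n) by (apply pow_lt; lra).
assert (HLd : L / 2 ^ n < dl).
{ apply Rlt_div_l; [exact P2|].
  apply (Rmult_lt_compat_l dl) in HN2; [|exact Hdl].
  unfold Rdiv in HN2. replace (dl * (L * / dl)) with L in HN2 by (field; lra). lra. }
destruct (I n) as [(I1 & I2 & I3 & I4 & I5 & I6 & I7) _].
assert (0 < / 2 ^ n) by (now apply Rinv_0_lt_compat).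
assert (EL : L / 2 ^ n = (b - a) / 2 ^ n + (d - c) / 2 ^ n) by (unfold L, Rdiv; ring).
assert (0 <= (b - a) / 2 ^ n) by (unfold Rdiv; nra).
assert (0 <= (d - c) / 2 ^ n) by (unfold Rdiv; nra).
specialize (H (A n) (B n) (C' n) (D' n) (Hs n) (Ht n) ltac:(lra) ltac:(lra) ltac:(lra)).
rewrite I5, I6, <- EL in H.
assert (E4 : 4 ^ n = 2 ^ n * 2 ^ n) by (rewrite <- Rpow_mult_distr; f_equal; lra).
assert (K : Rabs (J a b c d) <= eps / (L ^ 2 + 1) * L ^ 2).
{ apply (Rmult_le_reg_r (/ 4 ^ n)). { apply Rinv_0_lt_compat, pow_lt; lra. }
  eapply Rle_trans; [apply I7|]. eapply Rle_trans; [apply H|]. right.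
  rewrite E4. field. repeat split; nra. }
eapply Rle_trans; [exact K|].
apply (Rmult_le_reg_r (L ^ 2 + 1)); [nra|]. field_simplify; nra.
Qed.

End Goursat.

Definition I2pi (f : R -> R) : R := Rint f 0 (2 * PI).

(** Over a rectangle one period high the horizontal sides cancel, and the vertical ones are the two
    means. *)
Lemma mean_const_real (P Q : R -> R -> R) (sigma : R) :
  (forall s t, s < sigma -> closed_form P Q s t) ->
  (forall s, s < sigma -> P s (2 * PI) = P s 0) ->
  forall a b, a <= b -> b < sigma -> I2pi (Q a) = I2pi (Q b).
Proof.
intros D Per a b Hab Hb. pose proof PI_RGT_0.
pose proof (goursat P Q sigma D a b 0 (2 * PI) Hab Hb ltac:(lra)) as G.
unfold boundary_int in G.
rewrite (Rint_ext_in (fun s => P s 0 - P s (2 * PI)) (fun _ => 0) a b Hab) in G.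
2:{ intros x Hx. rewrite Per by lra. ring. }
rewrite Rint_const in G.
rewrite (Rint_minus (Q b) (Q a)) in G.
2,3: apply ex_RInt_ct; [lra|]; intros x _; eapply cont_Q2; eauto; lra.
unfold I2pi. lra.
Qed.

(** The imaginary part of F dw is Im F ds + Re F dt. It is closed by the Cauchy-Riemann equations,
    here read off from the complex derivative [l]: both mixed derivatives are Re l. *)
Lemma mean_const_Re (F : C -> C) (sigma : R) :
  (forall w : C, Re w < sigma -> exists l, cdiff F w l) ->
  (forall s t, s < sigma -> F (s, t + 2 * PI) = F (s, t)) ->
  forall a b, a <= b -> b < sigma ->
  I2pi (fun t => Re (F (a, t))) = I2pi (fun t => Re (F (b, t))).
Proof.
intros D Per a b Hab Hb.
apply (mean_const_real (fun x y => Im (F (x, y))) (fun x y => Re (F (x, y))) sigma); auto.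
2:{ intros s Hs. rewrite <- (Rplus_0_l (2 * PI)), Per; auto. }
intros s t Hs. destruct (D (s, t) Hs) as [l H].
assert (K : forall eps, 0 < eps -> exists d, 0 < d /\ forall x y,
  Rabs (x - s) < d -> Rabs (y - t) < d ->
  Cmod (F (x, y) - F (s, t) - l * ((x - s)%R, (y - t)%R))%C <= eps * (Rabs (x - s) + Rabs (y - t))).
{ intros eps He. destruct (H eps He) as [d [Hd H']]. exists (d / 2). split; [lra|].
  intros x y Hx Hy.
  assert (T : Cmod (x - s, y - t) <= Rabs (x - s) + Rabs (y - t)).
  { replace (x - s, y - t) with ((x - s)%R + Ci * (y - t)%R)%C
      by (apply C_ext; simpl; ring).
    eapply Rle_trans; [apply Cmod_triangle|]. rewrite Cmod_mult, Cmod_Ci, !Cmod_R. lra. }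
  specialize (H' (x - s, y - t) ltac:(lra)).
  replace ((s, t) + ((x - s)%R, (y - t)%R))%C with (x, y) in H' by (apply C_ext; simpl; ring).
  eapply Rle_trans; [exact H'|]. apply Rmult_le_compat_l; lra. }
exists (Im l), (Re l), (- Im l).
split; intros eps He; destruct (K eps He) as [d [Hd K']]; exists d; (split; [exact Hd|]);
intros x y Hx Hy; (eapply Rle_trans; [|exact (K' x y Hx Hy)]); (eapply Rle_trans; [|apply Rmax_Cmod]).
- eapply Rle_trans; [|apply Rmax_r]. right. f_equal. unfold Re, Im; simpl; ring.
- eapply Rle_trans; [|apply Rmax_l]. right. f_equal. unfold Re, Im; simpl; ring.
Qed.

Lemma mean_const (F : C -> C) (sigma : R) :
  (forall w : C, Re w < sigma -> exists l, cdiff F w l) ->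
  (forall s t, s < sigma -> F (s, t + 2 * PI) = F (s, t)) ->
  forall a b, a <= b -> b < sigma ->
  I2pi (fun t => Re (F (a, t))) = I2pi (fun t => Re (F (b, t))) /\
  I2pi (fun t => Im (F (a, t))) = I2pi (fun t => Im (F (b, t))).
Proof.
intros D Per a b Hab Hb. split; [now apply (mean_const_Re F sigma)|].
assert (E : forall s, I2pi (fun t => Im (F (s, t))) = I2pi (fun t => Re (- Ci * F (s, t))%C)).
{ intros s. apply Rint_ext. intros t. unfold Re, Im; simpl; ring. }
rewrite !E. apply (mean_const_Re (fun w => - Ci * F w)%C sigma); try assumption.
- intros w Hw. destruct (D w Hw) as [l Hl]. eexists.
  apply (cdiff_mult (fun _ => - Ci)%C F w _ l (cdiff_const _ w) Hl).
- intros s t Hs. now rewrite Per.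
Qed.

(** * Circular means and roots of polynomials *)

Lemma Rabs_sin_le (x : R) : Rabs (sin x) <= Rabs x.
Proof.
assert (G : forall y, 0 <= y -> Rabs (sin y) <= y).
{ intros y Hy. destruct (Rle_lt_dec y 1) as [H1|H1].
  - rewrite Rabs_pos_eq.
    + destruct Hy as [Hy|<-]; [left; now apply sin_lt_x|rewrite sin_0; lra].
    + apply sin_ge_0; [exact Hy|]. pose proof PI2_1. lra.
  - eapply Rle_trans; [|left; exact H1]. apply Rabs_le, SIN_bound. }
destruct (Rle_lt_dec 0 x) as [H|H].
- rewrite (Rabs_pos_eq x H). now apply G.
- rewrite (Rabs_left x H), <- Rabs_Ropp, <- sin_neg. apply G. lra.
Qed.

Lemma Cmod2 (z : C) : Cmod z * Cmod z = Re z * Re z + Im z * Im z.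
Proof. unfold Cmod, Re, Im. rewrite sqrt_sqrt; [ring|]. nra. Qed.

Lemma cis_dist2 (a b : R) : Cmod (cis a - cis b) * Cmod (cis a - cis b) = 2 - 2 * cos (a - b).
Proof.
rewrite Cmod2, cos_minus. unfold Re, Im; simpl.
pose proof (sin2_cos2 a). pose proof (sin2_cos2 b). unfold Rsqr in *. nra.
Qed.

Lemma cis_lip (a b : R) : Cmod (cis a - cis b) <= Rabs (a - b).
Proof.
pose proof (cis_dist2 a b) as H. set (x := a - b) in *.
replace (cos x) with (cos (2 * (x / 2))) in H by (f_equal; field).
rewrite cos_2a_sin in H. pose proof (Rabs_sin_le (x / 2)) as S.
pose proof (Cmod_ge_0 (cis a - cis b)%C) as M.
assert (E : Rabs x = 2 * Rabs (x / 2)).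
{ unfold Rdiv. rewrite Rabs_mult, (Rabs_pos_eq (/ 2)) by lra. field. }
pose proof (Rabs_pos (sin (x / 2))).
assert (sin (x / 2) * sin (x / 2) = Rabs (sin (x / 2)) * Rabs (sin (x / 2))).
{ rewrite <- Rabs_mult, Rabs_pos_eq; nra. }
nra.
Qed.

Lemma cis_plus (a b : R) : cis (a + b) = (cis a * cis b)%C.
Proof. unfold cis. rewrite cos_plus, sin_plus. apply C_ext; simpl; ring. Qed.

Lemma cexp_cis (r t : R) : 0 < r -> cexp (ln r, t) = (r * cis t)%C.
Proof. intros Hr. unfold cexp, cis; simpl. rewrite exp_ln by exact Hr. apply C_ext; simpl; ring. Qed.

Lemma Rabs_Re_le (z : C) : Rabs (Re z) <= Cmod z.
Proof. exact (Rle_trans _ _ _ (Rmax_l _ _) (Rmax_Cmod z)). Qed.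

Lemma Rabs_Im_le (z : C) : Rabs (Im z) <= Cmod z.
Proof. exact (Rle_trans _ _ _ (Rmax_r _ _) (Rmax_Cmod z)). Qed.

(** * Continuous functions and their integrals over a period *)

Definition ct (f : R -> R) : Prop := forall x, continuous f x.

Lemma ct_const c : ct (fun _ => c).
Proof. intros x. apply continuous_const. Qed.
Lemma ct_plus f g : ct f -> ct g -> ct (fun x => f x + g x).
Proof. intros F G x. apply (continuous_plus (V := R_NormedModule)); auto. Qed.
Lemma ct_minus f g : ct f -> ct g -> ct (fun x => f x - g x).
Proof. intros F G x. apply (continuous_minus (V := R_NormedModule)); auto. Qed.
Lemma ct_mult f g : ct f -> ct g -> ct (fun x => f x * g x).
Proof. intros F G x. apply (continuous_mult (K := R_AbsRing)); auto. Qed.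
Lemma ct_scal k f : ct f -> ct (fun x => k * f x).
Proof. apply ct_mult, ct_const. Qed.
Lemma ct_ext f g : (forall x, f x = g x) -> ct f -> ct g.
Proof. intros E F x. apply (continuous_ext f); auto. Qed.
Lemma ct_derive f : (forall x, ex_derive f x) -> ct f.
Proof. intros H x. apply (ex_derive_continuous (K := R_AbsRing) (V := R_NormedModule)), H. Qed.

Lemma ct_ex f a b : ct f -> ex_RInt f a b.
Proof. intros H. apply (ex_RInt_continuous (V := R_CompleteNormedModule)). intros; apply H. Qed.

Lemma twopi_pos : 0 < 2 * PI.
Proof. pose proof PI_RGT_0; lra. Qed.

Lemma I2pi_ext f g : (forall x, f x = g x) -> I2pi f = I2pi g.
Proof. intros H. now apply Rint_ext. Qed.
Lemma I2pi_const k : I2pi (fun _ => k) = 2 * PI * k.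
Proof. unfold I2pi. rewrite Rint_const. ring. Qed.
Lemma I2pi_plus f g : ct f -> ct g -> I2pi (fun x => f x + g x) = I2pi f + I2pi g.
Proof. intros; apply Rint_plus; now apply ct_ex. Qed.
Lemma I2pi_minus f g : ct f -> ct g -> I2pi (fun x => f x - g x) = I2pi f - I2pi g.
Proof. intros; apply Rint_minus; now apply ct_ex. Qed.
Lemma I2pi_scal k f : ct f -> I2pi (fun x => k * f x) = k * I2pi f.
Proof. intros; apply Rint_scal; now apply ct_ex. Qed.
Lemma I2pi_le f g : ct f -> ct g -> (forall x, f x <= g x) -> I2pi f <= I2pi g.
Proof.
intros F G H. pose proof twopi_pos.
apply RInt_le; [lra|now apply ct_ex|now apply ct_ex|]. intros; apply H.
Qed.
Lemma I2pi_abs f M : ct f -> (forall x, Rabs (f x) <= M) -> Rabs (I2pi f) <= 2 * PI * M.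
Proof.
intros F H. pose proof twopi_pos. unfold I2pi.
eapply Rle_trans; [apply (RInt_abs_le f 0 (2 * PI) M); auto; lra|]. right; ring.
Qed.

Definition cct (f : R -> C) : Prop := ct (fun t => Re (f t)) /\ ct (fun t => Im (f t)).
Definition cI (f : R -> C) : C := (I2pi (fun t => Re (f t)), I2pi (fun t => Im (f t))).

Lemma cct_lip (f : C -> C) (p : R -> C) :
  (forall t, exists l, cdiff f (p t) l) ->
  (forall t eps, 0 < eps -> exists d, 0 < d /\ forall s, Rabs (s - t) < d -> Cmod (p s - p t) < eps) ->
  cct (fun t => f (p t)).
Proof.
intros H L.
assert (G : forall t eps, 0 < eps -> exists d, 0 < d /\ forall s, Rabs (s - t) < d ->
   Cmod (f (p s) - f (p t))%C < eps).
{ intros t eps He. destruct (H t) as [l Hl].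
  destruct (cdiff_ccont _ _ _ Hl eps He) as [d [Hd H']].
  destruct (L t d Hd) as [d' [Hd' H'']]. exists d'; split; [exact Hd'|].
  intros s Hs. apply H', H'', Hs. }
split; intros t; apply continuous_eps; intros eps He;
destruct (G t eps He) as [d [Hd H']]; exists d; (split; [exact Hd|]); intros s Hs;
(eapply Rle_lt_trans; [|apply (H' s Hs)]).
- eapply Rle_trans; [|apply Rabs_Re_le]. right; f_equal.
- eapply Rle_trans; [|apply Rabs_Im_le]. right; f_equal.
Qed.

Lemma cct_circle (f : C -> C) (r : R) : 0 <= r ->
  (forall z : C, Cmod z = r -> exists l, cdiff f z l) -> cct (fun t => f (r * cis t)%C).
Proof.
intros Hr H. apply (cct_lip f (fun t => r * cis t)%C).
- intros t. now apply H, Cmod_polar.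
- intros t eps He. exists (eps / (r + 1)). split; [apply Rdiv_lt_0_compat; lra|].
  intros s Hs. replace (r * cis s - r * cis t)%C with (r * (cis s - cis t))%C by ring.
  rewrite Cmod_mult, Cmod_R, Rabs_pos_eq by exact Hr.
  pose proof (cis_lip s t). apply (Rmult_lt_compat_l (r + 1)) in Hs; [|lra].
  replace ((r + 1) * (eps / (r + 1))) with eps in Hs by (field; lra).
  pose proof (Cmod_ge_0 (cis s - cis t)%C). nra.
Qed.

Lemma cct_plus f g : cct f -> cct g -> cct (fun t => f t + g t)%C.
Proof. intros [A B] [A' B']. split; [apply (ct_plus _ _ A A')|apply (ct_plus _ _ B B')]. Qed.
Lemma cct_minus f g : cct f -> cct g -> cct (fun t => f t - g t)%C.
Proof. intros [A B] [A' B']. split; [apply (ct_minus _ _ A A')|apply (ct_minus _ _ B B')]. Qed.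
Lemma cct_const c : cct (fun _ => c).
Proof. split; apply ct_const. Qed.
Lemma cct_mult f g : cct f -> cct g -> cct (fun t => f t * g t)%C.
Proof.
intros [A B] [A' B']. split.
- apply (ct_minus _ _ (ct_mult _ _ A A') (ct_mult _ _ B B')).
- apply (ct_plus _ _ (ct_mult _ _ A B') (ct_mult _ _ B A')).
Qed.
Lemma cct_RtoC f : ct f -> cct (fun t => RtoC (f t)).
Proof. intros H; split; [exact H|exact (ct_const 0)]. Qed.

Lemma cI_ext f g : (forall t, f t = g t) -> cI f = cI g.
Proof. intros H. apply C_ext; apply I2pi_ext; intros; now rewrite H. Qed.
Lemma cI_const c : cI (fun _ => c) = (2 * PI * c)%C.
Proof.
apply C_ext; simpl; rewrite I2pi_const; unfold Re, Im; simpl; ring.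
Qed.
Lemma cI_plus f g : cct f -> cct g -> cI (fun t => f t + g t)%C = (cI f + cI g)%C.
Proof. intros [A B] [A' B']. apply C_ext; simpl; now apply I2pi_plus. Qed.
Lemma cI_minus f g : cct f -> cct g -> cI (fun t => f t - g t)%C = (cI f - cI g)%C.
Proof. intros [A B] [A' B']. apply C_ext; simpl; now apply I2pi_minus. Qed.
Lemma cI_scal c f : cct f -> cI (fun t => c * f t)%C = (c * cI f)%C.
Proof.
intros [A B]. apply C_ext.
- transitivity (I2pi (fun t => Re c * Re (f t) - Im c * Im (f t))); [reflexivity|].
  rewrite (I2pi_minus (fun t => Re c * Re (f t)) (fun t => Im c * Im (f t))).
  + rewrite !I2pi_scal by assumption. reflexivity.
  + apply ct_scal; exact A.
  + apply ct_scal; exact B.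
- transitivity (I2pi (fun t => Re c * Im (f t) + Im c * Re (f t))); [reflexivity|].
  rewrite (I2pi_plus (fun t => Re c * Im (f t)) (fun t => Im c * Re (f t))).
  + rewrite !I2pi_scal by assumption. reflexivity.
  + apply ct_scal; exact B.
  + apply ct_scal; exact A.
Qed.

(** A rotation by minus the argument of the integral turns the integral into its modulus; the real
    part of the rotated integrand is then estimated pointwise. *)
Lemma cI_norm f g : cct f -> ct g -> (forall t, Cmod (f t) <= g t) -> Cmod (cI f) <= I2pi g.
Proof.
intros Hf Hg H. destruct (polar (cI f)) as [a [_ Ha]].
assert (E : cI (fun t => cis (- a) * f t)%C = RtoC (Cmod (cI f))).
{ rewrite cI_scal by exact Hf. rewrite Ha at 1.
  replace (cis (- a) * (Cmod (cI f) * cis a))%C with (Cmod (cI f) * (cis (- a) * cis a))%C by ring.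
  rewrite <- cis_plus. replace (- a + a) with 0 by ring.
  unfold cis. rewrite cos_0, sin_0. change (1, 0) with (RtoC 1). ring. }
apply (f_equal Re) in E. simpl in E. rewrite <- E.
apply I2pi_le; [|exact Hg|].
- apply (cct_mult (fun _ => cis (- a)) f); [apply cct_const|exact Hf].
- intros t. eapply Rle_trans; [|apply H]. eapply Rle_trans; [apply Rle_abs|].
  eapply Rle_trans; [apply (Rabs_Re_le (cis (- a) * f t)%C)|].
  rewrite Cmod_mult, Cmod_cis. lra.
Qed.

Lemma cI_norm_const f M : cct f -> (forall t, Cmod (f t) <= M) -> Cmod (cI f) <= 2 * PI * M.
Proof.
intros Hf H. rewrite <- I2pi_const. apply cI_norm; [exact Hf|apply ct_const|exact H].
Qed.

(** The exponential maps the half-plane Re w < ln rho onto the punctured disc, so the function may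
    be singular at 0; this is what allows division by powers of z. *)
Lemma punctured_mean (g : C -> C) (rho : R) :
  (forall z : C, 0 < Cmod z < rho -> exists l, cdiff g z l) ->
  forall a b, 0 < a < rho -> 0 < b < rho ->
  cI (fun t => g (a * cis t)%C) = cI (fun t => g (b * cis t)%C).
Proof.
intros D.
assert (G : forall a b, 0 < a -> a <= b -> b < rho ->
  cI (fun t => g (a * cis t)%C) = cI (fun t => g (b * cis t)%C)).
{ intros a b Ha Hab Hb.
  assert (Hln : ln a <= ln b). { destruct Hab as [Hab| ->]; [left; apply ln_increasing; lra|lra]. }
  destruct (mean_const (fun w => g (cexp w)) (ln rho)) with (a := ln a) (b := ln b) as [M1 M2].
  - intros w Hw. destruct (D (cexp w)) as [l Hl].
    + rewrite Cmod_cexp. split; [apply exp_pos|].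
      rewrite <- (exp_ln rho) by lra. now apply exp_increasing.
    + eexists. apply (cdiff_comp g cexp w l _ Hl (cdiff_cexp w)).
  - intros s t _. f_equal. unfold cexp; simpl. now rewrite sin_plus, cos_plus, cos_2PI, sin_2PI,
      !Rmult_0_r, !Rmult_1_r, Rplus_0_r, Rminus_0_r.
  - exact Hln.
  - apply ln_increasing; lra.
  - apply C_ext; simpl.
    + etransitivity; [|etransitivity; [apply M1|]]; apply I2pi_ext; intros t; rewrite cexp_cis; auto; lra.
    + etransitivity; [|etransitivity; [apply M2|]]; apply I2pi_ext; intros t; rewrite cexp_cis; auto; lra. }
intros a b Ha Hb. destruct (Rle_lt_dec a b); [apply G; lra|symmetry; apply G; lra].
Qed.

Lemma circle_mean (g : C -> C) (rho : R) :
  (forall z : C, Cmod z < rho -> exists l, cdiff g z l) ->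
  forall r, 0 < r < rho -> cI (fun t => g (r * cis t)%C) = (2 * PI * g 0)%C.
Proof.
intros D r Hr. pose proof twopi_pos as TP.
assert (Z : Cmod (cI (fun t => g (r * cis t)%C) - 2 * PI * g 0)%C = 0).
2:{ apply Cmod_eq_0 in Z. 
  replace (cI (fun t => g (r * cis t)%C)) with
    (cI (fun t => g (r * cis t)%C) - 2 * PI * g 0 + 2 * PI * g 0)%C by ring.
  rewrite Z. ring. }
apply Rle_antisym; [|apply Cmod_ge_0]. apply le_epsilon. intros eps He. rewrite Rplus_0_l.
destruct (D 0) as [l Hl]; [rewrite Cmod_0; lra|].
destruct (cdiff_ccont _ _ _ Hl (eps / (2 * PI))) as [d [Hd H]]; [now apply Rdiv_lt_0_compat|].
(* The mean is moved to a circle so small that [g] is within eps / (2 pi) of [g 0] on it. *)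
set (a := Rmin r (d / 2)).
assert (Ha : 0 < a) by (apply Rmin_pos; lra).
assert (Har : a <= r) by apply Rmin_l. assert (Had : a <= d / 2) by apply Rmin_r.
rewrite (punctured_mean g rho) with (b := a); [| |exact Hr|lra].
2:{ intros z Hz. apply D. lra. }
rewrite <- cI_const.
assert (CC : cct (fun t => g (a * cis t)%C)).
{ apply cct_circle; [lra|]. intros z Hz. apply D. lra. }
rewrite <- (cI_minus (fun t => g (a * cis t)%C) (fun _ => g 0)) by (try apply cct_const; exact CC).
eapply Rle_trans.
- apply (cI_norm_const _ (eps / (2 * PI))); [apply cct_minus; [exact CC|apply cct_const]|].
  intros t. left. apply H. replace (a * cis t - 0)%C with (a * cis t)%C by ring.
  rewrite Cmod_polar; lra.
- right. field. lra.
Qed.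

(** * Polynomials: growth, roots, factorisation *)

Fixpoint peval (l : list C) (z : C) : C :=
  match l with nil => 0%C | a :: l => (a + z * peval l z)%C end.

Lemma peval_cdiff (l : list C) (z : C) : exists d, cdiff (peval l) z d.
Proof.
induction l as [|a l [d Hd]]; simpl.
- eexists. apply cdiff_const.
- eexists. apply (cdiff_plus (fun _ => a) (fun z => z * peval l z)%C).
  + apply cdiff_const.
  + apply (cdiff_mult (fun z => z) (peval l)); [apply cdiff_id|exact Hd].
Qed.

(** Induction along Horner's scheme. A tail that is large far out stays large when multiplied by z
    with |z| >= 1; a constant tail gives an affine function, which is constant or tends to
    infinity. *)
Lemma peval_growth (l : list C) :
  (forall z, peval l z = peval l 0) \/
  (forall B : R, exists rho, 0 < rho /\ forall z, rho <= Cmod z -> B <= Cmod (peval l z)).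
Proof.
induction l as [|a l IH]; simpl; [left; reflexivity|].
assert (T : forall z w : C, Cmod w - Cmod a <= Cmod (a + w)).
{ intros _ w. pose proof (Cmod_sub_le w (- a))%C as T. rewrite Cmod_opp in T.
  now replace (w - - a)%C with (a + w)%C in T by ring. }
destruct IH as [H|H].
- destruct (Ceq_dec (peval l 0) 0) as [E|E].
  + left. intros z. rewrite H, E. ring.
  + right. intros B. assert (Hm := proj1 (Cmod_gt_0 _) E). set (m := Cmod (peval l 0)) in *.
    exists (Rmax 1 ((B + Cmod a) / m)). split; [apply Rlt_le_trans with 1; [lra|apply Rmax_l]|].
    intros z Hz. rewrite H.
    eapply Rle_trans; [|apply (T z)]. rewrite Cmod_mult. fold m.
    assert (K : (B + Cmod a) / m <= Cmod z) by (eapply Rle_trans; [apply Rmax_r|exact Hz]).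
    apply (Rmult_le_compat_r m) in K; [|lra]. unfold Rdiv in K.
    rewrite Rmult_assoc, Rinv_l in K by lra. lra.
- right. intros B. destruct (H (Rmax 0 (B + Cmod a))) as [rho [Hr H']].
  exists (Rmax 1 rho). split; [apply Rlt_le_trans with 1; [lra|apply Rmax_l]|].
  intros z Hz. eapply Rle_trans; [|apply (T z)]. rewrite Cmod_mult.
  assert (H1 : 1 <= Cmod z) by (eapply Rle_trans; [apply Rmax_l|exact Hz]).
  specialize (H' z (Rle_trans _ _ _ (Rmax_r _ _) Hz)).
  pose proof (Rmax_l 0 (B + Cmod a)). pose proof (Rmax_r 0 (B + Cmod a)). nra.
Qed.

(* A zero-free nonconstant polynomial [p] would have [1/p] of mean [1/p 0] on
   every circle and tending to 0 at infinity. *)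
Lemma poly_root (l : list C) :
  (exists z, peval l z <> peval l 0) -> exists z, peval l z = 0.
Proof.
intros [z0 Hz0]. destruct (peval_growth l) as [H|Gr]; [now elim Hz0|].
destruct (classic (exists z, peval l z = 0)) as [|N]; [assumption|exfalso].
assert (N' : forall z, peval l z <> 0) by (intros z E; apply N; now exists z).
pose proof twopi_pos as TP.
set (g := fun z => (/ peval l z)%C).
assert (D : forall z, exists d, cdiff g z d).
{ intros z. destruct (peval_cdiff l z) as [d Hd]. eexists.
  apply (cdiff_comp (fun w => / w)%C (peval l) z _ d (cdiff_inv _ (N' z)) Hd). }
set (m := Cmod (g 0)).
assert (Hm : 0 < m).
{ unfold m, g. rewrite Cmod_inv by apply N'. apply Rinv_0_lt_compat. apply Cmod_gt_0, N'. }
destruct (Gr (2 / m)) as [rho [Hr H]].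
pose proof (circle_mean g (rho + 1)) as M. specialize (M (fun z _ => D z) rho ltac:(lra)).
assert (K : Cmod (cI (fun t => g (rho * cis t)%C)) <= 2 * PI * (m / 2)).
{ apply cI_norm_const.
  - apply cct_circle; [lra|]. intros; apply D.
  - intros t. unfold g. rewrite Cmod_inv by apply N'.
    replace (m / 2) with (/ (2 / m)) by (field; lra).
    apply Rinv_le_contravar; [apply Rdiv_lt_0_compat; lra|]. apply H.
    rewrite Cmod_polar; lra. }
rewrite M, !Cmod_mult, !Cmod_R in K. fold m in K. rewrite !Rabs_pos_eq in K by lra. nra.
Qed.

Lemma poly_div (l : list C) (a : C) : exists l',
  length l' = pred (length l) /\ forall z, peval l z = (peval l a + (z - a) * peval l' z)%C.
Proof.
induction l as [|c l [l' [Hl H]]]; [exists nil; split; [reflexivity|intros; simpl; ring]|].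
destruct l as [|b l].
- exists nil. split; [reflexivity|]. intros; simpl; ring.
- exists (peval (b :: l) a :: l'). split; [simpl in *; lia|].
  intros z. change (peval (c :: b :: l) z) with (c + z * peval (b :: l) z)%C.
  change (peval (c :: b :: l) a) with (c + a * peval (b :: l) a)%C.
  rewrite (H z). simpl. ring.
Qed.

(** The factors have value 1 at 0, [b] being the inverse of a root. A zero lies inside the circle of
    radius r exactly when |b| r > 1, and the value at 0 never enters Jensen's formula. *)
Definition pprod (bs : list C) (z : C) : C :=
  fold_right (fun b x => (1 - b * z) * x)%C (RtoC 1) bs.

(** The induction is on the length of the list rather than the degree, since the list may end in
    zeros; division by a root shortens it in any case. *)
Lemma poly_factor (l : list C) : peval l 0 <> 0 ->
  exists bs, forall z, peval l z = (peval l 0 * pprod bs z)%C.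
Proof.
remember (length l) as n eqn:En. revert l En.
induction n as [|n IH]; intros l En H0.
- destruct l; [|discriminate]. now elim H0.
- destruct (classic (exists z, peval l z <> peval l 0)) as [E|E].
  + destruct (poly_root l E) as [a Ha].
    destruct (poly_div l a) as [l' [Hl' D]].
    assert (Han : a <> 0) by (intros ->; now apply H0).
    assert (E0 : peval l 0 = (- a * peval l' 0)%C) by (rewrite D, Ha; ring).
    destruct (IH l') as [bs Hbs].
    * rewrite Hl', <- En. reflexivity.
    * intros K. apply H0. rewrite E0, K. ring.
    * exists (/ a :: bs)%C. intros z. rewrite E0, D, Ha, Hbs. simpl. field. exact Han.
  + exists nil. intros z. simpl.
    destruct (Ceq_dec (peval l z) (peval l 0)) as [->|K]; [ring|]. elim E. now exists z.
Qed.

(** * Fejer means *)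

Lemma cis_pow (t : R) (n : nat) : (cis t ^ n)%C = cis (INR n * t).
Proof.
induction n as [|n IH].
- simpl. rewrite Rmult_0_l. unfold cis. now rewrite cos_0, sin_0.
- simpl Cpow. rewrite IH, <- cis_plus. f_equal. rewrite S_INR. ring.
Qed.

Lemma cdiff_pow (n : nat) (z : C) : exists l, cdiff (fun w => w ^ n)%C z l.
Proof.
induction n as [|n [l Hl]]; simpl.
- eexists. apply cdiff_const.
- eexists. apply (cdiff_mult (fun w => w) (fun w => w ^ n)%C); [apply cdiff_id|exact Hl].
Qed.

Lemma cdiff_div_pow (f : C -> C) (n : nat) (z l : C) : z <> 0 -> cdiff f z l ->
  exists l', cdiff (fun w => f w * / w ^ n)%C z l'.
Proof.
intros Hz Hl. destruct (cdiff_pow n z) as [l' Hl'].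
pose proof (cdiff_comp _ _ _ _ _ (cdiff_inv _ (Cpow_nz _ n Hz)) Hl') as H.
eexists. exact (cdiff_mult _ _ _ _ _ Hl H).
Qed.

Lemma cct_cis (k a : R) : cct (fun t => cis (k * t + a)).
Proof.
split; apply ct_derive; intros x; unfold cis, Re, Im; simpl; auto_derive; exact I.
Qed.

Lemma I2pi_cos (n : nat) (a : R) : (1 <= n)%nat -> I2pi (fun t => cos (INR n * t + a)) = 0.
Proof.
intros Hn. assert (Hp : 0 < INR n) by (apply lt_0_INR; lia).
assert (H : is_RInt (fun t => cos (INR n * t + a)) 0 (2 * PI)
  (sin (INR n * (2 * PI) + a) / INR n - sin (INR n * 0 + a) / INR n)).
{ apply (is_RInt_derive (V := R_CompleteNormedModule) (fun t => sin (INR n * t + a) / INR n)).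
  - intros x _. auto_derive; [exact I|]. field. lra.
  - intros x _. apply (ct_derive (fun t => cos (INR n * t + a))). intros y. auto_derive. exact I. }
unfold I2pi, Rint. rewrite (is_RInt_unique _ _ _ _ H).
replace (INR n * (2 * PI) + a) with (a + 2 * INR n * PI) by ring.
rewrite sin_period, Rmult_0_r, Rplus_0_l. apply Rminus_diag.
Qed.

Fixpoint dirichlet (n : nat) (s : R) : R :=
  match n with O => 1 | S m => dirichlet m s + 2 * cos (INR n * s) end.

(* [K] times the Fejer kernel. *)
Fixpoint fejer (K : nat) (s : R) : R :=
  match K with O => 0 | S m => fejer m s + dirichlet m s end.

(** Multiplied by the squared chord 2 - 2 cos s the cosines telescope; a quotient of sines would
    have to exclude the multiples of 2 pi. *)
Lemma dirichlet_closed n s :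
  dirichlet n s * (2 - 2 * cos s) = 2 * cos (INR n * s) - 2 * cos (INR (S n) * s).
Proof.
induction n as [|n IH].
- simpl. rewrite Rmult_0_l, cos_0, !Rmult_1_l. ring.
- change (dirichlet (S n) s) with (dirichlet n s + 2 * cos (INR (S n) * s)).
  rewrite Rmult_plus_distr_r, IH, !S_INR.
  replace ((INR n + 1 + 1) * s) with ((INR n + 1) * s + s) by ring.
  replace (INR n * s) with ((INR n + 1) * s - s) by ring.
  rewrite cos_plus, cos_minus. ring.
Qed.

Lemma fejer_closed K s : fejer K s * (2 - 2 * cos s) = 2 - 2 * cos (INR K * s).
Proof.
induction K as [|K IH].
- simpl. rewrite !Rmult_0_l, cos_0. ring.
- change (fejer (S K) s) with (fejer K s + dirichlet K s).
  rewrite Rmult_plus_distr_r, IH, dirichlet_closed. ring.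
Qed.

Lemma fejer_pos K s : 0 <= fejer K s.
Proof.
pose proof (fejer_closed K s) as H. pose proof (COS_bound (INR K * s)).
(* Where cos s = 1 the closed form reads 0 = 0; but there every cosine in the sum is 1, so the
   kernel is a sum of positive terms. *)
destruct (Req_dec (cos s) 1) as [E|E].
- assert (S0 : sin s = 0).
  { pose proof (sin2_cos2 s) as T. rewrite E in T. unfold Rsqr in T. nra. }
  assert (G : forall n, cos (INR n * s) = 1 /\ sin (INR n * s) = 0).
  { induction n as [|n [IH1 IH2]]; [simpl; rewrite Rmult_0_l; now rewrite cos_0, sin_0|].
    rewrite S_INR. replace ((INR n + 1) * s) with (INR n * s + s) by ring.
    rewrite cos_plus, sin_plus, IH1, IH2, E, S0. split; ring. }
  assert (Dp : forall n, 0 <= dirichlet n s).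
  { induction n as [|n IH]; [simpl; lra|]. cbn [dirichlet]. rewrite (proj1 (G (S n))). lra. }
  clear H. induction K as [|K IH]; [simpl; lra|].
  change (fejer (S K) s) with (fejer K s + dirichlet K s). specialize (Dp K).
  pose proof (COS_bound (INR K * s)). specialize (IH ltac:(lra)). lra.
- pose proof (COS_bound s). assert (0 < 2 - 2 * cos s) by lra. nra.
Qed.

Lemma fejer_tail K s t : Cmod (cis s - cis t) ^ 2 * fejer K (s - t) <= 4.
Proof.
replace (Cmod (cis s - cis t) ^ 2) with (2 - 2 * cos (s - t)) by (rewrite <- cis_dist2; ring).
rewrite Rmult_comm, fejer_closed. pose proof (COS_bound (INR K * (s - t))). lra.
Qed.

Lemma dirichlet_ct n tau : ct (fun t => dirichlet n (t - tau)).
Proof.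
induction n as [|n IH]; [try exact (ct_const 1); exact (ct_const 0)|].
apply (ct_plus (fun t => dirichlet n (t - tau)) (fun t => 2 * cos (INR (S n) * (t - tau)))); [exact IH|].
apply ct_derive. intros x. auto_derive. exact I.
Qed.

Lemma fejer_ct K tau : ct (fun t => fejer K (t - tau)).
Proof.
induction K as [|K IH]; [try exact (ct_const 1); exact (ct_const 0)|].
apply (ct_plus (fun t => fejer K (t - tau)) (fun t => dirichlet K (t - tau))); [exact IH|].
apply dirichlet_ct.
Qed.

Lemma I2pi_dirichlet n tau : I2pi (fun t => dirichlet n (t - tau)) = 2 * PI.
Proof.
induction n as [|n IH]; [simpl; rewrite I2pi_const; ring|].
transitivity (I2pi (fun t => dirichlet n (t - tau) + 2 * cos (INR (S n) * t + - (INR (S n) * tau)))).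
{ apply I2pi_ext. intros t. cbn [dirichlet]. do 3 f_equal. ring. }
assert (ct (fun t => cos (INR (S n) * t + - (INR (S n) * tau)))).
{ apply ct_derive. intros x. auto_derive. exact I. }
rewrite (I2pi_plus (fun t => dirichlet n (t - tau))), I2pi_scal, I2pi_cos, IH;
  [ring|lia|assumption|apply dirichlet_ct|].
apply ct_scal; assumption.
Qed.

Lemma I2pi_fejer K tau : I2pi (fun t => fejer K (t - tau)) = 2 * PI * INR K.
Proof.
induction K as [|K IH]; [simpl; rewrite I2pi_const; ring|].
transitivity (I2pi (fun t => fejer K (t - tau) + dirichlet K (t - tau))); [reflexivity|].
rewrite I2pi_plus by (apply fejer_ct || apply dirichlet_ct).
rewrite IH, I2pi_dirichlet, S_INR. ring.
Qed.

Fixpoint psum (c : nat -> C) (n : nat) (z : C) : C :=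
  match n with O => c O | S m => (psum c m z + c n * z ^ n)%C end.

(** The sum, not the mean, of the first [K] partial sums; avoiding the division puts factors [INR K]
    into the estimates. *)
Fixpoint cesaro (c : nat -> C) (K : nat) (z : C) : C :=
  match K with O => 0%C | S m => (cesaro c m z + psum c m z)%C end.

Lemma RtoC_2cos (x : R) : RtoC (2 * cos x) = (cis x + cis (- x))%C.
Proof. unfold cis. rewrite cos_neg, sin_neg. apply C_ext; simpl; ring. Qed.

(** At r e^(i tau) the Cesaro sum is the mean of f on the circle of radius r against the kernel
    centred at tau. Positivity and total mass 2 pi K give the bound, decay away from tau the
    convergence. A circle of positive radius is used, hence 0 < |z|. *)
Lemma fejer_approximation (f : C -> C) (M : R) :
  (forall z, Cmod z < 1 -> exists l, cdiff f z l) ->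
  (forall z, Cmod z < 1 -> Cmod (f z) <= M) ->
  exists c : nat -> C,
    (forall K z, 0 < Cmod z < 1 -> Cmod (cesaro c K z) <= INR K * M) /\
    (forall z eps, 0 < Cmod z < 1 -> 0 < eps -> exists K0, forall K, (K0 <= K)%nat ->
       Cmod (cesaro c K z - INR K * f z) <= eps * INR K).
Proof.
intros D B. pose proof twopi_pos as TP.
assert (TPC : (2 * PI)%C <> 0).
{ rewrite <- RtoC_mult. apply RtoC_neq_0. lra. }
assert (M0 : 0 <= M).
{ eapply Rle_trans; [apply (Cmod_ge_0 (f 0))|]. apply B. rewrite Cmod_0. lra. }
assert (Fc : forall r, 0 < r < 1 -> cct (fun t => f (r * cis t)%C)).
{ intros r Hr. apply cct_circle; [lra|]. intros z Hz. apply D. lra. }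
(* The coefficients are read on the circle of radius 1/2; since f / z^n is holomorphic off 0, every
   radius gives the same ones, as [Cpos] says. *)
set (c := fun n : nat => (cI (fun t => f (/2 * cis t) * cis (- INR n * t + 0)) / (2 * PI * (/ 2) ^ n))%C).
assert (Cpos : forall n r, 0 < r < 1 ->
  cI (fun t => f (r * cis t) * cis (- INR n * t + 0))%C = (2 * PI * c n * r ^ n)%C).
{ intros n r Hr.
  set (g := fun z => (f z * / (z ^ n))%C).
  assert (Eg : forall r, 0 < r < 1 ->
    cI (fun t => f (r * cis t) * cis (- INR n * t + 0))%C = (r ^ n * cI (fun t => g (r * cis t)))%C).
  { clear r Hr. intros r Hr. assert (Hrn : RtoC r <> 0) by (apply RtoC_neq_0; lra).
    rewrite <- cI_scal.
    - apply cI_ext. intros t. unfold g. rewrite Cpow_mult_l, cis_pow.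
      replace (- INR n * t + 0) with (- (INR n * t)) by ring.
      assert (E : (cis (- (INR n * t)) * cis (INR n * t))%C = 1).
      { rewrite <- cis_plus. replace (- (INR n * t) + INR n * t) with 0 by ring.
        unfold cis. now rewrite cos_0, sin_0. }
      assert (cis (INR n * t) <> 0) by (apply Cmod_gt_0; rewrite Cmod_cis; lra).
      assert ((r ^ n)%C <> 0) by now apply Cpow_nz.
      replace (cis (- (INR n * t))) with (/ cis (INR n * t))%C.
      + field. auto.
      + rewrite <- (Cmult_1_l (/ cis (INR n * t))%C), <- E. field. assumption.
    - apply cct_circle; [lra|]. intros z Hz. destruct (D z ltac:(lra)) as [l Hl].
      apply (cdiff_div_pow f n z l); [apply Cmod_gt_0; lra|exact Hl]. }
  assert (Hh : RtoC (/2) = (/ 2)%C) by (rewrite RtoC_inv; [reflexivity|lra]).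
  unfold c. rewrite <- Hh, !Eg by lra.
  rewrite (punctured_mean g 1) with (b := / 2); [| |lra|lra].
  - assert (RtoC (/2) <> 0) by (apply RtoC_neq_0; lra).
    assert ((RtoC (/2) ^ n)%C <> 0) by now apply Cpow_nz.
    field. repeat split; try assumption; apply RtoC_neq_0; lra.
  - intros z Hz. destruct (D z ltac:(lra)) as [l Hl].
    apply (cdiff_div_pow f n z l); [apply Cmod_gt_0; lra|exact Hl]. }
(* The other frequencies of the kernel: for n >= 1 the function z^n f vanishes at 0, and therefore
   so do its means. *)
assert (Cneg : forall n r, (1 <= n)%nat -> 0 < r < 1 ->
  cI (fun t => f (r * cis t) * cis (INR n * t + 0))%C = 0).
{ intros n r Hn Hr.
  set (g := fun z => (f z * (z ^ n))%C).
  assert (Hrn : RtoC r <> 0) by (apply RtoC_neq_0; lra).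
  assert ((r ^ n)%C <> 0) by now apply Cpow_nz.
  assert (E := circle_mean g 1). specialize (E ltac:(
    intros z Hz; destruct (D z ltac:(lra)) as [l Hl]; destruct (cdiff_pow n z) as [l' Hl'];
    eexists; apply (cdiff_mult f (fun z => z ^ n)%C z l l' Hl Hl')) r Hr).
  assert (G0 : g 0 = 0).
  { unfold g. destruct n; [lia|]. simpl. ring. }
  rewrite G0 in E.
  assert (E2 : (r ^ n * cI (fun t => f (r * cis t) * cis (INR n * t + 0)))%C = 0).
  { rewrite <- cI_scal by (apply cct_mult; [now apply Fc|apply cct_cis]).
    etransitivity; [|etransitivity; [exact E|ring]].
    apply cI_ext. intros t. unfold g. rewrite Cpow_mult_l, cis_pow.
    rewrite Rplus_0_r. ring. }
  destruct (Ceq_dec (cI (fun t => f (r * cis t) * cis (INR n * t + 0))%C) 0) as [K|K]; [exact K|].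
  elim (Cmult_neq_0 _ _ H K E2). }
exists c.
assert (Ps : forall n r tau, 0 < r < 1 ->
  cI (fun t => f (r * cis t) * RtoC (dirichlet n (t - tau)))%C = (2 * PI * psum c n (r * cis tau))%C).
{ intros n r tau Hr. induction n as [|n IH].
  - specialize (Cpos O r Hr). simpl in Cpos |- *. rewrite Cmult_1_r in Cpos. rewrite <- Cpos.
    apply cI_ext. intros t. f_equal. unfold cis.
    replace (- 0 * t + 0) with 0 by ring. now rewrite cos_0, sin_0.
  - set (x := INR (S n)) in *.
    transitivity (cI (fun t => f (r * cis t) * RtoC (dirichlet n (t - tau)) +
       (cis (- (x * tau)) * (f (r * cis t) * cis (x * t + 0)) +
        cis (x * tau) * (f (r * cis t) * cis (- x * t + 0))))%C).
    { apply cI_ext. intros t. cbn [dirichlet]. fold x. rewrite RtoC_plus, RtoC_2cos.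
      replace (x * (t - tau)) with (- (x * tau) + (x * t + 0)) by ring.
      replace (- (- (x * tau) + (x * t + 0))) with (x * tau + (- x * t + 0)) by ring.
      rewrite (cis_plus (- (x * tau))), (cis_plus (x * tau)). ring. }
    assert (Q1 : cct (fun t => f (r * cis t) * cis (x * t + 0))%C)
      by (apply cct_mult; [now apply Fc|apply cct_cis]).
    assert (Q2 : cct (fun t => f (r * cis t) * cis (- x * t + 0))%C)
      by (apply cct_mult; [now apply Fc|apply cct_cis]).
    rewrite cI_plus, cI_plus, !cI_scal, IH; try assumption.
    + unfold x. rewrite Cneg, Cpos by (lia || assumption).
      cbn [psum]. rewrite Cpow_mult_l, cis_pow. ring.
    + apply cct_mult; [apply cct_const|assumption].
    + apply cct_mult; [apply cct_const|assumption].
    + apply cct_mult; [now apply Fc|apply cct_RtoC, dirichlet_ct].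
    + apply cct_plus; (apply cct_mult; [apply cct_const|assumption]). }
assert (Cs : forall K r tau, 0 < r < 1 ->
  cI (fun t => f (r * cis t) * RtoC (fejer K (t - tau)))%C = (2 * PI * cesaro c K (r * cis tau))%C).
{ intros K r tau Hr. induction K as [|K IH].
  - simpl. rewrite (cI_ext _ (fun _ => 0%C)) by (intros; ring). rewrite cI_const. ring.
  - transitivity (cI (fun t => f (r * cis t) * RtoC (fejer K (t - tau)) +
       f (r * cis t) * RtoC (dirichlet K (t - tau)))%C).
    { apply cI_ext. intros t. cbn [fejer]. rewrite RtoC_plus. ring. }
    rewrite cI_plus, IH, Ps by
      (assumption || (apply cct_mult; [now apply Fc|apply cct_RtoC; apply fejer_ct || apply dirichlet_ct])).
    cbn [cesaro]. ring. }
assert (Hcis : forall r t, 0 < r < 1 -> Cmod (r * cis t) < 1).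
{ intros r t Hr. rewrite Cmod_polar; lra. }
assert (Mod2 : Cmod (2 * PI) = 2 * PI).
{ rewrite <- RtoC_mult, Cmod_R, Rabs_pos_eq; lra. }
split.
- intros K z Hz. destruct (polar z) as [tau [_ Hzt]].
  set (r := Cmod z) in *. rewrite Hzt.
  assert (N : Cmod (2 * PI * cesaro c K (r * cis tau))%C <= 2 * PI * (INR K * M)).
  { rewrite <- Cs by exact Hz.
    replace (2 * PI * (INR K * M)) with (M * (2 * PI * INR K)) by ring.
    rewrite <- (I2pi_fejer K tau), <- I2pi_scal by apply fejer_ct.
    apply cI_norm.
    - apply cct_mult; [now apply Fc|apply cct_RtoC, fejer_ct].
    - apply ct_scal, fejer_ct.
    - intros t. rewrite Cmod_mult, Cmod_R, Rabs_pos_eq by apply fejer_pos.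
      apply Rmult_le_compat_r; [apply fejer_pos|]. now apply B, Hcis. }
  rewrite Cmod_mult, Mod2 in N. nra.
- intros z eps Hz He. destruct (polar z) as [tau [_ Hzt]].
  set (r := Cmod z) in *. rewrite Hzt.
  destruct (D (r * cis tau)%C) as [l Hl]; [now apply Hcis|].
  destruct (cdiff_ccont _ _ _ Hl (eps / 2) ltac:(lra)) as [eta [He1 H]].
  (* Away from tau, |f - f w| <= 2 M and the kernel is at most 4 / eta^2. Their product 8 M / eta^2
     has to be at most eps K / 2. *)
  destruct (nfloor_ex (16 * M / (eta ^ 2 * eps))) as [N HN].
  { apply Rdiv_le_0_compat; [lra|]. apply Rmult_lt_0_compat; [apply pow_lt; lra|lra]. }
  exists (S N). intros K HK.
  assert (HK' : 8 * M / eta ^ 2 <= eps / 2 * INR K).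
  { apply le_INR in HK. rewrite S_INR in HK.
    assert (E : 8 * M / eta ^ 2 = eps / 2 * (16 * M / (eta ^ 2 * eps))) by (field; lra).
    rewrite E. apply Rmult_le_compat_l; lra. }
  set (w := (r * cis tau)%C) in *.
  assert (Cf : cct (fun t => RtoC (fejer K (t - tau)))) by apply cct_RtoC, fejer_ct.
  assert (E : (2 * PI * (cesaro c K w - INR K * f w))%C =
     cI (fun t => (f (r * cis t) - f w) * RtoC (fejer K (t - tau)))%C).
  { transitivity (cI (fun t => f (r * cis t) * RtoC (fejer K (t - tau)) - f w * RtoC (fejer K (t - tau)))%C).
    2:{ apply cI_ext. intros; ring. }
    rewrite cI_minus, cI_scal, Cs; try assumption.
    - fold w.
      assert (E : cI (fun t => RtoC (fejer K (t - tau))) = (2 * PI * INR K)%C).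
      { rewrite <- !RtoC_mult, <- (I2pi_fejer K tau). apply C_ext; [reflexivity|].
        simpl. rewrite I2pi_const. ring. }
      rewrite E. ring.
    - apply cct_mult; [now apply Fc|exact Cf].
    - apply cct_mult; [apply cct_const|exact Cf]. }
  assert (Q : Cmod (2 * PI * (cesaro c K w - INR K * f w))%C <= 2 * PI * (eps * INR K)).
  { rewrite E.
    apply Rle_trans with (I2pi (fun t => eps / 2 * fejer K (t - tau) + 8 * M / eta ^ 2)).
    - apply cI_norm.
      + apply cct_mult; [|exact Cf]. apply cct_minus; [now apply Fc|apply cct_const].
      + apply ct_plus; [apply ct_scal, fejer_ct|apply ct_const].
      + intros t. rewrite Cmod_mult, Cmod_R, Rabs_pos_eq by apply fejer_pos.
        pose proof (fejer_pos K (t - tau)) as P. pose proof (fejer_tail K t tau) as T.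
        assert (E2 : 0 < eta ^ 2) by (apply pow_lt; lra).
        assert (Pq : 0 <= 8 * M / eta ^ 2) by (apply Rdiv_le_0_compat; lra).
        destruct (Rlt_le_dec (Cmod (r * cis t - w)) eta) as [L|L].
        * specialize (H _ L). nra.
        * assert (L2 : eta <= Cmod (cis t - cis tau)).
          { unfold w in L. replace (r * cis t - r * cis tau)%C with (r * (cis t - cis tau))%C in L by ring.
            rewrite Cmod_mult, Cmod_R, Rabs_pos_eq in L by lra.
            pose proof (Cmod_ge_0 (cis t - cis tau)%C). nra. }
          assert (L3 : Cmod (f (r * cis t) - f w)%C <= 2 * M).
          { eapply Rle_trans; [apply Cmod_triangle|]. rewrite Cmod_opp.
            pose proof (B _ (Hcis r t Hz)). pose proof (B _ (Hcis r tau Hz)). fold w in H1. lra. }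
          assert (L4 : eta ^ 2 * fejer K (t - tau) <= 4).
          { eapply Rle_trans; [|exact T]. apply Rmult_le_compat_r; [exact P|]. apply pow_incr; lra. }
          assert (L5 : 2 * M * fejer K (t - tau) <= 8 * M / eta ^ 2).
          { apply (Rmult_le_reg_r (eta ^ 2)); [exact E2|].
            unfold Rdiv. rewrite (Rmult_assoc (8 * M)), Rinv_l by lra. nra. }
          nra.
    - rewrite I2pi_plus, I2pi_scal, I2pi_fejer, I2pi_const.
      + nra.
      + apply fejer_ct.
      + apply ct_scal, fejer_ct.
      + apply ct_const. }
  rewrite Cmod_mult, Mod2 in Q. nra.
Qed.

(** * Jensen's formula and Harnack's inequality *)

(* [ln |1 - x e^(i tau)|] *)
Definition logdist (x tau : R) : R := ln (1 - 2 * x * cos tau + x ^ 2) / 2.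

(** Partial sums of the Fourier series of [- logdist], the real part of the series of - ln (1 - x
    e^(i tau)); [logser'] is the derivative in x. *)
Fixpoint logser (K : nat) (x tau : R) : R :=
  match K with O => 0 | S m => logser m x tau + x ^ K * cos (INR K * tau) / INR K end.

Fixpoint logser' (K : nat) (x tau : R) : R :=
  match K with O => 0 | S m => logser' m x tau + x ^ m * cos (INR K * tau) end.

Lemma logdist_den x tau : (1 - Rabs x) ^ 2 <= 1 - 2 * x * cos tau + x ^ 2.
Proof.
pose proof (COS_bound tau) as B.
destruct (Rle_lt_dec 0 x) as [H|H].
- rewrite Rabs_pos_eq by exact H. nra.
- rewrite Rabs_left by exact H. nra.
Qed.

Lemma logdist_den_pos x tau : 0 <= x -> x <> 1 -> 0 < 1 - 2 * x * cos tau + x ^ 2.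
Proof.
intros H0 H1. pose proof (logdist_den x tau) as D. rewrite Rabs_pos_eq in D by exact H0.
assert (0 < (1 - x) ^ 2) by (apply pow2_gt_0; lra). lra.
Qed.

Lemma logser'_closed K x tau : logser' K x tau * (1 - 2 * x * cos tau + x ^ 2) =
  cos tau - x - x ^ K * cos (INR (S K) * tau) + x ^ S K * cos (INR K * tau).
Proof.
induction K as [|K IH].
- simpl. rewrite !Rmult_0_l, cos_0, !Rmult_1_l. ring.
- change (logser' (S K) x tau) with (logser' K x tau + x ^ K * cos (INR (S K) * tau)).
  rewrite Rmult_plus_distr_r, IH, !S_INR.
  replace ((INR K + 1 + 1) * tau) with ((INR K + 1) * tau + tau) by ring.
  replace (INR K * tau) with ((INR K + 1) * tau - tau) by ring.
  rewrite cos_plus, cos_minus. simpl. ring.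
Qed.

Lemma logser_derive K x tau : is_derive (fun y => logser K y tau) x (logser' K x tau).
Proof.
induction K as [|K IH]; [exact (is_derive_const (K := R_AbsRing) (V := R_NormedModule) 0 x)|].
apply (is_derive_plus (K := R_AbsRing) (V := R_NormedModule) (fun y => logser K y tau)
  (fun y => y ^ S K * cos (INR (S K) * tau) / INR (S K))); [exact IH|].
assert (HN : INR (S K) <> 0) by (apply not_0_INR; lia).
assert (HD : is_derive (fun y => y ^ S K) x (INR (S K) * x ^ K)).
{ apply is_derive_Reals. exact (derivable_pt_lim_pow x (S K)). }
generalize dependent (INR (S K)). intros n HN HD.
apply (is_derive_ext (fun y => cos (n * tau) / n * y ^ S K)).
{ intros y. change (cos (n * tau) / n * y ^ S K = y ^ S K * cos (n * tau) / n).
  unfold Rdiv. ring. }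
replace (x ^ K * cos (n * tau)) with (cos (n * tau) / n * (n * x ^ K)) by (field; exact HN).
now apply (is_derive_scal (fun y => y ^ S K)).
Qed.

Lemma logser_0 K tau : logser K 0 tau = 0.
Proof.
induction K as [|K IH]; [reflexivity|].
cbn [logser]. rewrite IH, pow_i by lia. unfold Rdiv. ring.
Qed.

(** The sum vanishes at x = 0, and by the closed form of [logser'] its x-derivative is two terms of
    size at most x^K over |1 - x e^(i tau)|^2. The mean value theorem gives a bound uniform in tau,
    as integration requires. *)
Lemma logdist_series K x tau rho : 0 <= x <= rho -> rho < 1 ->
  Rabs (logdist x tau + logser K x tau) <= 2 * rho ^ K / (1 - rho) ^ 2.
Proof.
intros Hx Hr.
set (h' := fun y => (y - cos tau) / (1 - 2 * y * cos tau + y ^ 2) + logser' K y tau).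
assert (D : forall y, Rmin 0 x <= y <= Rmax 0 x ->
  is_derive (fun y => logdist y tau + logser K y tau) y (h' y)).
{ intros y. rewrite Rmin_left, Rmax_right by lra. intros Hy.
  apply (is_derive_plus (K := R_AbsRing) (V := R_NormedModule) (fun y => logdist y tau)
    (fun y => logser K y tau)); [|apply logser_derive].
  pose proof (logdist_den_pos y tau ltac:(lra) ltac:(lra)) as P.
  unfold logdist. auto_derive; [simpl in *; lra|]. field. simpl in *; lra. }
destruct (MVT_gen (fun y => logdist y tau + logser K y tau) 0 x h') as [y [Hy E]].
- intros y Hy. apply D. lra.
- intros y Hy. apply continuity_pt_filterlim.
  apply (ex_derive_continuous (K := R_AbsRing) (V := R_NormedModule)
    (fun y => logdist y tau + logser K y tau)). exists (h' y). now apply D.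
- rewrite Rmin_left, Rmax_right in Hy by lra.
  assert (E0 : logdist 0 tau + logser K 0 tau = 0).
  { unfold logdist. replace (1 - 2 * 0 * cos tau + 0 ^ 2) with 1 by ring. rewrite ln_1.
    rewrite logser_0. field. }
  rewrite E0, !Rminus_0_r in E. rewrite E.
  pose proof (logdist_den_pos y tau ltac:(lra) ltac:(lra)) as P.
  pose proof (logdist_den y tau) as P2. rewrite Rabs_pos_eq in P2 by lra.
  set (den := 1 - 2 * y * cos tau + y ^ 2) in *.
  assert (Eh : h' y = (y ^ S K * cos (INR K * tau) - y ^ K * cos (INR (S K) * tau)) / den).
  { unfold h'. fold den. pose proof (logser'_closed K y tau) as L. fold den in L.
    apply (Rmult_eq_reg_r den); [|lra]. field_simplify; [|lra|lra].
    rewrite (Rmult_comm den), L. ring. }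
  assert (P3 : (1 - rho) ^ 2 <= den).
  { eapply Rle_trans; [|exact P2]. apply pow_incr; lra. }
  assert (P4 : 0 < (1 - rho) ^ 2) by (apply pow_lt; lra).
  assert (Hp : 0 <= y ^ K <= rho ^ K).
  { split; [apply pow_le; lra|apply pow_incr; lra]. }
  assert (Hn : Rabs (y ^ S K * cos (INR K * tau) - y ^ K * cos (INR (S K) * tau)) <= 2 * rho ^ K).
  { eapply Rle_trans; [apply Rabs_triang|]. rewrite Rabs_Ropp, !Rabs_mult.
    rewrite !(Rabs_pos_eq (y ^ _)) by (apply pow_le; lra).
    assert (Rabs (cos (INR K * tau)) <= 1) by apply Rabs_le, COS_bound.
    assert (Rabs (cos (INR (S K) * tau)) <= 1) by apply Rabs_le, COS_bound.
    pose proof (Rabs_pos (cos (INR K * tau))). pose proof (Rabs_pos (cos (INR (S K) * tau))).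
    assert (0 <= y ^ S K <= y ^ K) by (simpl; split; nra). nra. }
  rewrite Rabs_mult, Eh. unfold Rdiv at 1. rewrite Rabs_mult, Rabs_inv, (Rabs_pos_eq den) by lra.
  rewrite (Rabs_pos_eq x) by lra.
  assert (Hi : 0 < / den <= / (1 - rho) ^ 2).
  { split; [now apply Rinv_0_lt_compat|now apply Rinv_le_contravar]. }
  unfold Rdiv. set (a := Rabs (y ^ S K * cos (INR K * tau) - y ^ K * cos (INR (S K) * tau))) in *.
  assert (0 <= a) by apply Rabs_pos.
  assert (a * / den <= 2 * rho ^ K * / (1 - rho) ^ 2) by (apply Rmult_le_compat; lra).
  assert (0 <= a * / den) by nra. nra.
Qed.

Lemma logdist_ct x sigma : 0 <= x -> x <> 1 -> ct (fun t => logdist x (t + sigma)).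
Proof.
intros H0 H1. apply ct_derive. intros t. unfold logdist.
pose proof (logdist_den_pos x (t + sigma) H0 H1). auto_derive. simpl in *; lra.
Qed.

Lemma cos_ct k a : ct (fun t => cos (k * t + a)).
Proof. apply ct_derive. intros x. auto_derive. exact I. Qed.

Lemma logser_ct K x sigma : ct (fun t => logser K x (t + sigma)).
Proof.
induction K as [|K IH]; [exact (ct_const 0)|].
apply (ct_plus (fun t => logser K x (t + sigma))
  (fun t => x ^ S K * cos (INR (S K) * (t + sigma)) / INR (S K))); [exact IH|].
apply ct_derive. intros t. auto_derive. exact I.
Qed.

Lemma pow_to_0 (rho C eps : R) : 0 <= rho < 1 -> 0 <= C -> 0 < eps ->
  exists N, forall K, (N <= K)%nat -> C * rho ^ K <= eps.
Proof.
intros Hr HC He.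
destruct (pow_lt_1_zero rho ltac:(rewrite Rabs_pos_eq; lra) (eps / (C + 1))) as [N HN].
{ apply Rdiv_lt_0_compat; lra. }
exists N. intros K HK. specialize (HN K HK).
assert (0 <= rho ^ K) by (apply pow_le; lra). rewrite Rabs_pos_eq in HN by assumption.
apply (Rmult_lt_compat_l (C + 1)) in HN; [|lra].
replace ((C + 1) * (eps / (C + 1))) with eps in HN by (field; lra). nra.
Qed.

(** [logser] tends uniformly to [- logdist], hence the sign. Against the weights in question its
    integrals are constant from some [K] on, by orthogonality, so the limit is known. *)
Lemma I2pi_logdist_aux x sigma (w : R -> R) B L :
  0 <= x < 1 -> ct w -> (forall t, Rabs (w t) <= B) ->
  (exists N, forall K, (N <= K)%nat -> I2pi (fun t => logser K x (t + sigma) * w t) = L) ->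
  I2pi (fun t => logdist x (t + sigma) * w t) = - L.
Proof.
intros Hx Hw HB [N HN]. pose proof twopi_pos as TP.
assert (B0 : 0 <= B) by (eapply Rle_trans; [apply Rabs_pos|apply (HB 0)]).
assert (Z : Rabs (I2pi (fun t => logdist x (t + sigma) * w t) + L) = 0).
2:{ apply Rabs_eq_0 in Z. lra. }
apply Rle_antisym; [|apply Rabs_pos]. apply le_epsilon. intros eps He. rewrite Rplus_0_l.
assert (P4 : 0 < (1 - x) ^ 2) by (apply pow_lt; lra).
destruct (pow_to_0 x (2 * PI * (2 * / (1 - x) ^ 2 * B)) eps ltac:(lra)) as [N' HN'].
{ apply Rmult_le_pos; [lra|]. apply Rmult_le_pos; [|exact B0].
  apply Rmult_le_pos; [lra|]. left; now apply Rinv_0_lt_compat. }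
{ exact He. }
set (K := (N + N')%nat). rewrite <- (HN K) by (unfold K; lia).
pose proof (logdist_ct x sigma ltac:(lra) ltac:(lra)) as C1.
pose proof (logser_ct K x sigma) as C2.
rewrite <- I2pi_plus by (apply ct_mult; assumption).
eapply Rle_trans; [apply (I2pi_abs _ (2 * x ^ K / (1 - x) ^ 2 * B))|].
- apply ct_plus; apply ct_mult; assumption.
- intros t. rewrite <- Rmult_plus_distr_r, Rabs_mult.
  apply Rmult_le_compat; try apply Rabs_pos; [|apply HB].
  apply logdist_series; lra.
- eapply Rle_trans; [|apply (HN' K); unfold K; lia]. right. field. lra.
Qed.

Lemma I2pi_logser K x sigma : I2pi (fun t => logser K x (t + sigma) * 1) = 0.
Proof.
induction K as [|K IH].
- rewrite (I2pi_ext _ (fun _ => 0)) by (intros; simpl; ring). rewrite I2pi_const. ring.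
- rewrite (I2pi_ext _ (fun t => logser K x (t + sigma) * 1 +
    x ^ S K / INR (S K) * cos (INR (S K) * t + INR (S K) * sigma))).
  + rewrite I2pi_plus, IH, I2pi_scal, I2pi_cos; [ring|lia|apply cos_ct| |].
    * apply ct_mult; [apply logser_ct|apply ct_const].
    * apply ct_scal, cos_ct.
  + intros t. cbn [logser]. rewrite Rmult_plus_distr_l. unfold Rdiv. ring.
Qed.

Lemma I2pi_cos_cos (j k : nat) (a b : R) : (1 <= j)%nat -> (1 <= k)%nat ->
  I2pi (fun t => cos (INR j * t + a) * cos (INR k * t + b)) =
  if Nat.eq_dec j k then PI * cos (a - b) else 0.
Proof.
intros Hj Hk.
set (g := fun t => / 2 * cos (INR j * t + a - (INR k * t + b))).
assert (G : ct g) by (apply ct_derive; intros t; unfold g; auto_derive; exact I).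
rewrite (I2pi_ext _ (fun t => / 2 * cos (INR (j + k) * t + (a + b)) + g t)).
2:{ intros t. unfold g. rewrite plus_INR.
  replace ((INR j + INR k) * t + (a + b)) with ((INR j * t + a) + (INR k * t + b)) by ring.
  generalize (INR j * t + a) (INR k * t + b). intros u v.
  rewrite cos_plus, cos_minus. field. }
rewrite I2pi_plus, I2pi_scal, I2pi_cos; [|lia|apply cos_ct|apply ct_scal, cos_ct|exact G].
rewrite Rmult_0_r, Rplus_0_l. unfold g.
destruct (Nat.eq_dec j k) as [->|N].
- rewrite (I2pi_ext _ (fun _ => / 2 * cos (a - b))).
  + rewrite I2pi_const. field.
  + intros t. do 2 f_equal. ring.
- destruct (Nat.lt_ge_cases j k) as [L|L].
  + rewrite (I2pi_ext _ (fun t => / 2 * cos (INR (k - j) * t + (b - a)))).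
    * rewrite I2pi_scal, I2pi_cos by (lia || apply cos_ct). ring.
    * intros t. f_equal. rewrite <- (cos_neg (_ + _)), minus_INR by lia. f_equal. ring.
  + rewrite (I2pi_ext _ (fun t => / 2 * cos (INR (j - k) * t + (a - b)))).
    * rewrite I2pi_scal, I2pi_cos by (lia || apply cos_ct). ring.
    * intros t. f_equal. rewrite minus_INR by lia. f_equal. ring.
Qed.

Lemma I2pi_logser_cos K x sigma k a : (1 <= k)%nat ->
  I2pi (fun t => logser K x (t + sigma) * cos (INR k * t + a)) =
  if le_dec k K then x ^ k / INR k * (PI * cos (INR k * sigma - a)) else 0.
Proof.
intros Hk. induction K as [|K IH].
- rewrite (I2pi_ext _ (fun _ => 0)) by (intros; simpl; ring). rewrite I2pi_const.
  destruct (le_dec k 0); [lia|ring].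
- rewrite (I2pi_ext _ (fun t => logser K x (t + sigma) * cos (INR k * t + a) +
    x ^ S K / INR (S K) * (cos (INR (S K) * t + INR (S K) * sigma) * cos (INR k * t + a)))).
  + rewrite I2pi_plus, IH, I2pi_scal, I2pi_cos_cos; try lia.
    * destruct (Nat.eq_dec (S K) k) as [<-|N].
      -- destruct (le_dec (S K) K); [lia|]. destruct (le_dec (S K) (S K)); [ring|lia].
      -- destruct (le_dec k K), (le_dec k (S K)); try lia; ring.
    * apply ct_mult; apply cos_ct.
    * apply ct_mult; [apply logser_ct|apply cos_ct].
    * apply ct_mult; [apply ct_const|]. apply ct_mult; apply cos_ct.
  + intros t. cbn [logser]. rewrite Rmult_plus_distr_l. unfold Rdiv. ring.
Qed.

Lemma I2pi_logdist_lt x sigma : 0 <= x < 1 -> I2pi (fun t => logdist x (t + sigma)) = 0.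
Proof.
intros Hx. rewrite (I2pi_ext _ (fun t => logdist x (t + sigma) * 1)) by (intros; ring).
rewrite (I2pi_logdist_aux x sigma (fun _ => 1) 1 0 Hx).
- ring.
- apply ct_const.
- intros; rewrite Rabs_R1; lra.
- exists O. intros K _. apply I2pi_logser.
Qed.

Lemma I2pi_logdist_cos x sigma k a : 0 <= x < 1 -> (1 <= k)%nat ->
  I2pi (fun t => logdist x (t + sigma) * cos (INR k * t + a)) =
  - (x ^ k / INR k * (PI * cos (INR k * sigma - a))).
Proof.
intros Hx Hk. apply (I2pi_logdist_aux x sigma _ 1 _ Hx).
- apply cos_ct.
- intros; apply Rabs_le, COS_bound.
- exists k. intros K HK. rewrite I2pi_logser_cos by exact Hk.
  destruct (le_dec k K); [reflexivity|lia].
Qed.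

Definition lnp (x : R) : R := if Rle_dec x 1 then 0 else ln x.

Lemma lnp_nonneg x : 0 <= lnp x.
Proof.
unfold lnp. destruct (Rle_dec x 1); [lra|]. rewrite <- ln_1. left. apply ln_increasing; lra.
Qed.

(** For x > 1, |1 - x e^(iu)| = x |1 - x^-1 e^(iu)|, which leaves ln x and a factor of mean 0. The
    value x = 1 is a zero on the circle, avoided later by the choice of the radius. *)
Lemma I2pi_logdist x sigma : 0 <= x -> x <> 1 ->
  I2pi (fun t => logdist x (t + sigma)) = 2 * PI * lnp x.
Proof.
intros H0 H1. unfold lnp. destruct (Rle_dec x 1) as [H|H].
- rewrite I2pi_logdist_lt by lra. ring.
- assert (Hx : 0 < / x < 1).
  { split; [apply Rinv_0_lt_compat; lra|]. rewrite <- Rinv_1. apply Rinv_lt_contravar; lra. }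
  rewrite (I2pi_ext _ (fun t => ln x + logdist (/ x) (t + sigma))).
  + rewrite I2pi_plus, I2pi_const, I2pi_logdist_lt; [ring|lra|apply ct_const|].
    apply logdist_ct; lra.
  + intros t. unfold logdist.
    replace (1 - 2 * x * cos (t + sigma) + x ^ 2) with
      (x * x * (1 - 2 * / x * cos (t + sigma) + (/ x) ^ 2)) by (field; lra).
    rewrite !ln_mult; try nra; try lra.
    apply logdist_den_pos; lra.
Qed.

Definition carg (z : C) : R := pick (polar z).

Lemma carg_bound z : 0 <= carg z < 2 * PI.
Proof. exact (proj1 (pick_spec (polar z))). Qed.

Lemma carg_spec z : z = (Cmod z * cis (carg z))%C.
Proof. exact (proj2 (pick_spec (polar z))). Qed.

Lemma ln_sqrt_half x : 0 < x -> ln (sqrt x) = ln x / 2.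
Proof.
intros Hx. pose proof (sqrt_lt_R0 x Hx).
rewrite <- (sqrt_sqrt x) at 2 by lra. rewrite ln_mult by assumption. field.
Qed.

Lemma ln_Cmod_factor (b : C) (r t : R) : 0 <= r -> Cmod b * r <> 1 ->
  ln (Cmod (1 - b * (r * cis t))%C) = logdist (Cmod b * r) (t + carg b).
Proof.
intros Hr Hb. pose proof (Cmod_ge_0 b).
unfold logdist. rewrite <- ln_sqrt_half by (apply logdist_den_pos; nra). f_equal.
rewrite (carg_spec b) at 1.
replace (1 - Cmod b * cis (carg b) * (r * cis t))%C with
  (1 - (Cmod b * r)%R * (cis t * cis (carg b)))%C by (rewrite RtoC_mult; ring).
rewrite <- cis_plus. set (x := Cmod b * r). set (u := t + carg b).
unfold Cmod, cis. simpl fst; simpl snd. f_equal.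
pose proof (sin2_cos2 u). unfold Rsqr in *. simpl. nra.
Qed.

Definition lsum {A : Type} (g : A -> R) (l : list A) : R := fold_right (fun b x => g b + x) 0 l.

Lemma lsum_nonneg {A} (g : A -> R) l : (forall b, In b l -> 0 <= g b) -> 0 <= lsum g l.
Proof.
induction l as [|b l IH]; simpl; intros H; [lra|].
apply Rplus_le_le_0_compat; [apply H; now left|apply IH; intros; apply H; now right].
Qed.

Lemma lsum_le {A} (f g : A -> R) l : (forall b, In b l -> f b <= g b) -> lsum f l <= lsum g l.
Proof.
induction l as [|b l IH]; simpl; intros H; [lra|].
pose proof (H b (or_introl eq_refl)). specialize (IH (fun x Hx => H x (or_intror Hx))). lra.
Qed.

Lemma lsum_ext {A} (f g : A -> R) l : (forall b, In b l -> f b = g b) -> lsum f l = lsum g l.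
Proof.
intros H. apply Rle_antisym; apply lsum_le; intros b Hb; rewrite (H b Hb); lra.
Qed.

Lemma lsum_plus {A} (f g : A -> R) l : lsum (fun b => f b + g b) l = lsum f l + lsum g l.
Proof. induction l as [|b l IH]; simpl; [ring|]. rewrite IH. ring. Qed.

Lemma lsum_scal {A} (k : R) (g : A -> R) l : lsum (fun b => k * g b) l = k * lsum g l.
Proof. induction l as [|b l IH]; simpl; [ring|]. rewrite IH. ring. Qed.

Lemma lsum_app {A} (g : A -> R) u v : lsum g (u ++ v) = lsum g u + lsum g v.
Proof. induction u as [|b u IH]; simpl; [ring|]. rewrite IH. ring. Qed.

Lemma lsum_const {A} (k : R) (l : list A) : lsum (fun _ => k) l = INR (length l) * k.
Proof.
induction l as [|b l IH]; [simpl; ring|].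
change (k + lsum (fun _ => k) l = INR (S (length l)) * k). rewrite IH, S_INR. ring.
Qed.

Lemma ln_Cmod_pprod bs z : (forall b, In b bs -> (1 - b * z)%C <> 0) ->
  ln (Cmod (pprod bs z)) = lsum (fun b => ln (Cmod (1 - b * z))) bs /\ pprod bs z <> 0.
Proof.
induction bs as [|b bs IH]; intros H.
- simpl. rewrite Cmod_1, ln_1. split; [reflexivity|]. apply RtoC_neq_0; lra.
- destruct IH as [E N]; [intros; apply H; now right|].
  assert (H0 : (1 - b * z)%C <> 0) by (apply H; now left).
  change (pprod (b :: bs) z) with ((1 - b * z) * pprod bs z)%C. simpl lsum.
  rewrite <- E, Cmod_mult, ln_mult by (now apply Cmod_gt_0). split; [reflexivity|].
  now apply Cmult_neq_0.
Qed.

Lemma factor_neq_0 (b z : C) : Cmod b * Cmod z <> 1 -> (1 - b * z)%C <> 0.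
Proof.
intros H E. apply H. rewrite <- Cmod_mult. replace (b * z)%C with (1 - (1 - b * z))%C by ring.
rewrite E. replace (1 - 0)%C with (RtoC 1) by ring. apply Cmod_1.
Qed.

Lemma ln_pprod_circle bs r : 0 <= r -> (forall b, In b bs -> Cmod b * r <> 1) ->
  (forall t, ln (Cmod (pprod bs (r * cis t)%C)) =
     lsum (fun b => logdist (Cmod b * r) (t + carg b)) bs /\ pprod bs (r * cis t)%C <> 0) .
Proof.
intros Hr H t.
assert (Hz := Cmod_polar r t Hr).
destruct (ln_Cmod_pprod bs (r * cis t)%C) as [E N].
- intros b Hb. apply factor_neq_0. rewrite Hz. now apply H.
- split; [|exact N]. rewrite E. apply lsum_ext. intros b Hb. apply ln_Cmod_factor; auto.
Qed.

Lemma lsum_ct {A} (g : A -> R -> R) (l : list A) :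
  (forall b, In b l -> ct (g b)) -> ct (fun t => lsum (fun b => g b t) l).
Proof.
induction l as [|b l IH]; intros H; [exact (ct_const 0)|].
apply (ct_plus (g b) (fun t => lsum (fun b => g b t) l)); [apply H; now left|].
apply IH. intros; apply H; now right.
Qed.

Lemma I2pi_lsum {A} (g : A -> R -> R) (l : list A) :
  (forall b, In b l -> ct (g b)) ->
  I2pi (fun t => lsum (fun b => g b t) l) = lsum (fun b => I2pi (g b)) l.
Proof.
induction l as [|b l IH]; intros H.
- simpl. rewrite I2pi_const. ring.
- simpl. rewrite <- IH by (intros; apply H; now right).
  apply (I2pi_plus (g b)); [apply H; now left|].
  apply lsum_ct. intros; apply H; now right.
Qed.

(** The one-factor formula summed: a zero a = 1 / b inside the circle contributes ln (r / |a|), and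
    the centre nothing, as [pprod] is 1 there. *)
Lemma jensen bs r : 0 <= r -> (forall b, In b bs -> Cmod b * r <> 1) ->
  ct (fun t => ln (Cmod (pprod bs (r * cis t)%C))) /\
  I2pi (fun t => ln (Cmod (pprod bs (r * cis t)%C))) =
  2 * PI * lsum (fun b => lnp (Cmod b * r)) bs.
Proof.
intros Hr H.
assert (C1 : forall b, In b bs -> ct (fun t => logdist (Cmod b * r) (t + carg b))).
{ intros b Hb. apply logdist_ct; [pose proof (Cmod_ge_0 b); nra|now apply H]. }
pose proof (ln_pprod_circle bs r Hr H) as E. split.
- eapply ct_ext; [intros t; symmetry; apply E|].
  apply (lsum_ct (fun b t => logdist (Cmod b * r) (t + carg b))). exact C1.
- rewrite (I2pi_ext _ _ (fun t => proj1 (E t))).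
  rewrite (I2pi_lsum (fun b t => logdist (Cmod b * r) (t + carg b)) bs C1).
  clear E C1. induction bs as [|b bs IH]; [simpl; ring|].
  simpl lsum. rewrite IH by (intros; apply H; now right).
  rewrite I2pi_logdist; [ring| |apply H; now left]. pose proof (Cmod_ge_0 b); nra.
Qed.

(* Harnack: positivity of [v] against the kernels [1 + cos (k (t - theta))] bounds
   the Fourier coefficients of [v] by [v 0]. *)
Lemma harnack_unit bs v0 :
  (forall b, In b bs -> Cmod b < 1) ->
  (forall t, ln (Cmod (pprod bs (cis t))) <= v0) ->
  forall z, Cmod z <= / 5 -> ln (Cmod (pprod bs z)) <= v0 / 2.
Proof.
intros Hb Hv z Hz. pose proof PI_RGT_0 as HPI.
assert (Hv' : forall t, lsum (fun b => logdist (Cmod b) (t + carg b)) bs <= v0).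
{ intros t. specialize (Hv t).
  assert (E := ln_pprod_circle bs 1 ltac:(lra)). specialize (E ltac:(intros b K; specialize (Hb b K); lra) t).
  rewrite Cmult_1_l in E. rewrite (proj1 E) in Hv. eapply Rle_trans; [right|exact Hv].
  apply lsum_ext. intros; now rewrite Rmult_1_r. }
assert (Cb : forall b, In b bs -> 0 <= Cmod b < 1).
{ intros b K; split; [apply Cmod_ge_0|now apply Hb]. }
(* - s k th / k is the coefficient of |z|^k in the expansion of ln |pprod z| along the ray of angle
   th. *)
set (s := fun k th => lsum (fun b => Cmod b ^ k * cos (INR k * (th + carg b))) bs).
assert (Coef : forall k th, (1 <= k)%nat -> - (2 * v0) <= s k th / INR k).
{ intros k th Hk.
  assert (Hik : 0 < INR k) by (apply lt_0_INR; lia).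
  set (w := fun t => 1 + cos (INR k * t + - (INR k * th))).
  assert (Cw : ct w) by (apply (ct_plus (fun _ => 1)); [apply ct_const|apply cos_ct]).
  assert (C1 : forall b, In b bs -> ct (fun t => logdist (Cmod b) (t + carg b))).
  { intros b K. specialize (Cb b K). apply logdist_ct; lra. }
  assert (C2 : forall b, In b bs -> ct (fun t => logdist (Cmod b) (t + carg b) * w t)).
  { intros b K. apply ct_mult; auto. }
  assert (P : I2pi (fun t => lsum (fun b => logdist (Cmod b) (t + carg b) * w t) bs) <= I2pi (fun t => v0 * w t)).
  { apply I2pi_le.
    - apply (lsum_ct (fun b t => logdist (Cmod b) (t + carg b) * w t)). exact C2.
    - apply ct_scal; exact Cw.
    - intros t. assert (W : 0 <= w t) by (unfold w; pose proof (COS_bound (INR k * t + - (INR k * th))); lra).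
      eapply Rle_trans; [|apply Rmult_le_compat_r; [exact W|apply (Hv' t)]]. right.
      generalize (w t). intros y. clear. induction bs as [|b bs IH]; simpl; [ring|]. rewrite IH. ring. }
  rewrite I2pi_scal in P by exact Cw. unfold w at 2 in P.
  rewrite I2pi_plus, I2pi_const, I2pi_cos in P by (exact Hk || apply ct_const || apply cos_ct).
  rewrite (I2pi_lsum (fun b t => logdist (Cmod b) (t + carg b) * w t) bs C2) in P.
  assert (E : lsum (fun b => I2pi (fun t => logdist (Cmod b) (t + carg b) * w t)) bs = - (PI * (s k th / INR k))).
  { unfold s. clear P C2 Hv Hv' Hb. induction bs as [|b l IH].
    - simpl. field. lra.
    - simpl lsum. rewrite IH by (intros; (apply Cb || apply C1); now right).
      assert (Cbb : 0 <= Cmod b < 1) by (apply Cb; now left).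
      rewrite (I2pi_ext _ (fun t => logdist (Cmod b) (t + carg b) +
         logdist (Cmod b) (t + carg b) * cos (INR k * t + - (INR k * th)))) by (intros; unfold w; ring).
      assert (Cc : ct (fun t => logdist (Cmod b) (t + carg b))) by (apply C1; now left).
      rewrite I2pi_plus, I2pi_logdist_lt, I2pi_logdist_cos; try assumption.
      + replace (INR k * carg b - - (INR k * th)) with (INR k * (th + carg b)) by ring. field. lra.
      + apply ct_mult; [exact Cc|apply cos_ct]. }
  rewrite E in P. nra. }
(* All zeros lie outside the closed unit disc, so ln |pprod| has mean 0 on the circle and its upper
   bound is nonnegative. *)
assert (V0 : 0 <= v0).
{ assert (Q : I2pi (fun t => lsum (fun b => logdist (Cmod b) (t + carg b)) bs) <= I2pi (fun _ => v0)).
  { apply I2pi_le; [|apply ct_const|exact Hv'].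
    apply (lsum_ct (fun b t => logdist (Cmod b) (t + carg b))).
    intros b K. specialize (Cb b K). apply logdist_ct; lra. }
  rewrite I2pi_const, (I2pi_lsum (fun b t => logdist (Cmod b) (t + carg b))) in Q.
  2:{ intros b K. specialize (Cb b K). apply logdist_ct; lra. }
  rewrite (lsum_ext _ (fun _ => 0)), lsum_const in Q.
  2:{ intros b K. apply I2pi_logdist_lt. now apply Cb. }
  nra. }
set (x := Cmod z). set (th := carg z).
assert (X0 : 0 <= x) by apply Cmod_ge_0.
assert (Ez : ln (Cmod (pprod bs z)) = lsum (fun b => logdist (Cmod b * x) (th + carg b)) bs).
{ rewrite (carg_spec z). apply (ln_pprod_circle bs x X0). intros b K. specialize (Cb b K).
  unfold x in *. nra. }
rewrite Ez. apply le_epsilon. intros eps He.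
destruct (pow_to_0 (/ 5) (INR (length bs) * (2 / (1 - / 5) ^ 2)) eps) as [K HK]; [lra| |exact He|].
{ apply Rmult_le_pos; [apply pos_INR|lra]. }
specialize (HK K (Nat.le_refl K)).
assert (S1 : lsum (fun b => logdist (Cmod b * x) (th + carg b)) bs <=
  lsum (fun b => - logser K (Cmod b * x) (th + carg b)) bs + eps).
{ eapply Rle_trans; [apply (lsum_le _ (fun b => - logser K (Cmod b * x) (th + carg b) + 2 * (/ 5) ^ K / (1 - / 5) ^ 2))|].
  - intros b Hin. specialize (Cb b Hin).
    pose proof (logdist_series K (Cmod b * x) (th + carg b) (/ 5)) as L.
    specialize (L ltac:(unfold x in *; split; nra) ltac:(lra)).
    apply Rabs_le_between in L. lra.
  - rewrite lsum_plus, lsum_const.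
    apply Rplus_le_compat_l. eapply Rle_trans; [|exact HK]. right. field. }
(* Each coefficient is at most 2 v0, and 2 times the sum of 5^-k over k >= 1 is 1/2: this is the
   reason for the radius 1/5. *)
assert (S2 : lsum (fun b => - logser K (Cmod b * x) (th + carg b)) bs <= v0 / 2 * (1 - (/ 5) ^ K)).
{ clear S1 HK. induction K as [|K IH].
  - rewrite (lsum_ext _ (fun _ => 0)) by (intros; simpl; ring). rewrite lsum_const. simpl. lra.
  - rewrite (lsum_ext _ (fun b => - logser K (Cmod b * x) (th + carg b) +
      - (x ^ S K / INR (S K)) * (Cmod b ^ S K * cos (INR (S K) * (th + carg b))))).
    2:{ intros b _. cbn [logser]. rewrite Rpow_mult_distr. unfold Rdiv. ring. }
    rewrite lsum_plus, lsum_scal. fold (s (S K) th).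
    replace (- (x ^ S K / INR (S K)) * s (S K) th) with (- x ^ S K * (s (S K) th / INR (S K)))
      by (unfold Rdiv; ring).
    specialize (Coef (S K) th ltac:(lia)).
    assert (XK : 0 <= x ^ S K <= (/ 5) ^ S K).
    { split; [now apply pow_le|apply pow_incr; split; [exact X0|exact Hz]]. }
    assert (E5 : (/ 5) ^ S K = / 5 * (/ 5) ^ K) by reflexivity. rewrite E5 in *.
    set (X := x ^ S K) in *. set (q := s (S K) th / INR (S K)) in *. set (p := (/ 5) ^ K) in *.
    assert (- X * q <= X * (2 * v0)) by nra.
    assert (X * (2 * v0) <= / 5 * p * (2 * v0)) by nra. lra. }
assert (0 <= (/ 5) ^ K) by (apply pow_le; lra). nra.
Qed.

(** With z = w + s zeta, the factor 1 - b z becomes (1 - b w)(1 - b' zeta), where b' = b s / (1 - b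
    w). This reduces to the unit disc, with v0 = - ln |q w|. *)
Lemma harnack_disc (c : C) bs w s : 0 < s -> c <> 0 ->
  (forall z, Cmod (z - w) <= s -> Cmod (c * pprod bs z) <= 1) ->
  (forall z b, Cmod (z - w) <= s -> In b bs -> (1 - b * z)%C <> 0) ->
  forall z, Cmod (z - w) <= s / 5 ->
  ln (Cmod (c * pprod bs z)) <= ln (Cmod (c * pprod bs w)) / 2.
Proof.
intros Hs Hc H1 H0 z Hz.
assert (Hw0 : Cmod (w - w) <= s) by (replace (w - w)%C with (RtoC 0) by ring; rewrite Cmod_0; lra).
set (sh := fun b => (b * s / (1 - b * w))%C).
assert (Es : RtoC s <> 0) by (apply RtoC_neq_0; lra).
assert (F : forall l zeta, (forall b, In b l -> (1 - b * w)%C <> 0) ->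
  pprod l (w + s * zeta)%C = (pprod l w * pprod (map sh l) zeta)%C).
{ intros l zeta Hl. induction l as [|b l IH]; [simpl; ring|].
  simpl. rewrite IH by (intros; apply Hl; now right). unfold sh at 2. field.
  apply Hl. now left. }
assert (Hbw : forall b, In b bs -> (1 - b * w)%C <> 0) by (intros; now apply H0).
assert (Hsh : forall b, In b (map sh bs) -> Cmod b < 1).
{ intros b' Hb'. apply in_map_iff in Hb'. destruct Hb' as [b [<- Hb]].
  destruct (Rlt_le_dec (Cmod (sh b)) 1) as [L|L]; [exact L|exfalso].
  assert (N : sh b <> 0) by (apply Cmod_gt_0; lra).
  (* If |b'| >= 1, this point is a zero of the factor inside the disc. *)
  apply (H0 (w + s * / sh b)%C b).
  - replace (w + s * / sh b - w)%C with (s * / sh b)%C by ring.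
    rewrite Cmod_mult, Cmod_inv, Cmod_R, Rabs_pos_eq by (assumption || lra).
    assert (/ Cmod (sh b) <= 1) by (rewrite <- Rinv_1; apply Rinv_le_contravar; lra). nra.
  - exact Hb.
  - assert (Nb : b <> 0).
    { intros E. apply N. unfold sh. rewrite E. field. }
    unfold sh. field. repeat split; auto. }
assert (Nw : pprod bs w <> 0) by (apply ln_Cmod_pprod; exact Hbw).
assert (Mw : 0 < Cmod (c * pprod bs w)) by (apply Cmod_gt_0; now apply Cmult_neq_0).
assert (Nsh : forall zeta, Cmod zeta <= 1 -> pprod (map sh bs) zeta <> 0).
{ intros zeta Hzeta. apply ln_Cmod_pprod. intros b Hb. apply factor_neq_0.
  specialize (Hsh b Hb). pose proof (Cmod_ge_0 b). pose proof (Cmod_ge_0 zeta). nra. }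
assert (Split : forall zeta, Cmod zeta <= 1 -> ln (Cmod (c * pprod bs (w + s * zeta))%C) =
  ln (Cmod (c * pprod bs w)) + ln (Cmod (pprod (map sh bs) zeta))).
{ intros zeta Hzeta. rewrite F by exact Hbw.
  replace (c * (pprod bs w * pprod (map sh bs) zeta))%C with
    ((c * pprod bs w) * pprod (map sh bs) zeta)%C by ring.
  rewrite (Cmod_mult (c * pprod bs w)%C), ln_mult; [reflexivity|exact Mw|].
  now apply Cmod_gt_0, Nsh. }
pose proof (harnack_unit (map sh bs) (- ln (Cmod (c * pprod bs w))) Hsh) as H.
specialize (H ltac:(
  intros t; specialize (Split (cis t) ltac:(rewrite Cmod_cis; lra));
  assert (B : Cmod (c * pprod bs (w + s * cis t))%C <= 1) by
   (apply H1; replace (w + s * cis t - w)%C with (s * cis t)%C by ring;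
    rewrite Cmod_polar; lra);
  assert (B2 : ln (Cmod (c * pprod bs (w + s * cis t))%C) <= 0) by
   (rewrite <- ln_1; apply ln_le; [|exact B]; rewrite F by exact Hbw;
    apply Cmod_gt_0, Cmult_neq_0; [exact Hc|apply Cmult_neq_0; [exact Nw|apply Nsh; rewrite Cmod_cis; lra]]);
  lra)).
assert (Hzeta : Cmod ((z - w) / s)%C <= / 5).
{ rewrite Cmod_div, Cmod_R, (Rabs_pos_eq s) by (assumption || lra).
  apply Rle_div_l; lra. }
specialize (H _ Hzeta). specialize (Split ((z - w) / s)%C ltac:(lra)).
replace (w + s * ((z - w) / s))%C with z in Split by (field; assumption). lra.
Qed.

(** * Counting points where a polynomial is small *)

(** A tent in place of the indicator of an arc, so that only continuous functions are integrated. *)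
Definition bump (r s : R) (w : C) (t : R) : R := Rmax 0 (1 - Cmod (r * cis t - w) / s).

Lemma Rmax0_lip (a b : R) : Rabs (Rmax 0 a - Rmax 0 b) <= Rabs (a - b).
Proof. unfold Rmax. destruct (Rle_dec 0 a), (Rle_dec 0 b); split_Rabs; lra. Qed.

Lemma bump_ct r s w : 0 <= r <= 1 -> 0 < s -> ct (bump r s w).
Proof.
intros Hr Hs t. apply continuous_eps. intros eps He. exists (eps * s). split; [nra|].
intros u Hu. eapply Rle_lt_trans; [apply Rmax0_lip|].
replace (1 - Cmod (r * cis u - w) / s - (1 - Cmod (r * cis t - w) / s)) with
  (- ((Cmod (r * cis u - w) - Cmod (r * cis t - w)) * / s)) by (unfold Rdiv; ring).
rewrite Rabs_Ropp, Rabs_mult, (Rabs_pos_eq (/ s)) by (left; now apply Rinv_0_lt_compat).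
apply (Rmult_lt_reg_r s); [exact Hs|]. rewrite Rmult_assoc, Rinv_l, Rmult_1_r by lra.
eapply Rle_lt_trans; [|exact Hu]. eapply Rle_trans; [apply Cmod_triangle_sub|].
replace (r * cis u - w - (r * cis t - w))%C with (r * (cis u - cis t))%C by ring.
rewrite Cmod_mult, Cmod_R, Rabs_pos_eq by lra. pose proof (cis_lip u t).
pose proof (Cmod_ge_0 (cis u - cis t)%C). nra.
Qed.

Lemma bump_nonneg r s w t : 0 <= bump r s w t.
Proof. apply Rmax_l. Qed.

(** On an arc of angular length s / 4 next to the argument of w the distance to w is at most s / 2
    radially plus s / 4 along the circle. The tent is at least 1/4 there, whence s / 16. *)
Lemma bump_mean r s w : 0 <= r <= 1 -> 0 < s <= 1 -> Cmod w <= 1 ->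
  Rabs (r - Cmod w) <= s / 2 -> s / 16 <= I2pi (bump r s w).
Proof.
intros Hr Hs Hw Hrw. pose proof PI2_1 as HPI.
pose proof (bump_ct r s w Hr ltac:(lra)) as C1.
pose proof (carg_bound w) as Ha. pose proof (carg_spec w) as Hwa. set (a := carg w) in *.
(* The arc starts or ends at the argument of w, on the side that keeps it within [0, 2 pi]. *)
set (a0 := if Rle_dec a PI then a else a - s / 4).
assert (H0 : 0 <= a0 /\ a0 + s / 4 <= 2 * PI /\ forall t, a0 <= t <= a0 + s / 4 -> Rabs (t - a) <= s / 4).
{ unfold a0. destruct (Rle_dec a PI); (split; [lra|split; [lra|intros t Ht; apply Rabs_le; lra]]). }
destruct H0 as (A1 & A2 & A3).
assert (N : forall x y, x <= y -> 0 <= Rint (bump r s w) x y).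
{ intros x y Hxy. apply RInt_ge_0; [exact Hxy|now apply ct_ex|]. intros; apply bump_nonneg. }
unfold I2pi. rewrite (Rint_Chasles _ 0 a0 (2 * PI)), (Rint_Chasles _ a0 (a0 + s / 4) (2 * PI)) by (now apply ct_ex).
pose proof (N 0 a0 A1). pose proof (N (a0 + s / 4) (2 * PI) A2).
assert (M : Rint (fun _ => / 4) a0 (a0 + s / 4) <= Rint (bump r s w) a0 (a0 + s / 4)).
{ apply RInt_le; [lra|apply ct_ex, ct_const|now apply ct_ex|]. intros t Ht.
  eapply Rle_trans; [|apply Rmax_r].
  assert (B : Cmod (r * cis t - w) <= 3 / 4 * s).
  { replace (r * cis t - w)%C with ((r - Cmod w)%R * cis t + (Cmod w * (cis t - cis a)))%C.
    2:{ rewrite Hwa at 3. rewrite RtoC_minus. ring. }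
    eapply Rle_trans; [apply Cmod_triangle|].
    rewrite !Cmod_mult, Cmod_cis, !Cmod_R, (Rabs_pos_eq (Cmod w)) by apply Cmod_ge_0.
    pose proof (cis_lip t a). specialize (A3 t ltac:(lra)).
    pose proof (Cmod_ge_0 (cis t - cis a)%C). pose proof (Cmod_ge_0 w). nra. }
  apply (Rmult_le_reg_r s); [lra|].
  replace ((1 - Cmod (r * cis t - w) / s) * s) with (s - Cmod (r * cis t - w)) by (field; lra).
  lra. }
rewrite Rint_const in M. lra.
Qed.

(** Centres 2 s apart give disjoint supports: at each t at most one tent is positive. *)
Lemma lsum_bump_le r s t (W : list C) : 0 < s -> NoDup W ->
  (forall w w', In w W -> In w' W -> w <> w' -> 2 * s <= Cmod (w - w')) ->
  lsum (fun w => bump r s w t) W <= 1 /\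
  (0 < lsum (fun w => bump r s w t) W -> exists w, In w W /\ Cmod (r * cis t - w) < s).
Proof.
intros Hs. induction W as [|w W IH]; intros ND Sep; [simpl; split; [lra|lra]|].
inversion ND as [|? ? Hin ND']; subst.
destruct IH as [IH1 IH2]; [exact ND'|intros; apply Sep; auto; now right|].
assert (P : forall x, 0 < bump r s x t -> Cmod (r * cis t - x) < s).
{ intros x Hx. unfold bump in Hx.
  destruct (Rlt_le_dec (Cmod (r * cis t - x)) s) as [L|L]; [exact L|exfalso].
  rewrite Rmax_left in Hx; [lra|].
  assert (1 <= Cmod (r * cis t - x) / s).
  { apply Rle_div_r; lra. }
  lra. }
simpl lsum. pose proof (bump_nonneg r s w t) as B0.
destruct (Rlt_le_dec 0 (bump r s w t)) as [L|L].
- assert (Z : lsum (fun w => bump r s w t) W = 0).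
  { rewrite (lsum_ext _ (fun _ => 0)); [rewrite lsum_const; ring|].
    intros w' Hw'. apply Rle_antisym; [|apply bump_nonneg].
    destruct (Rlt_le_dec 0 (bump r s w' t)) as [L'|L']; [exfalso|exact L'].
    apply P in L. apply P in L'.
    specialize (Sep w w' (or_introl eq_refl) (or_intror Hw') ltac:(intros ->; contradiction)).
    pose proof (Cmod_triangle (w - r * cis t) (r * cis t - w'))%C as T.
    replace (w - r * cis t + (r * cis t - w'))%C with (w - w')%C in T by ring.
    rewrite (Cmod_sub_comm w (r * cis t)%C) in T. lra. }
  rewrite Z, Rplus_0_r. split.
  + unfold bump. apply Rmax_lub; [lra|].
    assert (0 <= Cmod (r * cis t - w) / s).
    { apply Rdiv_le_0_compat; [apply Cmod_ge_0|lra]. }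
    lra.
  + intros _. exists w. split; [now left|now apply P].
- assert (E : bump r s w t = 0) by lra. rewrite E, Rplus_0_l. split; [exact IH1|].
  intros H. destruct (IH2 H) as [x [Hx Hx']]. exists x. split; [now right|exact Hx'].
Qed.

Lemma jensen_bound (c : C) bs r V : c <> 0 -> - ln (Cmod c) <= V -> 0 <= r ->
  (forall b, In b bs -> Cmod b * r <> 1) ->
  ct (fun t => - ln (Cmod (c * pprod bs (r * cis t))%C)) /\
  I2pi (fun t => - ln (Cmod (c * pprod bs (r * cis t))%C)) +
    2 * PI * lsum (fun b => lnp (Cmod b * r)) bs <= 2 * PI * V.
Proof.
intros Hc HV Hr Hb. pose proof twopi_pos as TP.
destruct (jensen bs r Hr Hb) as [C1 E].
assert (E2 : forall t, - ln (Cmod c) - ln (Cmod (pprod bs (r * cis t)%C)) = - ln (Cmod (c * pprod bs (r * cis t))%C)).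
{ intros t. rewrite Cmod_mult, ln_mult; [ring| |].
  - now apply Cmod_gt_0.
  - apply Cmod_gt_0. apply (ln_pprod_circle bs r Hr Hb t). }
split.
- eapply ct_ext; [exact E2|]. apply ct_minus; [apply ct_const|exact C1].
- rewrite <- (I2pi_ext _ _ E2), I2pi_minus, I2pi_const, E by (exact C1 || apply ct_const). nra.
Qed.

(** [V] bounds - ln |q 0| for q = c pprod. The bound on |q| starts at radius 1/4 because q may arise
    from division by a power of z; all circles and Harnack discs below stay in that annulus. *)
Definition normalized (c : C) (bs : list C) (V : R) : Prop :=
  c <> 0 /\ - ln (Cmod c) <= V /\
  forall z, / 4 <= Cmod z < 1 -> Cmod (c * pprod bs z) <= 1.

Lemma neg_ln_circle_nonneg (c : C) bs V r t : normalized c bs V ->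
  / 4 <= r < 1 -> (forall b, In b bs -> Cmod b * r <> 1) ->
  0 <= - ln (Cmod (c * pprod bs (r * cis t))%C).
Proof.
intros (Hc & _ & Hq) Hr Hb. rewrite <- Ropp_0. apply Ropp_le_contravar. rewrite <- ln_1. apply ln_le.
- apply Cmod_gt_0, Cmult_neq_0; [exact Hc|]. apply (ln_pprod_circle bs r); [lra|exact Hb].
- apply Hq. rewrite Cmod_polar; lra.
Qed.

(** On the circle, A times the sum of the tents lies below - ln |q|, whose integral is at most 2 pi
    V by Jensen, while every tent has integral at least s / 16. *)
Lemma circle_count (c : C) bs V r s A (W : list C) :
  normalized c bs V ->
  / 4 <= r < 1 -> (forall b, In b bs -> Cmod b * r <> 1) -> 0 < s <= 1 -> 0 <= A ->
  NoDup W ->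
  (forall w, In w W -> Cmod w <= 1 /\ Rabs (r - Cmod w) <= s / 2 /\
     forall z, Cmod (z - w) <= s -> ln (Cmod (c * pprod bs z)) <= - A) ->
  (forall w w', In w W -> In w' W -> w <> w' -> 2 * s <= Cmod (w - w')) ->
  INR (length W) * (A * s) <= 32 * PI * V.
Proof.
intros Hn Hr Hb Hs HA ND HW Sep. pose proof Hn as (Hc & HV & Hq). pose proof PI_RGT_0 as HPI.
destruct (jensen_bound c bs r V Hc HV ltac:(lra) Hb) as [C1 J].
assert (L0 : 0 <= lsum (fun b => lnp (Cmod b * r)) bs) by (apply lsum_nonneg; intros; apply lnp_nonneg).
assert (Cb : forall w, In w W -> ct (bump r s w)) by (intros; apply bump_ct; lra).
assert (P : I2pi (fun t => A * lsum (fun w => bump r s w t) W) <=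
  I2pi (fun t => - ln (Cmod (c * pprod bs (r * cis t))%C))).
{ apply I2pi_le.
  - apply ct_mult; [apply ct_const|]. apply (lsum_ct (fun w t => bump r s w t)). exact Cb.
  - exact C1.
  - intros t. destruct (lsum_bump_le r s t W ltac:(lra) ND Sep) as [S1 S2].
    destruct (Rlt_le_dec 0 (lsum (fun w => bump r s w t) W)) as [L|L].
    + destruct (S2 L) as [w [Hw Hd]]. destruct (HW w Hw) as (_ & _ & H).
      specialize (H (r * cis t)%C ltac:(lra)). nra.
    + pose proof (neg_ln_circle_nonneg c bs V r t Hn Hr Hb). nra. }
rewrite I2pi_scal, (I2pi_lsum (fun w t => bump r s w t) W Cb) in P
  by (apply (lsum_ct (fun w t => bump r s w t)); exact Cb).
assert (Q : INR (length W) * (s / 16) <= lsum (fun w => I2pi (fun t => bump r s w t)) W).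
{ rewrite <- lsum_const. apply lsum_le. intros w Hw. destruct (HW w Hw) as (H1 & H2 & _).
  apply bump_mean; lra. }
pose proof (pos_INR (length W)). nra.
Qed.

Lemma lsum_incl_le {A} (g : A -> R) (l1 l2 : list A) :
  NoDup l1 -> incl l1 l2 -> (forall b, 0 <= g b) -> lsum g l1 <= lsum g l2.
Proof.
revert l2. induction l1 as [|a l1 IH]; intros l2 ND I Hg; [apply lsum_nonneg; auto|].
inversion ND as [|? ? Hin ND']; subst.
destruct (in_split a l2) as [x [y ->]]; [apply I; now left|].
rewrite lsum_app. simpl lsum. specialize (IH (x ++ y) ND').
rewrite lsum_app in IH. cut (incl l1 (x ++ y)); [intros K; specialize (IH K Hg); lra|].
intros b Hb. specialize (I b (or_intror Hb)). apply in_app_or in I. apply in_or_app.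
destruct I as [I|[I|I]]; [now left|subst; contradiction|now right].
Qed.

Lemma avoid_list (l : list R) a b : a < b -> exists r, a < r < b /\ forall x, In x l -> r <> x.
Proof.
revert b. induction l as [|x l IH]; intros b Hab; [exists ((a + b) / 2); split; [lra|intros x []]|].
destruct (Rlt_le_dec a x) as [L|L].
- destruct (IH (Rmin b x)) as [r [Hr H]]; [now apply Rmin_glb_lt|].
  pose proof (Rmin_l b x). pose proof (Rmin_r b x).
  exists r. split; [lra|]. intros y [<-|Hy]; [lra|now apply H].
- destruct (IH b Hab) as [r [Hr H]]. exists r. split; [exact Hr|].
  intros y [<-|Hy]; [lra|now apply H].
Qed.

(** Only the finitely many radii of circles through a zero, where - ln |q| is not continuous, have
    to be avoided. *)
Lemma generic_radius (bs : list C) a b : 0 <= a < b ->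
  exists r, a < r < b /\ forall x, In x bs -> Cmod x * r <> 1.
Proof.
intros Hab. destruct (avoid_list (map (fun x => / Cmod x) bs) a b) as [r [Hr H]]; [lra|].
exists r. split; [exact Hr|]. intros x Hx E.
apply (H (/ Cmod x)); [apply in_map_iff; now exists x|].
assert (Cmod x <> 0) by (intros K; rewrite K in E; lra).
apply (Rmult_eq_reg_l (Cmod x)); [|assumption]. rewrite E. field. assumption.
Qed.

Lemma NoDup_map_in {A B} (f : A -> B) (l : list A) : NoDup l ->
  (forall x y, In x l -> In y l -> f x = f y -> x = y) -> NoDup (map f l).
Proof.
induction l as [|a l IH]; intros ND H; [constructor|].
inversion ND as [|? ? Hin ND']; subst. simpl. constructor.
- intros K. apply in_map_iff in K. destruct K as [x [E Hx]]. apply Hin.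
  rewrite <- (H x a (or_intror Hx) (or_introl eq_refl) E). exact Hx.
- apply IH; [exact ND'|]. intros; apply H; auto; now right.
Qed.

(** The discs are disjoint, so they contain distinct zeros. A zero z charged by [a] adds ln (r /
    |z|) >= (r - |z|) / r to Jensen's sum; as r > 1 - g0 / 2 and |z| <= 1 - g a, this is at least g
    a / 2. On the circle - ln |q| >= 0, so Jensen's sum is at most V. *)
Lemma root_count {A : Type} (c : C) bs V (W : list A) (p : A -> C) (S g : A -> R) g0 :
  normalized c bs V ->
  NoDup W -> 0 < g0 < 1 ->
  (forall a, In a W -> g0 <= g a /\ Cmod (p a) + S a <= 1 - g a /\
     exists b z, In b bs /\ (1 - b * z)%C = 0 /\ Cmod (z - p a) <= S a) ->
  (forall a a', In a W -> In a' W -> a <> a' -> S a + S a' < Cmod (p a - p a')) ->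
  lsum g W <= 2 * V.
Proof.
intros Hn ND Hg0 HW Sep. pose proof Hn as (Hc & HV & Hq). pose proof PI_RGT_0 as HPI.
destruct (generic_radius bs (1 - g0 / 2) 1) as [r [Hr Hb]]; [lra|].
destruct (jensen_bound c bs r V Hc HV ltac:(lra) Hb) as [C1 J].
assert (I0 : 0 <= I2pi (fun t => - ln (Cmod (c * pprod bs (r * cis t))%C))).
{ assert (Z : I2pi (fun _ => 0) <= I2pi (fun t => - ln (Cmod (c * pprod bs (r * cis t))%C))).
  - apply I2pi_le; [apply ct_const|exact C1|]. intros t.
    apply (neg_ln_circle_nonneg c bs V r t Hn); [lra|exact Hb].
  - rewrite I2pi_const in Z. lra. }
assert (JV : lsum (fun b => lnp (Cmod b * r)) bs <= V) by nra.
(* Membership in [W] is moved inside the existential so that the choice is a total function; outside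
   [W] its value is arbitrary. *)
assert (Ch : forall a, exists b, In a W -> In b bs /\ exists z, (1 - b * z)%C = 0 /\ Cmod (z - p a) <= S a).
{ intros a. destruct (classic (In a W)) as [Ha|Ha].
  - destruct (HW a Ha) as (_ & _ & b & z & H1 & H2 & H3). exists b. intros _. split; [exact H1|].
    exists z. auto.
  - exists (RtoC 0). intros K; contradiction. }
set (f := fun a => pick (Ch a)).
assert (Hf : forall a, In a W -> In (f a) bs /\ exists z, (1 - f a * z)%C = 0 /\ Cmod (z - p a) <= S a).
{ intros a. exact (pick_spec (Ch a)). }
assert (ND2 : NoDup (map f W)).
{ apply NoDup_map_in; [exact ND|]. intros a a' Ha Ha' E.
  destruct (classic (a = a')) as [|N]; [assumption|exfalso].
  specialize (Sep a a' Ha Ha' N).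
  destruct (Hf a Ha) as (_ & z & H1 & H2). destruct (Hf a' Ha') as (_ & z' & H1' & H2').
  rewrite <- E in H1'.
  assert (Nb : f a <> 0).
  { intros K. rewrite K in H1. replace (1 - 0 * z)%C with (RtoC 1) in H1 by ring.
    apply RtoC_inj in H1. lra. }
  assert (Ez : z = z').
  { replace z with ((1 - (1 - f a * z)) / f a)%C by (field; exact Nb).
    replace z' with ((1 - (1 - f a * z')) / f a)%C by (field; exact Nb). now rewrite H1, H1'. }
  subst z'. pose proof (Cmod_triangle (p a - z) (z - p a'))%C as T.
  replace (p a - z + (z - p a'))%C with (p a - p a')%C in T by ring.
  rewrite (Cmod_sub_comm (p a) z) in T. lra. }
assert (K : lsum (fun b => lnp (Cmod b * r)) (map f W) <= V).
{ eapply Rle_trans; [|exact JV]. apply lsum_incl_le; [exact ND2| |intros; apply lnp_nonneg].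
  intros b Hb'. apply in_map_iff in Hb'. destruct Hb' as [a [<- Ha]]. now apply Hf. }
assert (E : lsum (fun b => lnp (Cmod b * r)) (map f W) = lsum (fun a => lnp (Cmod (f a) * r)) W).
{ generalize f. clear. intros f. induction W as [|a W IH]; simpl; [reflexivity|]. now rewrite IH. }
rewrite E in K.
assert (F : lsum (fun a => / 2 * g a) W <= lsum (fun a => lnp (Cmod (f a) * r)) W).
{ apply lsum_le. intros a Ha. destruct (HW a Ha) as (G1 & G2 & _).
  destruct (Hf a Ha) as (_ & z & H1 & H2).
  assert (Hz : Cmod z <= 1 - g a).
  { pose proof (Cmod_triangle_sub z (p a)) as T. apply Rabs_le_between in T. lra. }
  assert (Hm : Cmod (f a) * Cmod z = 1).
  { rewrite <- Cmod_mult. replace (f a * z)%C with (1 - (1 - f a * z))%C by ring.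
    rewrite H1. replace (1 - 0)%C with (RtoC 1) by ring. apply Cmod_1. }
  assert (Z0 : 0 < Cmod z) by (pose proof (Cmod_ge_0 z); destruct (Req_dec (Cmod z) 0) as [K0|K0]; [rewrite K0 in Hm; lra|lra]).
  assert (Ef : Cmod (f a) = / Cmod z).
  { apply (Rmult_eq_reg_r (Cmod z)); [|lra]. rewrite Hm. field. lra. }
  rewrite Ef. set (x := / Cmod z * r).
  assert (X1 : 1 < x).
  { unfold x. apply (Rmult_lt_reg_l (Cmod z)); [exact Z0|]. rewrite <- Rmult_assoc, Rinv_r by lra. lra. }
  unfold lnp. destruct (Rle_dec x 1); [lra|].
  assert (L : 1 - / x <= ln x).
  { pose proof (exp_ineq1_le (- ln x)) as Q. rewrite exp_Ropp, exp_ln in Q by lra. lra. }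
  eapply Rle_trans; [|exact L].
  assert (Ex : / x = Cmod z / r) by (unfold x; field; lra). rewrite Ex.
  apply (Rmult_le_reg_r r); [lra|]. unfold Rdiv.
  replace ((1 - Cmod z * / r) * r) with (r - Cmod z) by (field; lra). nra. }
rewrite lsum_scal in F. lra.
Qed.

Definition cfilter {A : Type} (P : A -> Prop) (l : list A) : list A :=
  filter (fun a => if excluded_middle_informative (P a) then true else false) l.

Lemma in_cfilter {A} (P : A -> Prop) l a : In a (cfilter P l) <-> In a l /\ P a.
Proof.
unfold cfilter. rewrite filter_In. destruct (excluded_middle_informative (P a)); intuition congruence.
Qed.

Lemma length_cfilter {A} (P : A -> Prop) l :
  length l = (length (cfilter P l) + length (cfilter (fun a => ~ P a) l))%nat.
Proof.
unfold cfilter. induction l as [|a l IH]; [reflexivity|]. simpl.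
destruct (excluded_middle_informative (P a)), (excluded_middle_informative (~ P a));
  try contradiction; simpl; rewrite IH; lia.
Qed.

Lemma class_bound {A} (P : nat -> A -> Prop) (B : R) (K : nat) (W : list A) :
  NoDup W -> (forall w, In w W -> exists k, (k < K)%nat /\ P k w) ->
  (forall k U, (k < K)%nat -> NoDup U -> incl U W -> (forall w, In w U -> P k w) -> INR (length U) <= B) ->
  INR (length W) <= INR K * B.
Proof.
revert W. induction K as [|K IH]; intros W ND HP HB.
- destruct W as [|w W]; [simpl; lra|]. destruct (HP w (or_introl eq_refl)) as [k [Hk _]]. lia.
- rewrite (length_cfilter (P K) W), plus_INR, S_INR.
  assert (INR (length (cfilter (P K) W)) <= B).
  { apply (HB K); [lia|now apply NoDup_filter| |].
    - intros a Ha. now apply in_cfilter in Ha.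
    - intros a Ha. now apply in_cfilter in Ha. }
  assert (INR (length (cfilter (fun a => ~ P K a) W)) <= INR K * B).
  { apply IH; [now apply NoDup_filter| |].
    - intros w Hw. apply in_cfilter in Hw. destruct Hw as [Hw1 Hw2].
      destruct (HP w Hw1) as [k [Hk Hk']]. exists k. split; [|exact Hk'].
      assert (k <> K) by (intros ->; contradiction). lia.
    - intros k U Hk NU I HU. apply (HB k U); auto.
      intros a Ha. specialize (I a Ha). now apply in_cfilter in I. }
  lra.
Qed.

Lemma half_pow_pos m : 0 < / 2 ^ m.
Proof. apply Rinv_0_lt_compat, pow_lt. lra. Qed.

Lemma half_pow_le m : (1 <= m)%nat -> / 2 ^ m <= / 2.
Proof.
intros H. apply Rinv_le_contravar; [lra|]. rewrite <- (pow_1 2) at 1. apply Rle_pow; [lra|exact H].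
Qed.

Lemma half_pow_S m : / 2 ^ (m + 1) = / 2 ^ m / 2.
Proof. rewrite pow_add, pow_1, Rinv_mult. reflexivity. Qed.

(* Points of [Y m] at distance more than [5 / (K 2^m)] from all zeros: the annulus is
   covered by [K] thin annuli, and on each of them the discs of radius [1 / (K 2^m)]
   around the points, where [-ln |q| >= A / 2] by Harnack, charge a circular mean. *)
Lemma far_count (c : C) bs V (K : nat) m A (W : list C) :
  normalized c bs V ->
  (1 <= m)%nat -> 20 < INR K -> 0 < A -> NoDup W ->
  (forall w, In w W -> Y m w /\ ln (Cmod (c * pprod bs w)) <= - A /\
     forall z b, Cmod (z - w) <= 5 / INR K * / 2 ^ m -> In b bs -> (1 - b * z)%C <> 0) ->
  (forall w w', In w W -> In w' W -> w <> w' -> 2 / INR K * / 2 ^ m <= Cmod (w - w')) ->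
  INR (length W) <= 64 * PI * V * INR K ^ 2 * 2 ^ m / A.
Proof.
intros Hn Hm HK HA ND HW Sep. pose proof Hn as (Hc & HV & Hq).
pose proof (half_pow_pos m) as D0. pose proof (half_pow_le m Hm) as D1.
set (d := / 2 ^ m) in *.
assert (HK0 : 0 < / INR K < / 20).
{ split; [apply Rinv_0_lt_compat; lra|]. apply Rinv_lt_contravar; lra. }
set (s := / INR K * d).
assert (Hs : 0 < s /\ s < d / 20 /\ s <= 1) by (unfold s; repeat split; nra).
assert (EK : INR K * s = d) by (unfold s; field; lra).
replace (64 * PI * V * INR K ^ 2 * 2 ^ m / A) with (INR K * (32 * PI * V / (A / 2 * s))).
2:{ unfold s, d. field. repeat split; try lra. apply pow_nonzero; lra. }
(* The level has width d / 2, that is [K] times s / 2. A radius taken in the k-th annulus is within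
   s / 2 of the moduli of its points, as [circle_count] demands; s is a fifth of the zero-free
   radius, so Harnack applies with A / 2. *)
apply (class_bound (fun k w => 1 - d + INR k * (s / 2) <= Cmod w < 1 - d + (INR k + 1) * (s / 2))).
- exact ND.
- intros w Hw. destruct (HW w Hw) as [[Y1 Y2] _]. rewrite half_pow_S in Y2. fold d in Y1, Y2.
  destruct (nfloor_ex ((Cmod w - (1 - d)) / (s / 2))) as [k [Hk1 Hk2]].
  { apply Rdiv_le_0_compat; lra. }
  assert (E : (Cmod w - (1 - d)) / (s / 2) * (s / 2) = Cmod w - (1 - d)) by (field; lra).
  exists k. split.
  + apply INR_lt. apply (Rmult_lt_reg_r (s / 2)); [lra|]. nra.
  + split; nra.
- intros k U Hk NU I HU.
  assert (Hk' : INR k + 1 <= INR K) by (rewrite <- S_INR; apply le_INR; lia).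
  assert (Hk0 := pos_INR k).
  destruct (generic_radius bs (1 - d + INR k * (s / 2)) (1 - d + (INR k + 1) * (s / 2))) as [r [Hr Hb]].
  { split; nra. }
  assert (Hr1 : r < 1) by nra.
  assert (Hr2 : / 4 <= r) by nra.
  pose proof (circle_count c bs V r s (A / 2) U Hn ltac:(lra) Hb ltac:(lra) ltac:(lra) NU) as CC.
  specialize (CC ltac:(
    intros w Hw; destruct (HW w (I w Hw)) as ([Y1 Y2] & L & Z); rewrite half_pow_S in Y2; fold d in Y1, Y2;
    specialize (HU w Hw); simpl in HU;
    split; [lra|]; split; [apply Rabs_le; lra|];
    intros z Hz;
    assert (Hd : forall u, Cmod (u - w) <= 5 / INR K * d -> / 4 <= Cmod u < 1) by
     (intros u Hu; replace (5 / INR K * d) with (5 * s) in Hu by (unfold s; field; lra);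
      pose proof (Cmod_triangle_sub u w) as T; apply Rabs_le_between in T; lra);
    pose proof (harnack_disc c bs w (5 / INR K * d) ltac:(unfold Rdiv; nra) Hc
      (fun u Hu => Hq u (Hd u Hu)) Z z) as H;
    replace (5 / INR K * d / 5) with s in H by (unfold s; field; lra);
    specialize (H Hz); lra)).
  specialize (CC ltac:(
    intros w w' Hw Hw' N; specialize (Sep w w' (I w Hw) (I w' Hw') N);
    replace (2 / INR K * d) with (2 * s) in Sep by (unfold s; field; lra); exact Sep)).
  apply Rle_div_r; [nra|exact CC].
Qed.

Lemma NoDup_flat_map {A B} (F : A -> list B) (l : list A) :
  NoDup l -> (forall a, In a l -> NoDup (F a)) ->
  (forall a a' x, In a l -> In a' l -> In x (F a) -> In x (F a') -> a = a') -> NoDup (flat_map F l).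
Proof.
induction l as [|a l IH]; intros ND H1 H2; [constructor|].
inversion ND as [|? ? Hin ND']; subst. simpl. apply NoDup_app.
- apply H1; now left.
- apply IH; [exact ND'| |]; intros; [apply H1; now right|].
  eapply H2; eauto; now right.
- intros x Hx K. apply in_flat_map in K. destruct K as [a' [Ha' Hx']].
  apply Hin. rewrite (H2 a a' x (or_introl eq_refl) (or_intror Ha') Hx Hx'). exact Ha'.
Qed.

Lemma lsum_flat_map {A B} (g : B -> R) (F : A -> list B) (l : list A) :
  lsum g (flat_map F l) = lsum (fun a => lsum g (F a)) l.
Proof.
induction l as [|a l IH]; [reflexivity|]. simpl. rewrite lsum_app, IH. reflexivity.
Qed.

Lemma Y_disjoint m m' z : Y m z -> Y m' z -> m = m'.
Proof.
assert (G : forall a b, Y a z -> Y b z -> (a < b)%nat -> False).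
{ intros a b [_ H1] [H2 _] L.
  assert (/ 2 ^ b <= / 2 ^ (a + 1)).
  { apply Rinv_le_contravar; [apply pow_lt; lra|]. apply Rle_pow; [lra|lia]. }
  lra. }
intros H H'. destruct (Nat.lt_total m m') as [L|[L|L]]; [elim (G _ _ H H' L)|exact L|elim (G _ _ H' H L)].
Qed.

Lemma restrict_lsum (J : nat -> Prop) (a : nat -> R) l : lsum (restrict J a) l = lsum a (cfilter J l).
Proof.
induction l as [|m l IH]; [reflexivity|]. unfold cfilter in *. simpl. unfold restrict at 1.
destruct (excluded_middle_informative (J m)); simpl; rewrite IH; ring.
Qed.

Lemma one_sub_conj_pos (z w : C) : Cmod z < 1 -> Cmod w < 1 -> 0 < Cmod (1 - Cconj z * w).
Proof.
intros Hz Hw. pose proof (one_sub_Cmod_le (Cconj z * w)) as T. rewrite Cmod_mult, Cmod_conj in T.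
pose proof (Cmod_ge_0 z). pose proof (Cmod_ge_0 w). nra.
Qed.

Lemma separation_lower (w w' : C) delta : 0 < delta -> Cmod w < 1 -> Cmod w' < 1 ->
  delta * Cmod (1 - Cconj w * w') <= Cmod (w - w') ->
  delta * (1 - Cmod w) <= Cmod (w - w') /\ delta * (1 - Cmod w') <= Cmod (w - w').
Proof.
intros Hd Hw Hw' H.
pose proof (one_sub_Cmod_le (Cconj w * w')) as T. rewrite Cmod_mult, Cmod_conj in T.
pose proof (Cmod_ge_0 w). pose proof (Cmod_ge_0 w').
split; (eapply Rle_trans; [|exact H]); apply Rmult_le_compat_l; nra.
Qed.

(** [gamma] and the bound 32 V are fixed before the polynomial and the finite set of levels, so an
    infinite set of levels can be exhausted, with a new polynomial for each finite part. *)
Lemma bad_levels (delta V : R) : 0 < delta -> 0 < V -> exists gamma, 0 < gamma /\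
  forall (c : C) bs (ms : list nat) (W : nat -> list C) (N : nat -> nat),
  normalized c bs V ->
  NoDup ms ->
  (forall m, In m ms -> (1 <= m)%nat /\ NoDup (W m) /\ (N m < 2 * length (W m))%nat /\
     forall w, In w (W m) -> Y m w /\
       Cmod (c * pprod bs w) < exp (- (gamma * 2 ^ m / INR (N m)))) ->
  (forall m m' w w', In m ms -> In m' ms -> In w (W m) -> In w' (W m') -> w <> w' ->
     delta * Cmod (1 - Cconj w * w') <= Cmod (w - w')) ->
  lsum (density N) ms <= 32 * V.
Proof.
intros Hd HV. pose proof PI_RGT_0 as HPI.
destruct (nfloor_ex (20 / delta)) as [K0 HK0]; [apply Rdiv_le_0_compat; lra|].
(* K > 20 keeps the discs of radius 5 / (K 2^m) within 2^-m / 4 of their centres; K > 20 / delta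
   makes discs about different points disjoint, also across levels. *)
set (K := (K0 + 22)%nat).
assert (HK : 20 < INR K /\ 20 / delta < INR K).
{ unfold K. rewrite plus_INR. simpl INR. pose proof (pos_INR K0). lra. }
assert (HKd : 20 < delta * INR K).
{ destruct HK as [_ HK]. apply (Rmult_lt_compat_l delta) in HK; [|exact Hd].
  replace (delta * (20 / delta)) with 20 in HK by (field; lra). exact HK. }
(* With A = gamma 2^m / N_m the bound of [far_count] becomes exactly N_m / 4. *)
set (gamma := 256 * PI * V * INR K ^ 2).
assert (HK2 : 0 < INR K ^ 2) by (apply pow_lt; lra).
assert (HPV : 0 < PI * V) by nra.
assert (Hg : 0 < gamma) by (unfold gamma; nra).
exists gamma. split; [exact Hg|].
intros c bs ms W N Hn ND HW Sep. pose proof Hn as (Hc & HcV & Hq).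
set (S := fun m : nat => 5 / INR K * / 2 ^ m).
set (near := fun m w => exists b z, In b bs /\ (1 - b * z)%C = 0 /\ Cmod (z - w) <= S m).
assert (YW : forall m w, In m ms -> In w (W m) -> 1 - / 2 ^ m <= Cmod w < 1 - / 2 ^ m / 2).
{ intros m w Hm Hw. destruct (HW m Hm) as (_ & _ & _ & H). destruct (H w Hw) as [[Y1 Y2] _].
  rewrite half_pow_S in Y2. lra. }
assert (IK : 0 < / INR K < / 20).
{ split; [apply Rinv_0_lt_compat; lra|]. apply Rinv_lt_contravar; lra. }
assert (Near : forall m, In m ms -> INR (N m) / 4 <= INR (length (cfilter (near m) (W m)))).
{ intros m Hm. destruct (HW m Hm) as (M1 & M2 & M3 & M4).
  pose proof (half_pow_pos m) as D0.
  assert (LenW : INR (N m) < 2 * INR (length (W m))).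
  { rewrite <- (mult_INR 2). apply lt_INR. exact M3. }
  rewrite (length_cfilter (near m) (W m)), plus_INR in LenW.
  (* For [N m = 0] the quotient in the exponent is a default value, but the claim is then
     trivial. *)
  destruct (Nat.eq_dec (N m) 0) as [E|E].
  { rewrite E. simpl. pose proof (pos_INR (length (cfilter (near m) (W m)))). lra. }
  assert (N0 : 0 < INR (N m)) by (apply lt_0_INR; lia).
  assert (P2 : 0 < 2 ^ m) by (apply pow_lt; lra).
  set (A := gamma * 2 ^ m / INR (N m)).
  assert (HA : 0 < A) by (unfold A; apply Rdiv_lt_0_compat; nra).
  pose proof (far_count c bs V K m A (cfilter (fun w => ~ near m w) (W m)) Hn M1 ltac:(lra) HA
    (NoDup_filter _ M2)) as F.
  assert (F' : INR (length (cfilter (fun w => ~ near m w) (W m))) <= 64 * PI * V * INR K ^ 2 * 2 ^ m / A).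
  { apply F.
    - intros w Hw. apply in_cfilter in Hw. destruct Hw as [Hw Far]. destruct (M4 w Hw) as [Y1 L].
      assert (Z : forall z b, Cmod (z - w) <= 5 / INR K * / 2 ^ m -> In b bs -> (1 - b * z)%C <> 0).
      { intros z b Hz Hb E0. apply Far. exists b, z. auto. }
      split; [exact Y1|]. split; [|exact Z].
      fold A in L. rewrite <- (ln_exp (- A)). apply ln_le; [|lra].
      apply Cmod_gt_0, Cmult_neq_0; [exact Hc|]. apply ln_Cmod_pprod. intros b Hb.
      apply Z; [|exact Hb]. replace (w - w)%C with (RtoC 0) by ring. rewrite Cmod_0. unfold Rdiv. nra.
    - intros w w' Hw Hw' Nw. apply in_cfilter in Hw. apply in_cfilter in Hw'.
      specialize (Sep m m w w' Hm Hm (proj1 Hw) (proj1 Hw') Nw).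
      pose proof (YW m w Hm (proj1 Hw)). pose proof (YW m w' Hm (proj1 Hw')).
      destruct (separation_lower w w' delta Hd ltac:(lra) ltac:(lra) Sep) as [S1 _].
      eapply Rle_trans; [|exact S1].
      apply Rle_trans with (delta * (/ 2 ^ m / 2)); [|apply Rmult_le_compat_l; lra].
      apply (Rmult_le_reg_r (INR K)); [lra|].
      replace (2 / INR K * / 2 ^ m * INR K) with (2 * / 2 ^ m) by (field; split; [apply pow_nonzero|]; lra).
      replace (delta * (/ 2 ^ m / 2) * INR K) with (delta * INR K * (/ 2 ^ m / 2)) by ring. nra. }
  assert (EF : 64 * PI * V * INR K ^ 2 * 2 ^ m / A = INR (N m) / 4).
  { unfold A, gamma. field. repeat split; try lra. }
  rewrite EF in F'. lra. }
(* Points are paired with their levels, since the radius and the weight in [root_count] depend on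
   the level. *)
set (L := flat_map (fun m => map (pair m) (cfilter (near m) (W m))) ms).
assert (InL : forall a, In a L -> In (fst a) ms /\ In (snd a) (W (fst a)) /\ near (fst a) (snd a)).
{ intros a Ha. apply in_flat_map in Ha. destruct Ha as [m [Hm Ha]]. apply in_map_iff in Ha.
  destruct Ha as [w [<- Hw]]. apply in_cfilter in Hw. simpl. tauto. }
destruct (classic (ms = nil)) as [->|Nms]; [simpl; lra|].
assert (exists M, forall m, In m ms -> (m <= M)%nat) as [M HM].
{ clear. induction ms as [|m ms [M IH]]; [exists O; intros m []|].
  exists (m + M)%nat. intros m' [<-|Hm']; [lia|]. specialize (IH m' Hm'). lia. }
assert (Q : lsum (fun a : nat * C => / 2 ^ fst a / 4) L <= 2 * V).
{ apply (root_count c bs V L snd (fun a => S (fst a)) (fun a => / 2 ^ fst a / 4) (/ 2 ^ M / 4) Hn).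
  - apply NoDup_flat_map; [exact ND| |].
    + intros m Hm. apply NoDup_map_in; [apply NoDup_filter, (HW m Hm)|].
      intros x y _ _ E. now inversion E.
    + intros m m' x _ _ Hx Hx'. apply in_map_iff in Hx. apply in_map_iff in Hx'.
      destruct Hx as [w [<- _]]. destruct Hx' as [w' [E _]]. now inversion E.
  - pose proof (half_pow_pos M). split; [lra|]. assert (/ 2 ^ M <= 1); [|lra].
    rewrite <- Rinv_1. apply Rinv_le_contravar; [lra|]. apply pow_R1_Rle; lra.
  - intros a Ha. destruct (InL a Ha) as (H1 & H2 & H3). split; [|split; [|exact H3]].
    + apply Rmult_le_compat_r; [lra|]. apply Rinv_le_contravar; [apply pow_lt; lra|].
      apply Rle_pow; [lra|now apply HM].
    + pose proof (YW _ _ H1 H2). pose proof (half_pow_pos (fst a)). unfold S, Rdiv. nra.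
  - intros a a' Ha Ha' Na. destruct (InL a Ha) as (H1 & H2 & _). destruct (InL a' Ha') as (H1' & H2' & _).
    assert (Nw : snd a <> snd a').
    { intros E. apply Na. destruct a as [m w], a' as [m' w']. simpl in *. subst w'. f_equal.
      destruct (HW m H1) as (_ & _ & _ & Q1). destruct (HW m' H1') as (_ & _ & _ & Q2).
      apply (Y_disjoint m m' w); [apply Q1|apply Q2]; assumption. }
    specialize (Sep _ _ _ _ H1 H1' H2 H2' Nw).
    pose proof (YW _ _ H1 H2) as Ya. pose proof (YW _ _ H1' H2') as Ya'.
    pose proof (half_pow_pos (fst a)) as P1. pose proof (half_pow_pos (fst a')) as P2.
    destruct (separation_lower (snd a) (snd a') delta Hd ltac:(lra) ltac:(lra) Sep) as [S1 S2].
    unfold S. set (x := / 2 ^ fst a) in *. set (y := / 2 ^ fst a') in *.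
    assert (Hx : 5 / INR K * x < delta * x / 4).
    { apply (Rmult_lt_reg_r (INR K)); [lra|].
      replace (5 / INR K * x * INR K) with (5 * x) by (field; lra). nra. }
    assert (Hy : 5 / INR K * y < delta * y / 4).
    { apply (Rmult_lt_reg_r (INR K)); [lra|].
      replace (5 / INR K * y * INR K) with (5 * y) by (field; lra). nra. }
    assert (delta * (x / 2) <= delta * (1 - Cmod (snd a))) by (apply Rmult_le_compat_l; lra).
    assert (delta * (y / 2) <= delta * (1 - Cmod (snd a'))) by (apply Rmult_le_compat_l; lra).
    lra. }
unfold L in Q. rewrite lsum_flat_map in Q.
assert (Q2 : lsum (fun m => / 16 * density N m) ms <=
  lsum (fun m => lsum (fun a : nat * C => / 2 ^ fst a / 4) (map (pair m) (cfilter (near m) (W m)))) ms).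
{ apply lsum_le. intros m Hm.
  assert (E : forall l : list C, lsum (fun a : nat * C => / 2 ^ fst a / 4) (map (pair m) l) = INR (length l) * (/ 2 ^ m / 4)).
  { induction l as [|w l IH]; [simpl; ring|]. cbn [length map]. rewrite S_INR. simpl lsum. rewrite IH. simpl. ring. }
  rewrite E. specialize (Near m Hm). unfold density. pose proof (half_pow_pos m). nra. }
rewrite lsum_scal in Q2. lra.
Qed.

(** * Part (a) *)

Lemma peval_add (l l' : list C) : exists l'', forall z, peval l'' z = (peval l z + peval l' z)%C.
Proof.
revert l'. induction l as [|a l IH]; intros l'.
- exists l'. intros; simpl; ring.
- destruct l' as [|b l']; [exists (a :: l); intros; simpl; ring|].
  destruct (IH l') as [m Hm]. exists (a + b :: m)%C. intros z. simpl. rewrite Hm. ring.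
Qed.

Lemma peval_monomial (a : C) (n : nat) : exists l, forall z, peval l z = (a * z ^ n)%C.
Proof.
induction n as [|n [l Hl]]; [exists (a :: nil); intros; simpl; ring|].
exists (RtoC 0 :: l). intros z. simpl. rewrite Hl. ring.
Qed.

Lemma peval_cesaro (c : nat -> C) (K : nat) : exists l, forall z, peval l z = cesaro c K z.
Proof.
assert (P : forall n, exists l, forall z, peval l z = psum c n z).
{ induction n as [|n [l Hl]]; [exists (c O :: nil); intros; simpl; ring|].
  destruct (peval_monomial (c (S n)) (S n)) as [l' Hl'].
  destruct (peval_add l l') as [m Hm]. exists m. intros z. rewrite Hm, Hl, Hl'. reflexivity. }
induction K as [|K [l Hl]]; [exists nil; reflexivity|].
destruct (P K) as [l' Hl']. destruct (peval_add l l') as [m Hm].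
exists m. intros z. rewrite Hm, Hl, Hl'. reflexivity.
Qed.

Lemma cesaro_0 (c : nat -> C) (K : nat) : cesaro c K 0 = (INR K * c O)%C.
Proof.
assert (P : forall n, psum c n 0 = c O).
{ induction n as [|n IH]; [reflexivity|]. cbn [psum]. rewrite IH. simpl. ring. }
induction K as [|K IH]; [simpl; ring|]. cbn [cesaro]. rewrite IH, P, S_INR, RtoC_plus. ring.
Qed.

(** The first k partial sums vanish, and each later one is z^k times a partial sum of the shifted
    series. *)
Lemma cesaro_shift (c : nat -> C) (k : nat) : (forall j, (j < k)%nat -> c j = 0) ->
  forall K z, cesaro c (k + K) z = (z ^ k * cesaro (fun n => c (k + n)%nat) K z)%C.
Proof.
intros H K z.
assert (P0 : forall n, (n < k)%nat -> psum c n z = 0).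
{ induction n as [|n IH]; intros Hn; [now apply H|]. cbn [psum].
  rewrite IH, H by lia. ring. }
assert (C0 : forall n, (n <= k)%nat -> cesaro c n z = 0).
{ induction n as [|n IH]; intros Hn; [reflexivity|]. cbn [cesaro].
  rewrite IH, P0 by lia. ring. }
assert (PS : forall n, psum c (k + n) z = (z ^ k * psum (fun n => c (k + n)%nat) n z)%C).
{ induction n as [|n IH].
  - rewrite Nat.add_0_r. cbn [psum]. rewrite Nat.add_0_r.
    destruct k as [|k]; [simpl; ring|]. cbn [psum]. rewrite P0 by lia. ring.
  - rewrite Nat.add_succ_r. cbn [psum]. rewrite IH, <- Nat.add_succ_r, Cpow_add_r. ring. }
induction K as [|K IH].
- rewrite Nat.add_0_r, C0 by lia. simpl. ring.
- rewrite Nat.add_succ_r. cbn [cesaro]. rewrite IH, PS. ring.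
Qed.

Lemma least_nat (P : nat -> Prop) : (exists n, P n) ->
  exists n, P n /\ forall k, P k -> (n <= k)%nat.
Proof.
intros [n Hn]. revert Hn. induction n as [n IH] using (well_founded_induction lt_wf). intros Hn.
destruct (classic (exists j, (j < n)%nat /\ P j)) as [[j [Hj Hc]]|F].
- exact (IH j Hj Hc).
- exists n. split; [exact Hn|]. intros k Hk.
  destruct (le_lt_dec n k) as [E|E]; [exact E|]. elim F. exists k. auto.
Qed.

(* A bounded [f] is a pointwise limit of [z^k] times polynomials that are bounded near
   the circle and not too small at 0; the factor [z^k] is dropped. *)
Lemma polynomial_approximation (f : C -> C) : Hinfty f -> nonzero_on_disk f ->
  exists V, 0 < V /\ forall (l : list (C * R)),
   (forall p, In p l -> / 2 <= Cmod (fst p) < 1 /\ Cmod (f (fst p)) < snd p) ->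
   exists (c : C) bs, normalized c bs V /\
     forall p, In p l -> Cmod (c * pprod bs (fst p))%C < snd p.
Proof.
intros [Hf [M0 HM0]] [z0 [Hz0 Hfz0]].
set (M := Rmax 1 M0). assert (M1 : 1 <= M) by apply Rmax_l.
assert (HM : forall z, Cmod z < 1 -> Cmod (f z) <= M).
{ intros z Hz. eapply Rle_trans; [now apply HM0|apply Rmax_r]. }
assert (D : forall z, Cmod z < 1 -> exists l, cdiff f z l).
{ intros z Hz. destruct (Hf z Hz) as [l Hl]. exists l. now apply is_derive_cdiff. }
destruct (fejer_approximation f M D HM) as [c [B A]].
(* If all coefficients vanished, so would f off 0 by the convergence, and at 0 by continuity. *)
assert (NZ : exists n, c n <> 0).
{ destruct (classic (exists n, c n <> 0)) as [E|N]; [exact E|exfalso].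
  assert (c0 : forall n, c n = 0).
  { intros n. destruct (Ceq_dec (c n) 0) as [E|E]; [exact E|]. elim N. now exists n. }
  assert (Ce : forall K z, cesaro c K z = 0).
  { intros K z. assert (P : forall n, psum c n z = 0).
    { induction n as [|n IH]; [apply c0|]. cbn [psum]. rewrite IH, c0. ring. }
    induction K as [|K IH]; [reflexivity|]. cbn [cesaro]. rewrite IH, P. ring. }
  assert (F0 : forall z, 0 < Cmod z < 1 -> f z = 0).
  { intros z Hz. apply Cmod_eq_0, Rle_antisym; [|apply Cmod_ge_0].
    apply le_epsilon. intros eps He. destruct (A z eps Hz He) as [K0 HK].
    specialize (HK (S K0) ltac:(lia)). rewrite Ce in HK.
    replace (0 - INR (S K0) * f z)%C with (- (INR (S K0) * f z))%C in HK by ring.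
    assert (0 < INR (S K0)) by (apply lt_0_INR; lia).
    rewrite Cmod_opp, Cmod_mult, Cmod_R, Rabs_pos_eq in HK by lra. nra. }
  destruct (Req_dec (Cmod z0) 0) as [E|E].
  - apply Cmod_eq_0 in E. subst z0. destruct (D 0 Hz0) as [l Hl].
    assert (F1 := proj1 (Cmod_gt_0 _) Hfz0).
    destruct (cdiff_ccont f 0 l Hl (Cmod (f 0)) F1) as [d [Hd H]].
    set (x := Rmin (/ 2) (d / 2)).
    assert (X : 0 < x /\ x <= / 2 /\ x <= d / 2).
    { unfold x. split; [apply Rmin_pos; lra|]. split; [apply Rmin_l|apply Rmin_r]. }
    specialize (H (RtoC x)). replace (x - 0)%C with (RtoC x) in H by ring.
    rewrite (F0 (RtoC x)) in H by (rewrite Cmod_R, Rabs_pos_eq; lra).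
    replace (0 - f 0)%C with (- f 0)%C in H by ring.
    rewrite Cmod_opp, Cmod_R, Rabs_pos_eq in H by lra. specialize (H ltac:(lra)). lra.
  - apply Hfz0, F0. unfold disk in Hz0. pose proof (Cmod_ge_0 z0). lra. }
destruct (least_nat _ NZ) as [k [Hk Hleast]].
assert (Hkj : forall j, (j < k)%nat -> c j = 0).
{ intros j Hj. apply NNPP. intros Hc. specialize (Hleast j Hc). lia. }
set (c' := fun n => c (k + n)%nat).
assert (Hk' : c' O <> 0) by (unfold c'; now rewrite Nat.add_0_r).
assert (Mk := proj1 (Cmod_gt_0 _) Hk').
assert (P4 : 1 <= 4 ^ k) by (apply pow_R1_Rle; lra).
(* A lower bound for |q 0| that is free of K: q will be the shifted Cesaro sum over n M 4^k with n =
   k + K <= 2 K, and its value at 0 has modulus K |c' 0| / (n M 4^k). *)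
set (v := Cmod (c' O) / (2 * M * 4 ^ k)).
assert (Hv : 0 < v) by (unfold v; apply Rdiv_lt_0_compat; nra).
exists (Rmax 1 (- ln v)). split; [apply Rlt_le_trans with 1; [lra|apply Rmax_l]|].
intros l Hl.
(* Strict inequalities at finitely many points survive for large K. The unnormalised sums make K = 0
   an exception. *)
assert (EV : exists K0, forall K, (K0 <= K)%nat -> forall p, In p l ->
   Cmod (cesaro c K (fst p)) < INR K * snd p \/ K = O).
{ clear - Hl A. induction l as [|p l IH]; [exists O; intros K _ p []|].
  destruct IH as [K1 H1]; [intros; apply Hl; now right|].
  destruct (Hl p (or_introl eq_refl)) as [Q1 Q2].
  destruct (A (fst p) ((snd p - Cmod (f (fst p))) / 2)) as [K2 H2]; [lra|lra|].
  exists (K1 + K2)%nat. intros K HK q [<-|Hq]; [|apply H1; [lia|exact Hq]].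
  destruct (Nat.eq_dec K 0) as [->|NK]; [now right|left].
  assert (KP : 0 < INR K) by (apply lt_0_INR; lia).
  specialize (H2 K ltac:(lia)).
  pose proof (Cmod_triangle (cesaro c K (fst p) - INR K * f (fst p)) (INR K * f (fst p)))%C as T.
  replace (cesaro c K (fst p) - INR K * f (fst p) + INR K * f (fst p))%C with (cesaro c K (fst p)) in T by ring.
  rewrite (Cmod_mult (INR K)), Cmod_R, Rabs_pos_eq in T by lra. nra. }
destruct EV as [K0 HK0].
(* Large enough for the approximation, and at least k, which gives n <= 2 K. *)
set (K := (K0 + k + 1)%nat). set (n := (k + K)%nat).
assert (KP : 0 < INR K) by (apply lt_0_INR; unfold K; lia).
assert (NP : 0 < INR n <= 2 * INR K).
{ split; [apply lt_0_INR; unfold n, K; lia|]. rewrite <- (mult_INR 2). apply le_INR. unfold n, K. lia. }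
destruct (peval_cesaro c' K) as [pl Hpl].
destruct (poly_factor pl) as [bs Hbs].
{ rewrite Hpl, cesaro_0. apply Cmult_neq_0; [|exact Hk']. apply RtoC_neq_0. lra. }
assert (Hbs' : forall z, cesaro c' K z = (INR K * c' O * pprod bs z)%C).
{ intros z. rewrite <- Hpl, Hbs, Hpl, cesaro_0. reflexivity. }
set (E := INR n * M * 4 ^ k). assert (EP : 0 < E) by (unfold E; repeat apply Rmult_lt_0_compat; lra).
assert (EC : RtoC E <> 0) by (apply RtoC_neq_0; lra).
assert (Sh : forall z, (z ^ k * (INR K * c' O / E * pprod bs z))%C = (cesaro c n z / E)%C).
{ intros z. unfold n. rewrite (cesaro_shift c k Hkj). fold c'. rewrite Hbs'. field. exact EC. }
assert (Sm : forall z, (Cmod z ^ k * Cmod (INR K * c' O / E * pprod bs z)) = Cmod (cesaro c n z) / E).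
{ intros z. rewrite <- Cmod_pow, <- Cmod_mult, Sh, Cmod_div by exact EC.
  now rewrite (Cmod_R E), (Rabs_pos_eq E) by lra. }
exists (INR K * c' O / E)%C, bs.
assert (Cn : Cmod (INR K * c' O / E) = INR K * Cmod (c' O) / E).
{ rewrite Cmod_div, Cmod_mult, !Cmod_R, !Rabs_pos_eq by (exact EC || lra). reflexivity. }
(* Dropping z^k costs at most the factor 4^k on |z| >= 1/4, and E contains this factor. *)
assert (Bd : forall z, / 4 <= Cmod z < 1 ->
  Cmod (INR K * c' O / E * pprod bs z) <= Cmod (cesaro c n z) / (INR n * M)).
{ intros z Hz. specialize (Sm z).
  assert (Pz : (/ 4) ^ k <= Cmod z ^ k) by (apply pow_incr; lra). rewrite pow_inv in Pz.
  set (y := Cmod (INR K * c' O / E * pprod bs z)) in *.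
  assert (Y0 : 0 <= y) by apply Cmod_ge_0.
  apply (Rmult_le_reg_r (/ 4 ^ k)); [apply Rinv_0_lt_compat; lra|].
  replace (Cmod (cesaro c n z) / (INR n * M) * / 4 ^ k) with (Cmod z ^ k * y)
    by (rewrite Sm; unfold E; field; lra).
  rewrite Rmult_comm. now apply Rmult_le_compat_r. }
assert (NM : 0 < INR n * M) by nra.
split; [split; [|split]|].
- apply Cmod_gt_0. rewrite Cn. apply Rdiv_lt_0_compat; nra.
- eapply Rle_trans; [|apply Rmax_r]. apply Ropp_le_contravar. apply ln_le; [exact Hv|].
  rewrite Cn. unfold v, E. apply (Rmult_le_reg_r (2 * M * 4 ^ k * INR n)); [assert (0 < M * 4 ^ k) by nra; assert (0 < M * 4 ^ k * INR n) by (apply Rmult_lt_0_compat; lra); lra|].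
  replace (Cmod (c' O) / (2 * M * 4 ^ k) * (2 * M * 4 ^ k * INR n)) with (Cmod (c' O) * INR n) by (field; lra).
  replace (INR K * Cmod (c' O) / (INR n * M * 4 ^ k) * (2 * M * 4 ^ k * INR n)) with (Cmod (c' O) * (2 * INR K)) by (field; lra).
  apply Rmult_le_compat_l; lra.
- intros z Hz. eapply Rle_trans; [now apply Bd|].
  apply Rle_div_l; [exact NM|]. rewrite Rmult_1_l. apply B. lra.
- intros p Hp. destruct (Hl p Hp) as [Q1 Q2].
  destruct (HK0 n ltac:(unfold n, K; lia) p Hp) as [Lt|Lt]; [|unfold n, K in Lt; lia].
  assert (S0 : 0 < snd p) by (pose proof (Cmod_ge_0 (f (fst p))); lra).
  eapply Rle_lt_trans; [apply Bd; lra|].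
  apply Rlt_div_l; [exact NM|].
  assert (0 < snd p * INR n) by nra. nra.
Qed.

Lemma separated_delta (z : nat -> C) : (forall k, disk (z k)) -> separated z ->
  exists delta, 0 < delta /\ forall n k, n <> k ->
    delta * Cmod (1 - Cconj (z n) * z k)%C <= Cmod (z n - z k).
Proof.
intros Hz S. unfold separated in S.
set (E := fun d : R => exists n k : nat, n <> k /\ d = Cmod ((z n - z k) / (1 - Cconj (z n) * z k))%C) in *.
destruct (Glb_Rbar_correct E) as [LB _].
assert (G : exists delta, 0 < delta /\ forall d, E d -> delta <= d).
(* An infimum [p_infty] would bound every real below, so 1 serves; [m_infty] contradicts
   separation. *)
{ destruct (Glb_Rbar E) as [g| |].
  - exists g. split; [exact S|]. intros d Hd. exact (LB d Hd).
  - exists 1. split; [lra|]. intros d Hd. elim (LB d Hd).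
  - elim S. }
destruct G as [delta [Hd H]]. exists delta. split; [exact Hd|].
intros n k Hnk. specialize (H _ (ex_intro _ n (ex_intro _ k (conj Hnk eq_refl)))).
assert (P := one_sub_conj_pos (z n) (z k) (Hz n) (Hz k)).
rewrite Cmod_div in H by (now apply Cmod_gt_0).
now apply Rle_div_r in H.
Qed.

Lemma sum_n_lsum (a : nat -> R) n : sum_n a n = lsum a (seq 0 (S n)).
Proof.
induction n as [|n IH].
- rewrite sum_O. simpl. ring.
- rewrite sum_Sn, IH, (seq_S (S n)), lsum_app. simpl lsum at 3. unfold plus; simpl. ring.
Qed.

Lemma lsum_le_Series (a : nat -> R) (l : list nat) :
  (forall n, 0 <= a n) -> ex_series a -> NoDup l -> lsum a l <= Series a.
Proof.
intros Ha Hs ND.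
assert (exists n, forall k, In k l -> (k <= n)%nat) as [n Hn].
{ clear. induction l as [|m l [M IH]]; [exists O; intros m []|].
  exists (m + M)%nat. intros m' [<-|Hm']; [lia|]. specialize (IH m' Hm'). lia. }
apply Rle_trans with (lsum a (seq 0 (S n))).
- apply lsum_incl_le; [exact ND| |exact Ha]. intros k Hk. apply in_seq. specialize (Hn k Hk). lia.
- rewrite <- sum_n_lsum.
  apply (is_lim_seq_incr_compare (sum_n a)).
  + apply (Series_correct a Hs).
  + intros k. rewrite sum_Sn. unfold plus; simpl. specialize (Ha (S k)). lra.
Qed.

Lemma ex_series_bounded (a : nat -> R) (B : R) :
  (forall n, 0 <= a n) -> (forall n, sum_n a n <= B) -> ex_series a.
Proof.
intros Ha HB. destruct (ex_finite_lim_seq_incr (sum_n a) B) as [l Hl].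
- intros k. rewrite sum_Sn. unfold plus; simpl. specialize (Ha (S k)). lra.
- exact HB.
- exists l. exact Hl.
Qed.

(** On the level, 1 - |w| lies between 2^-m / 2 and 2^-m: the linear factor of [rho] loses at most
    2, and the exponential does not decrease since theta is nonincreasing. *)
Lemma rho_Y (theta : R -> R) m (w : C) : admissible_weight theta -> (1 <= m)%nat -> Y m w ->
  rho theta (/ 2 ^ m) <= 2 * rho theta (1 - Cmod w).
Proof.
intros [_ Mono] Hm [Y1 Y2]. rewrite half_pow_S in Y2.
pose proof (half_pow_pos m). pose proof (half_pow_le m Hm).
assert (T : theta (/ 2 ^ m) <= theta (1 - Cmod w)) by (apply Mono; lra).
unfold rho. assert (E : exp (theta (/ 2 ^ m)) <= exp (theta (1 - Cmod w))).
{ destruct T as [T|T]; [left; now apply exp_increasing|right; now rewrite T]. }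
pose proof (exp_pos (theta (/ 2 ^ m))). nra.
Qed.

Lemma rho_nonneg theta t : 0 <= t -> 0 <= rho theta t.
Proof. intros. unfold rho. pose proof (exp_pos (theta t)). nra. Qed.

Lemma divergence_not_Lambda (theta : R -> R) (z : nat -> C) (N : nat -> nat) :
  admissible_weight theta -> disk_sequence z -> separated z ->
  (forall m : nat, (1 <= m)%nat -> count_in_Y z m (N m)) ->
  (forall (gamma : R) (J : nat -> Prop), 0 < gamma -> index_set J ->
     sum_finite J (density N) ->
     sum_infinite (fun m => (1 <= m)%nat /\ ~ J m) (term theta N gamma)) ->
  ~ Lambda theta z.
Proof.
intros Hth [Hz _] Hsep HN Hinf [_ [_ [f [Hf [Hf0 Hs]]]]].
destruct (polynomial_approximation f Hf Hf0) as [V [HV HP]].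
destruct (separated_delta z Hz Hsep) as [delta [Hd Sep]].
destruct (bad_levels delta V Hd HV) as [gamma [Hg BL]].
assert (HC : forall m, exists l : list nat, (1 <= m)%nat -> NoDup l /\ length l = N m /\
   forall k, In k l <-> Y m (z k)).
{ intros m. destruct (le_dec 1 m) as [L|L]; [|exists nil; intros K; lia].
  destruct (HN m L) as [l Hl]. exists l. intros _. exact Hl. }
set (ls := fun m => pick (HC m)).
assert (Hls : forall m, (1 <= m)%nat -> NoDup (ls m) /\ length (ls m) = N m /\
   forall k, In k (ls m) <-> Y m (z k)).
{ intros m. exact (pick_spec (HC m)). }
set (small := fun m k => Cmod (f (z k)) < exp (- (gamma * 2 ^ m / INR (N m)))).
(* Bad levels: f is small at more than half of the points. On the others at least half of the points
   retain |f z_k| >= exp (- gamma 2^m / N_m). *)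
set (J := fun m => (1 <= m)%nat /\ (N m < 2 * length (cfilter (small m) (ls m)))%nat).
assert (Zinj : forall n k, z n = z k -> n = k).
{ intros n k E. destruct (Nat.eq_dec n k) as [|Q]; [assumption|exfalso].
  specialize (Sep n k Q). rewrite E in Sep.
  replace (z k - z k)%C with (RtoC 0) in Sep by ring. rewrite Cmod_0 in Sep.
  pose proof (one_sub_conj_pos (z k) (z k) (Hz k) (Hz k)). nra. }
assert (Dn : forall m, 0 <= density N m).
{ intros m. unfold density. pose proof (pos_INR (N m)). pose proof (half_pow_pos m). nra. }
assert (SF : sum_finite J (density N)).
(* Each partial sum involves finitely many points and has its own polynomial; the bound is common to
   all. *)
{ apply (ex_series_bounded _ (32 * V)).
  - intros m. unfold restrict. destruct (excluded_middle_informative (J m)); [apply Dn|lra].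
  - intros n. rewrite sum_n_lsum.
    set (ms := cfilter J (seq 0 (S n))).
    rewrite restrict_lsum. fold ms.
    destruct (HP (flat_map (fun m => map (fun k => (z k, exp (- (gamma * 2 ^ m / INR (N m)))))
      (cfilter (small m) (ls m))) ms)) as (c & bs & Hn & Hsm).
    { intros p Hp. apply in_flat_map in Hp. destruct Hp as [m [Hm Hp]].
      apply in_map_iff in Hp. destruct Hp as [k [<- Hk]]. simpl.
      apply in_cfilter in Hm. destruct Hm as [_ [Hm _]]. apply in_cfilter in Hk. destruct Hk as [Hk Hk'].
      apply Hls in Hk; [|exact Hm]. destruct Hk as [Y1 _].
      pose proof (half_pow_le m Hm). split; [|exact Hk']. split; [lra|apply Hz]. }
    apply (BL c bs ms (fun m => map z (cfilter (small m) (ls m))) N Hn).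
    + apply NoDup_filter, seq_NoDup.
    + intros m Hm. assert (Hm' := Hm). apply in_cfilter in Hm. destruct Hm as [_ [Hm HJ]].
      split; [exact Hm|]. split; [|split].
      * apply NoDup_map_in; [apply NoDup_filter, (Hls m Hm)|]. intros x y _ _. apply Zinj.
      * rewrite length_map. exact HJ.
      * intros w Hw. apply in_map_iff in Hw. destruct Hw as [k [<- Hk]]. split.
        -- apply in_cfilter in Hk. now apply Hls.
        -- apply (Hsm (z k, exp (- (gamma * 2 ^ m / INR (N m))))).
           apply in_flat_map. exists m. split; [exact Hm'|]. apply in_map_iff. now exists k.
    + intros m m' w w' _ _ Hw Hw' Nw. apply in_map_iff in Hw. apply in_map_iff in Hw'.
      destruct Hw as [k [<- _]]. destruct Hw' as [k' [<- _]]. apply Sep. intros ->. now apply Nw. }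
specialize (Hinf gamma J Hg (fun m Hm => proj1 Hm) SF).
set (a := fun k : nat => if Ceq_dec (z k) (RtoC 0) then 0
      else rho theta (1 - Cmod (z k)) * Cmod (f (z k))) in *.
assert (Ha : forall k, 0 <= a k).
{ intros k. unfold a. destruct (Ceq_dec (z k) 0); [lra|]. apply Rmult_le_pos; [|apply Cmod_ge_0].
  apply rho_nonneg. pose proof (Hz k) as Q. unfold disk in Q. lra. }
set (G := fun m => (1 <= m)%nat /\ ~ J m).
(* One factor 2 because only half of the points count, another from [rho_Y]. *)
assert (TB : forall m, G m -> term theta N gamma m <= 4 * lsum a (ls m)).
{ intros m [Hm HJ]. destruct (Hls m Hm) as (L1 & L2 & L3).
  set (eta := exp (- (gamma * 2 ^ m / INR (N m)))).
  assert (Len : INR (N m) <= 2 * INR (length (cfilter (fun k => ~ small m k) (ls m)))).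
  { rewrite <- (mult_INR 2). apply le_INR.
    pose proof (length_cfilter (small m) (ls m)) as Q. rewrite L2 in Q.
    assert (~ (N m < 2 * length (cfilter (small m) (ls m)))%nat) by (intros K; apply HJ; split; assumption).
    lia. }
  assert (R0 : 0 <= rho theta (/ 2 ^ m)) by (apply rho_nonneg; left; apply half_pow_pos).
  assert (E0 : 0 < eta) by apply exp_pos.
  assert (Q : INR (length (cfilter (fun k => ~ small m k) (ls m))) * (/ 2 * (rho theta (/ 2 ^ m) * eta)) <=
     lsum a (cfilter (fun k => ~ small m k) (ls m))).
  { rewrite <- lsum_const. apply lsum_le. intros k Hk. apply in_cfilter in Hk. destruct Hk as [Hk Hk'].
    apply L3 in Hk. unfold small in Hk'. fold eta in Hk'. unfold a.
    pose proof (half_pow_le m Hm).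
    (* For m >= 1 the points satisfy |z_k| >= 1/2, so the omitted term never occurs here. *)
    destruct (Ceq_dec (z k) 0) as [E|E].
    { destruct Hk as [Y1 _]. rewrite E, Cmod_0 in Y1. lra. }
    pose proof (rho_Y theta m (z k) Hth Hm Hk). nra. }
  assert (Q2 : lsum a (cfilter (fun k => ~ small m k) (ls m)) <= lsum a (ls m)).
  { apply lsum_incl_le; [now apply NoDup_filter| |exact Ha]. intros k Hk. now apply in_cfilter in Hk. }
  unfold term. fold eta.
  assert (0 <= rho theta (/ 2 ^ m) * eta) by nra. nra. }
assert (PB : forall n, sum_n (restrict G (term theta N gamma)) n <= 4 * Series a).
{ intros n. rewrite sum_n_lsum.
  rewrite restrict_lsum. set (ms := cfilter G (seq 0 (S n))).
  assert (HG : forall m, In m ms -> G m) by (intros m Hm; now apply in_cfilter in Hm).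
  eapply Rle_trans; [apply (lsum_le _ (fun m => 4 * lsum a (ls m))); intros m Hm; apply TB, HG, Hm|].
  rewrite lsum_scal, <- lsum_flat_map. apply Rmult_le_compat_l; [lra|].
  apply lsum_le_Series; [exact Ha|exact Hs|].
  apply NoDup_flat_map.
  - apply NoDup_filter, seq_NoDup.
  - intros m Hm. apply Hls. now apply HG.
  - intros m m' k Hm Hm' Hk Hk'. apply HG in Hm. apply HG in Hm'.
    apply Hls in Hk; [|apply Hm]. apply Hls in Hk'; [|apply Hm'].
    exact (Y_disjoint m m' (z k) Hk Hk'). }
unfold sum_infinite in Hinf. fold G in Hinf.
apply is_lim_seq_spec in Hinf. destruct (Hinf (4 * Series a)) as [n Hn].
specialize (Hn n (Nat.le_refl n)). specialize (PB n). lra.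
Qed.

(** * Cantor sets *)

(** Greedy interpolation: [E] rises by one at each step until it reaches the value of [e] at the
    next index of [L]. Since [e] grows no faster than the index, there are always steps enough. *)
Lemma slow_profile (L : nat -> Prop) (e : nat -> nat) :
  (forall n, exists l, (n <= l)%nat /\ L l) ->
  (forall l, L l -> (e l <= l)%nat) ->
  (forall l l', L l -> L l' -> (l <= l')%nat -> (e l <= e l' <= e l + (l' - l))%nat) ->
  exists E : nat -> nat, E O = O /\ (forall n, (E n <= E (S n) <= S (E n))%nat) /\
    forall l, L l -> E l = e l.
Proof.
intros Hinf He Hinc.
assert (NX : forall n, exists l, (L l /\ (n <= l)%nat) /\ forall l', L l' /\ (n <= l')%nat -> (l <= l')%nat).
{ intros n. apply (least_nat (fun l => L l /\ (n <= l)%nat)). destruct (Hinf n) as [l [H1 H2]]. now exists l. }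
set (nx := fun n => pick (NX n)).
assert (Hnx : forall n, (L (nx n) /\ (n <= nx n)%nat) /\ forall l', L l' /\ (n <= l')%nat -> (nx n <= l')%nat).
{ intros n. exact (pick_spec (NX n)). }
set (E := fix E n := match n with O => O | S m => Nat.min (S (E m)) (e (nx (S m))) end).
assert (Up : forall n, (E n <= e (nx n))%nat).
{ destruct n; [simpl; lia|]. change (Nat.min (S (E n)) (e (nx (S n))) <= e (nx (S n)))%nat. lia. }
(* Rising by one at every remaining step would still reach [e l]; with [Up] this gives equality at n
   = l. *)
assert (Lo : forall n l, L l -> (n <= l)%nat -> (e l <= E n + (l - n))%nat).
{ induction n as [|n IH]; intros l Hl Hn; [specialize (He l Hl); simpl; lia|].
  change (e l <= Nat.min (S (E n)) (e (nx (S n))) + (l - S n))%nat.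
  specialize (IH l Hl ltac:(lia)). destruct (Hnx (S n)) as [[N1 N2] N3].
  specialize (N3 l (conj Hl Hn)). pose proof (Hinc _ _ N1 Hl N3). lia. }
exists E. split; [reflexivity|]. split.
- intros n. change (E n <= Nat.min (S (E n)) (e (nx (S n))) <= S (E n))%nat.
  destruct (Hnx n) as [[N1 N2] N3]. destruct (Hnx (S n)) as [[M1 M2] M3].
  specialize (N3 (nx (S n)) ltac:(split; [exact M1|lia])).
  pose proof (Hinc _ _ N1 M1 N3). specialize (Up n). lia.
- intros l Hl. specialize (Lo l l Hl (Nat.le_refl l)). specialize (Up l).
  destruct (Hnx l) as [[N1 N2] N3]. specialize (N3 l (conj Hl (Nat.le_refl l))).
  replace (nx l) with l in Up by lia. lia.
Qed.

(* The digits of a point of the Cantor set: the digit of weight [2^-(n+1)] is free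
   when [E] jumps at [n], and 0 otherwise. *)
Definition free (E : nat -> nat) (n : nat) : bool := Nat.eqb (E (S n)) (S (E n)).

(** Left end, in units of 2^-n, of the q-th interval of generation n: the bits of [q] fill the free
    digits, the lowest bit the last of them. *)
Fixpoint prefix (E : nat -> nat) (n q : nat) : nat :=
  match n with
  | O => O
  | S m => if free E m then 2 * prefix E m (q / 2) + q mod 2 else 2 * prefix E m q
  end.

Definition split_digit (E : nat -> nat) (n : nat) (phi : R -> C) (x : R) : C :=
  if free E n then ((phi x + phi (x + / 2 ^ S n)%R) / 2)%C else phi x.

(* The mean of [phi] over the points with free digits of index below [n]. *)
Fixpoint cmean (E : nat -> nat) (n : nat) (phi : R -> C) : C :=
  match n with O => phi 0 | S m => cmean E m (split_digit E m phi) end.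

Section Cantor.

Variable E : nat -> nat.

Lemma free_true n : free E n = true -> E (S n) = S (E n).
Proof. apply Nat.eqb_eq. Qed.

Lemma free_false (Estep : forall n, (E n <= E (S n) <= S (E n))%nat) n : free E n = false -> E (S n) = E n.
Proof. intros H. apply Nat.eqb_neq in H. specialize (Estep n). lia. Qed.

Lemma prefix_lt n q : (prefix E n q < 2 ^ n)%nat.
Proof.
revert q. induction n as [|n IH]; intros q; [simpl; lia|]. cbn [prefix Nat.pow].
destruct (free E n).
- specialize (IH (q / 2)%nat). pose proof (Nat.mod_upper_bound q 2 ltac:(lia)). lia.
- specialize (IH q). lia.
Qed.

Lemma prefix_inj (E0 : E O = O)
  (Estep : forall n, (E n <= E (S n) <= S (E n))%nat) n q q' : (q < 2 ^ E n)%nat -> (q' < 2 ^ E n)%nat ->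
  prefix E n q = prefix E n q' -> q = q'.
Proof.
revert q q'. induction n as [|n IH]; intros q q' Hq Hq'.
- rewrite E0 in Hq, Hq'. simpl in *. lia.
- cbn [prefix]. destruct (free E n) eqn:F.
  + rewrite (free_true n F) in Hq, Hq'. cbn [Nat.pow] in Hq, Hq'. intros H.
    pose proof (Nat.mod_upper_bound q 2 ltac:(lia)). pose proof (Nat.mod_upper_bound q' 2 ltac:(lia)).
    pose proof (Nat.div_mod_eq q 2). pose proof (Nat.div_mod_eq q' 2).
    assert (K : prefix E n (q / 2) = prefix E n (q' / 2)) by lia.
    apply IH in K; [lia| |]; apply Nat.Div0.div_lt_upper_bound; lia.
  + rewrite (free_false Estep n F) in Hq, Hq'. intros H. apply IH; [assumption|assumption|lia].
Qed.

Lemma cmean_ext n phi psi : (forall x, phi x = psi x) -> cmean E n phi = cmean E n psi.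
Proof.
revert phi psi. induction n as [|n IH]; intros phi psi H; [apply H|].
apply IH. intros x. unfold split_digit. now rewrite !H.
Qed.

Lemma cmean_lin n c phi psi :
  cmean E n (fun x => phi x + c * psi x)%C = (cmean E n phi + c * cmean E n psi)%C.
Proof.
revert phi psi. induction n as [|n IH]; intros phi psi; [reflexivity|].
simpl. rewrite <- IH. apply cmean_ext. intros x. unfold split_digit.
destruct (free E n); [|reflexivity]. field.
Qed.

Lemma C2_neq_0 : RtoC 2 <> 0.
Proof. apply RtoC_neq_0. lra. Qed.

Lemma cmean_bound n phi B : (forall x, Cmod (phi x) <= B) -> Cmod (cmean E n phi) <= B.
Proof.
revert phi. induction n as [|n IH]; intros phi H; [apply H|]. apply IH.
intros x. unfold split_digit. destruct (free E n); [|apply H].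
rewrite Cmod_div, Cmod_R, Rabs_pos_eq by (apply C2_neq_0 || lra).
pose proof (Cmod_triangle (phi x) (phi (x + / 2 ^ S n)%R)).
pose proof (H x). pose proof (H (x + / 2 ^ S n)%R). lra.
Qed.

Lemma Re_half (a b : C) : Re ((a + b) / 2)%C = (Re a + Re b) / 2.
Proof.
replace ((a + b) / 2)%C with ((/ 2)%R * (a + b))%C.
- unfold Re; simpl. field.
- rewrite RtoC_inv by lra. field.
Qed.

Lemma split_digit_nonneg n phi : (forall x, 0 <= Re (phi x)) -> forall x, 0 <= Re (split_digit E n phi x).
Proof.
intros H x. unfold split_digit. destruct (free E n); [|apply H]. rewrite Re_half.
pose proof (H x). pose proof (H (x + / 2 ^ S n)%R). lra.
Qed.

(** Each of the 2^(E n) points has that share of the mean, and the others contribute nonnegative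
    real parts. *)
Lemma cmean_point (E0 : E O = O)
  (Estep : forall n, (E n <= E (S n) <= S (E n))%nat) n q phi : (forall x, 0 <= Re (phi x)) ->
  Re (phi (INR (prefix E n q) * / 2 ^ n)) / 2 ^ E n <= Re (cmean E n phi).
Proof.
revert q phi. induction n as [|n IH]; intros q phi H.
- simpl. rewrite E0, Rmult_0_l. simpl. lra.
- cbn [cmean prefix].
  assert (P2 : 0 < / 2 ^ E n) by apply half_pow_pos.
  destruct (free E n) eqn:F.
  + eapply Rle_trans; [|apply (IH (q / 2)%nat), split_digit_nonneg, H].
    rewrite (free_true n F). unfold split_digit. rewrite F, Re_half.
    assert (Epos : INR (2 * prefix E n (q / 2) + q mod 2) * / 2 ^ S n =
      INR (prefix E n (q / 2)) * / 2 ^ n + INR (q mod 2) * / 2 ^ S n).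
    { rewrite plus_INR, mult_INR. simpl. field. apply pow_nonzero; lra. }
    rewrite Epos. set (x := INR (prefix E n (q / 2)) * / 2 ^ n).
    pose proof (H x). pose proof (H (x + / 2 ^ S n)).
    pose proof (Nat.mod_upper_bound q 2 ltac:(lia)) as M.
    simpl pow at 2. unfold Rdiv. rewrite Rinv_mult.
    destruct (q mod 2) as [|[|k]]; [| |lia].
    * rewrite Rmult_0_l, Rplus_0_r. nra.
    * rewrite Rmult_1_l. nra.
  + eapply Rle_trans; [|apply (IH q), split_digit_nonneg, H].
    rewrite (free_false Estep n F). unfold split_digit. rewrite F. right.
    do 3 f_equal. rewrite mult_INR. simpl. field. apply pow_nonzero; lra.
Qed.

(** An interval of generation m has mass 2^-(E m). The digits of index m to n - 1 move a point by at
    most 2^-m - 2^-n; this exact width makes the induction on n close. *)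
Lemma cmean_interval (E0 : E O = O)
  (Estep : forall n, (E n <= E (S n) <= S (E n))%nat) m q a n phi : (m <= n)%nat -> (forall x, 0 <= Re (phi x)) ->
  (forall x, INR (prefix E m q) * / 2 ^ m <= x <= INR (prefix E m q) * / 2 ^ m + / 2 ^ m - / 2 ^ n ->
     a <= Re (phi x)) ->
  a / 2 ^ E m <= Re (cmean E n phi).
Proof.
intros Hmn. revert phi. induction Hmn as [|n Hmn IH]; intros phi H Ha.
- eapply Rle_trans; [|apply (cmean_point E0 Estep m q phi H)].
  apply Rmult_le_compat_r; [left; apply half_pow_pos|]. apply Ha. lra.
- apply IH; [now apply split_digit_nonneg|].
  assert (P : / 2 ^ S n = / 2 ^ n / 2) by (rewrite <- Nat.add_1_r; apply half_pow_S).
  pose proof (half_pow_pos n).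
  intros x Hx. unfold split_digit. destruct (free E n).
  + rewrite Re_half. assert (a <= Re (phi x)) by (apply Ha; lra).
    assert (a <= Re (phi (x + / 2 ^ S n))) by (apply Ha; lra). lra.
  + apply Ha. lra.
Qed.

Definition lipschitz (phi : R -> C) : Prop :=
  exists k, 0 <= k /\ forall x y, Cmod (phi x - phi y) <= k * Rabs (x - y).

(** Integration against the uniform measure, as a limit of finite means. *)
Definition mean_lim (phi : R -> C) (l : C) : Prop :=
  forall eps, 0 < eps -> exists n0, forall n, (n0 <= n)%nat -> Cmod (cmean E n phi - l) < eps.

(** A free digit moves points by 2^-(n+1), so the means of a Lipschitz function form a Cauchy
    sequence. *)
Lemma mean_lim_ex phi : lipschitz phi -> exists l, mean_lim phi l.
Proof.
intros [k [Hk H]].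
assert (Step : forall n, Cmod (cmean E (S n) phi - cmean E n phi)%C <= k * / 2 ^ S n).
{ intros n. cbn [cmean].
  replace (cmean E n (split_digit E n phi) - cmean E n phi)%C with
    (cmean E n (split_digit E n phi) + (- (1)) * cmean E n phi)%C by ring.
  rewrite <- cmean_lin. apply cmean_bound. intros x. unfold split_digit.
  pose proof (half_pow_pos (S n)) as P. destruct (free E n).
  - replace ((phi x + phi (x + / 2 ^ S n)%R) / 2 + - (1) * phi x)%C with
      ((phi (x + / 2 ^ S n)%R - phi x) / 2)%C by field.
    rewrite Cmod_div, Cmod_R, (Rabs_pos_eq 2) by (apply C2_neq_0 || lra).
    specialize (H (x + / 2 ^ S n) x). replace (x + / 2 ^ S n - x) with (/ 2 ^ S n) in H by ring.
    rewrite Rabs_pos_eq in H by lra. pose proof (Cmod_ge_0 (phi (x + / 2 ^ S n)%R - phi x)%C). lra.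
  - replace (phi x + - (1) * phi x)%C with (RtoC 0) by ring. rewrite Cmod_0. nra. }
assert (Tail : forall n j, Cmod (cmean E (n + j) phi - cmean E n phi)%C <= k * (/ 2 ^ n - / 2 ^ (n + j))).
{ intros n j. induction j as [|j IH].
  - rewrite Nat.add_0_r. replace (cmean E n phi - cmean E n phi)%C with (RtoC 0) by ring.
    rewrite Cmod_0. right; ring.
  - rewrite Nat.add_succ_r. specialize (Step (n + j)%nat).
    assert (P : / 2 ^ S (n + j) = / 2 ^ (n + j) / 2) by (rewrite <- (Nat.add_1_r (n + j)); apply half_pow_S).
    pose proof (Cmod_triangle (cmean E (S (n + j)) phi - cmean E (n + j) phi) (cmean E (n + j) phi - cmean E n phi))%C as T.
    replace (cmean E (S (n + j)) phi - cmean E (n + j) phi + (cmean E (n + j) phi - cmean E n phi))%C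
      with (cmean E (S (n + j)) phi - cmean E n phi)%C in T by ring.
    rewrite P in *. nra. }
assert (Cau : forall eps, 0 < eps -> exists n0, forall n m, (n0 <= n)%nat -> (n0 <= m)%nat ->
   Cmod (cmean E n phi - cmean E m phi) < eps).
{ intros eps He. destruct (pow_to_0 (/ 2) (k + 1) (eps / 4)) as [n0 Hn0]; [lra|lra|lra|].
  specialize (Hn0 n0 (Nat.le_refl n0)). rewrite pow_inv in Hn0. pose proof (half_pow_pos n0).
  assert (B : forall n, (n0 <= n)%nat -> Cmod (cmean E n phi - cmean E n0 phi) <= eps / 4).
  { intros n Hn. specialize (Tail n0 (n - n0)%nat). replace (n0 + (n - n0))%nat with n in Tail by lia.
    pose proof (half_pow_pos n). nra. }
  exists n0. intros n m Hn Hm.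
  pose proof (Cmod_triangle (cmean E n phi - cmean E n0 phi) (- (cmean E m phi - cmean E n0 phi)))%C as T.
  replace (cmean E n phi - cmean E n0 phi + - (cmean E m phi - cmean E n0 phi))%C
    with (cmean E n phi - cmean E m phi)%C in T by ring.
  rewrite Cmod_opp in T. pose proof (B n Hn). pose proof (B m Hm). lra. }
assert (Lp : forall pr : C -> R, (forall u v, Rabs (pr u - pr v) <= Cmod (u - v)) ->
  ex_finite_lim_seq (fun n => pr (cmean E n phi))).
{ intros pr Hpr. apply ex_lim_seq_cauchy_corr. intros eps. destruct (Cau eps (cond_pos eps)) as [n0 H0].
  exists n0. intros n m Hn Hm. eapply Rle_lt_trans; [apply Hpr|apply (H0 n m Hn Hm)]. }
destruct (Lp Re (fun u v => Rabs_Re_le (u - v)%C)) as [a La].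
destruct (Lp Im (fun u v => Rabs_Im_le (u - v)%C)) as [b Lb].
exists (a, b). intros eps He.
apply is_lim_seq_spec in La. apply is_lim_seq_spec in Lb.
destruct (La (mkposreal (eps / 4) ltac:(lra))) as [n1 H1].
destruct (Lb (mkposreal (eps / 4) ltac:(lra))) as [n2 H2].
exists (n1 + n2)%nat. intros n Hn. specialize (H1 n ltac:(lia)). specialize (H2 n ltac:(lia)).
simpl in H1, H2. apply Rle_lt_trans with (Rabs (Re (cmean E n phi) - a) + Rabs (Im (cmean E n phi) - b)); [|lra].
replace (cmean E n phi - (a, b))%C with ((Re (cmean E n phi) - a)%R + Ci * (Im (cmean E n phi) - b)%R)%C
  by (apply C_ext; unfold Re, Im; simpl; ring).
eapply Rle_trans; [apply Cmod_triangle|]. rewrite Cmod_mult, Cmod_Ci, !Cmod_R. lra.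
Qed.

Lemma mean_lim_lin phi psi c l l' : mean_lim phi l -> mean_lim psi l' ->
  mean_lim (fun x => phi x + c * psi x)%C (l + c * l')%C.
Proof.
intros H H' eps He. pose proof (Cmod_ge_0 c) as Hc.
destruct (H (eps / 2) ltac:(lra)) as [n0 H0].
destruct (H' (eps / (2 * (Cmod c + 1)))) as [n1 H1]; [apply Rdiv_lt_0_compat; lra|].
exists (n0 + n1)%nat. intros n Hn. specialize (H0 n ltac:(lia)). specialize (H1 n ltac:(lia)).
rewrite cmean_lin.
replace (cmean E n phi + c * cmean E n psi - (l + c * l'))%C with
  ((cmean E n phi - l) + c * (cmean E n psi - l'))%C by ring.
eapply Rle_lt_trans; [apply Cmod_triangle|]. rewrite Cmod_mult.
assert ((Cmod c + 1) * (eps / (2 * (Cmod c + 1))) = eps / 2) by (field; lra).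
pose proof (Cmod_ge_0 (cmean E n psi - l')%C). nra.
Qed.

Lemma mean_lim_bound phi l B : mean_lim phi l -> (forall x, Cmod (phi x) <= B) -> Cmod l <= B.
Proof.
intros H HB. apply le_epsilon. intros eps He. destruct (H eps He) as [n Hn].
specialize (Hn n (Nat.le_refl n)). pose proof (cmean_bound n phi B HB).
pose proof (Cmod_triangle_sub l (cmean E n phi)) as T. rewrite Cmod_sub_comm in T.
apply Rabs_le_between in T. lra.
Qed.

Lemma mean_lim_Re_ge phi l a n0 : mean_lim phi l ->
  (forall n, (n0 <= n)%nat -> a <= Re (cmean E n phi)) -> a <= Re l.
Proof.
intros H HB. apply le_epsilon. intros eps He. destruct (H eps He) as [n Hn].
specialize (Hn (n + n0)%nat ltac:(lia)). specialize (HB (n + n0)%nat ltac:(lia)).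
pose proof (Rabs_Re_le (cmean E (n + n0) phi - l)%C) as T.
change (Re (cmean E (n + n0) phi - l)%C) with (Re (cmean E (n + n0) phi) - Re l) in T.
apply Rabs_le_between in T. lra.
Qed.

(** * The Cauchy kernel and its mean over the Cantor set *)

Definition ker (z : C) (x : R) : C := (/ (1 - z * cis (- x)))%C.

Lemma ker_den z x : 1 - Cmod z <= Cmod (1 - z * cis (- x))%C.
Proof.
pose proof (one_sub_Cmod_le (z * cis (- x))) as T. rewrite Cmod_mult, Cmod_cis in T. lra.
Qed.

Lemma ker_den_neq z x : Cmod z < 1 -> (1 - z * cis (- x))%C <> 0.
Proof. intros H. apply Cmod_gt_0. pose proof (ker_den z x). lra. Qed.

Lemma ker_mod z x : Cmod z < 1 -> Cmod (ker z x) <= / (1 - Cmod z).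
Proof.
intros H. unfold ker. rewrite Cmod_inv by now apply ker_den_neq.
apply Rinv_le_contravar; [lra|apply ker_den].
Qed.

Lemma ker_Re z x : Cmod z < 1 ->
  Re (ker z x) = (1 - Re (z * cis (- x))%C) / Cmod (1 - z * cis (- x))%C ^ 2.
Proof.
intros H. assert (N := proj1 (Cmod_gt_0 _) (ker_den_neq z x H)). unfold ker.
set (w := (z * cis (- x))%C) in *.
assert (Q : Cmod (1 - w) ^ 2 = (1 - Re w) ^ 2 + Im w ^ 2).
{ rewrite Cmod2_alt. unfold Re, Im; simpl. ring. }
rewrite Q. assert (0 < (1 - Re w) ^ 2 + Im w ^ 2) by (rewrite <- Q; apply pow_lt; lra).
unfold Cinv, Re, Im in *; simpl in *. field. lra.
Qed.

Lemma ker_Re_pos z x : Cmod z < 1 -> 0 <= Re (ker z x).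
Proof.
intros H. rewrite ker_Re by exact H.
assert (N := proj1 (Cmod_gt_0 _) (ker_den_neq z x H)).
apply Rdiv_le_0_compat; [|apply pow_lt; lra].
pose proof (Rabs_Re_le (z * cis (- x))%C) as T. rewrite Cmod_mult, Cmod_cis in T.
apply Rabs_le_between in T. lra.
Qed.

Lemma cis_neg_lipschitz : lipschitz (fun x => cis (- x)).
Proof.
exists 1. split; [lra|]. intros x y. eapply Rle_trans; [apply cis_lip|].
right. rewrite Rmult_1_l, <- Rabs_Ropp. f_equal. ring.
Qed.

Lemma lipschitz_mult phi psi A B : lipschitz phi -> lipschitz psi ->
  (forall x, Cmod (phi x) <= A) -> (forall x, Cmod (psi x) <= B) ->
  lipschitz (fun x => phi x * psi x)%C.
Proof.
intros [a [Ha H]] [b [Hb H']] HA HB.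
assert (A0 : 0 <= A) by (eapply Rle_trans; [apply Cmod_ge_0|apply (HA 0)]).
assert (B0 : 0 <= B) by (eapply Rle_trans; [apply Cmod_ge_0|apply (HB 0)]).
exists (a * B + A * b). split; [nra|]. intros x y.
replace (phi x * psi x - phi y * psi y)%C with ((phi x - phi y) * psi x + phi y * (psi x - psi y))%C by ring.
eapply Rle_trans; [apply Cmod_triangle|]. rewrite !Cmod_mult.
specialize (H x y). specialize (H' x y). specialize (HB x). specialize (HA y).
pose proof (Rabs_pos (x - y)).
assert (Cmod (phi x - phi y) * Cmod (psi x) <= a * Rabs (x - y) * B)
  by (apply Rmult_le_compat; auto; apply Cmod_ge_0).
assert (Cmod (phi y) * Cmod (psi x - psi y) <= A * (b * Rabs (x - y)))
  by (apply Rmult_le_compat; auto; apply Cmod_ge_0).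
lra.
Qed.

Lemma ker_lipschitz z : Cmod z < 1 -> lipschitz (ker z).
Proof.
intros H. exists (/ (1 - Cmod z) * / (1 - Cmod z)).
assert (P : 0 < / (1 - Cmod z)) by (apply Rinv_0_lt_compat; lra).
split; [nra|]. intros x y.
replace (ker z x - ker z y)%C with (z * (cis (- x) - cis (- y)) * (ker z x * ker z y))%C.
2:{ unfold ker. field. split; now apply ker_den_neq. }
rewrite !Cmod_mult.
pose proof (ker_mod z x H). pose proof (ker_mod z y H).
pose proof (cis_lip (- x) (- y)) as L. replace (- x - - y) with (- (x - y)) in L by ring.
rewrite Rabs_Ropp in L.
assert (Cmod (ker z x) * Cmod (ker z y) <= / (1 - Cmod z) * / (1 - Cmod z))
  by (apply Rmult_le_compat; auto; apply Cmod_ge_0).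
assert (Cmod z * Cmod (cis (- x) - cis (- y))%C <= 1 * Rabs (x - y))
  by (apply Rmult_le_compat; auto; try apply Cmod_ge_0; lra).
pose proof (Rabs_pos (x - y)).
rewrite (Rmult_comm _ (Rabs (x - y))), <- (Rmult_1_l (Rabs (x - y))).
apply Rmult_le_compat; auto; [|].
- apply Rmult_le_pos; apply Cmod_ge_0.
- apply Rmult_le_pos; apply Cmod_ge_0.
Qed.

(* [z |-> int (1 - z e^(-ix))^-1 dmu(x)] for the uniform measure [mu] of the Cantor set. *)
Lemma cantor_transform (E0 : E O = O)
  (Estep : forall n, (E n <= E (S n) <= S (E n))%nat) : exists g : C -> C,
  (forall z, Cmod z < 1 -> exists l, cdiff g z l) /\
  (forall z, Cmod z < 1 -> 0 <= Re (g z)) /\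
  (forall z m q a, Cmod z < 1 ->
    (forall x, INR (prefix E m q) * / 2 ^ m <= x <= INR (prefix E m q) * / 2 ^ m + / 2 ^ m -> a <= Re (ker z x)) ->
    a / 2 ^ E m <= Re (g z)).
Proof.
assert (G : forall z, exists l, Cmod z < 1 -> mean_lim (ker z) l).
{ intros z. destruct (Rlt_le_dec (Cmod z) 1) as [H|H]; [|exists (RtoC 0); lra].
  destruct (mean_lim_ex _ (ker_lipschitz z H)) as [l Hl]. now exists l. }
set (g := fun z => pick (G z)).
assert (Hg : forall z, Cmod z < 1 -> mean_lim (ker z) (g z)).
{ intros z. exact (pick_spec (G z)). }
exists g. split; [|split].
- intros z Hz. set (t := 1 - Cmod z). assert (Ht : 0 < t) by (unfold t; lra).
  assert (Pk : forall x, Cmod (ker z x) <= / t) by (intros; now apply ker_mod).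
  (* The candidate derivative is the mean of the z-derivative of the kernel. *)
  assert (Hd : exists d, mean_lim (fun x => cis (- x) * (ker z x * ker z x))%C d).
  { apply mean_lim_ex. apply (lipschitz_mult _ _ 1 (/ t * / t)).
    - apply cis_neg_lipschitz.
    - apply (lipschitz_mult _ _ (/ t) (/ t)); auto using ker_lipschitz.
    - intros x. rewrite Cmod_cis. lra.
    - intros x. rewrite Cmod_mult. apply Rmult_le_compat; auto; apply Cmod_ge_0. }
  destruct Hd as [d Hd]. exists d. intros eps He.
  assert (Pt : 0 < t ^ 3) by (apply pow_lt; lra).
  exists (Rmin (t / 2) (eps * t ^ 3 / 2)). split.
  { apply Rmin_pos; [lra|]. nra. }
  intros h Hh.
  destruct (Rmin_Rgt_l _ _ _ Hh) as [H1 H2].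
  assert (Hzh : Cmod (z + h) < 1 - t / 2).
  { pose proof (Cmod_triangle z h). unfold t in *. lra. }
  assert (Hzh1 : Cmod (z + h) < 1) by lra.
  pose proof (mean_lim_lin _ _ (- h)%C _ _ (mean_lim_lin _ _ (- (1))%C _ _ (Hg (z + h)%C Hzh1) (Hg z Hz)) Hd) as M.
  replace (g (z + h) - g z - d * h)%C with (g (z + h) + - (1) * g z + - h * d)%C by ring.
  apply Rle_trans with (2 / t ^ 3 * Cmod h * Cmod h).
  (* The kernel's remainder is exactly h^2 e^(-2ix) ker(z + h) ker(z)^2, at most 2 |h|^2 / t^3
     uniformly in x, and this bound passes to the limit of the means. *)
  + apply (mean_lim_bound _ _ _ M). intros x.
    replace (ker (z + h) x + - (1) * ker z x + - h * (cis (- x) * (ker z x * ker z x)))%C with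
      (h * h * (cis (- x) * cis (- x)) * (ker (z + h) x * (ker z x * ker z x)))%C.
    2:{ unfold ker. field. split; apply ker_den_neq; lra. }
    rewrite !Cmod_mult, Cmod_cis.
    assert (K1 : Cmod (ker (z + h) x) <= 2 / t).
    { eapply Rle_trans; [apply ker_mod; lra|]. replace (2 / t) with (/ (t / 2)) by (field; lra).
      apply Rinv_le_contravar; lra. }
    specialize (Pk x).
    assert (K2 : Cmod (ker z x) * Cmod (ker z x) <= / t * / t) by (apply Rmult_le_compat; auto; apply Cmod_ge_0).
    assert (K3 : Cmod (ker (z + h) x) * (Cmod (ker z x) * Cmod (ker z x)) <= 2 / t * (/ t * / t)).
    { apply Rmult_le_compat; auto; [apply Cmod_ge_0|]. apply Rmult_le_pos; apply Cmod_ge_0. }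
    replace (2 / t ^ 3 * Cmod h * Cmod h) with (Cmod h * Cmod h * (1 * 1) * (2 / t * (/ t * / t))) by (field; lra).
    apply Rmult_le_compat_l; [|exact K3]. pose proof (Cmod_ge_0 h). nra.
  + apply Rmult_le_compat_r; [apply Cmod_ge_0|].
    apply (Rmult_le_reg_r (t ^ 3 / 2)); [lra|].
    replace (2 / t ^ 3 * Cmod h * (t ^ 3 / 2)) with (Cmod h) by (field; lra). lra.
- intros z Hz. apply (mean_lim_Re_ge _ _ 0 O (Hg z Hz)). intros n _.
  pose proof (cmean_point E0 Estep n O (ker z) (fun x => ker_Re_pos z x Hz)) as Q.
  eapply Rle_trans; [|exact Q]. apply Rdiv_le_0_compat; [now apply ker_Re_pos|apply pow_lt; lra].
- intros z m q a Hz Ha. apply (mean_lim_Re_ge _ _ _ m (Hg z Hz)). intros n Hn.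
  apply (cmean_interval E0 Estep m q a n (ker z) Hn); [intros; now apply ker_Re_pos|].
  intros x Hx. apply Ha. pose proof (half_pow_pos n). lra.
Qed.

(** With d = 2^-m, w = z e^(-ix) satisfies 1 - Re w >= d and |1 - w| <= 2 d, the radial and angular
    parts being at most d each; d / (4 d^2) = 2^m / 4. *)
Lemma ker_Re_near m x u : (1 <= m)%nat -> Rabs (u - x) <= / 2 ^ m ->
  2 ^ m / 4 <= Re (ker ((1 - / 2 ^ m)%R * cis u)%C x).
Proof.
intros Hm Hux. pose proof (half_pow_pos m) as D0. pose proof (half_pow_le m Hm) as D1.
set (d := / 2 ^ m) in *. set (r := 1 - d).
assert (Mz : Cmod (r * cis u) = r) by (apply Cmod_polar; unfold r; lra).
rewrite ker_Re by (rewrite Mz; unfold r; lra).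
replace (r * cis u * cis (- x))%C with (r * cis (u - x))%C.
2:{ unfold Rminus. rewrite cis_plus. ring. }
set (v := u - x) in *.
assert (ReW : Re (r * cis v)%C <= r).
{ pose proof (Rabs_Re_le (r * cis v)%C) as T. rewrite Cmod_polar in T by (unfold r; lra).
  apply Rabs_le_between in T. lra. }
assert (Mw : Cmod (1 - r * cis v) <= 2 * d).
{ replace (1 - r * cis v)%C with (RtoC (1 - r) + r * (cis 0 - cis v))%C.
  2:{ unfold cis at 1. rewrite cos_0, sin_0, RtoC_minus. change (1, 0) with (RtoC 1). ring. }
  eapply Rle_trans; [apply Cmod_triangle|]. rewrite Cmod_mult, !Cmod_R.
  pose proof (cis_lip 0 v) as T. rewrite Rminus_0_l, Rabs_Ropp in T.
  rewrite !Rabs_pos_eq by (unfold r; lra). pose proof (Cmod_ge_0 (cis 0 - cis v)%C).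
  unfold r in *. nra. }
assert (M0 : 0 < Cmod (1 - r * cis v)).
{ pose proof (one_sub_Cmod_le (r * cis v)) as T.
  rewrite Cmod_polar in T by (unfold r; lra). assert (r < 1) by (unfold r; lra). lra. }
set (y := Cmod (1 - r * cis v)) in *.
replace (2 ^ m / 4) with (d * / (4 * d ^ 2)).
2:{ unfold d. field. apply pow_nonzero; lra. }
unfold Rdiv. apply Rmult_le_compat; [lra| |assert (d = 1 - r) by (unfold r; ring); lra|].
- left. apply Rinv_0_lt_compat. nra.
- apply Rinv_le_contravar; [nra|]. nra.
Qed.

End Cantor.

(** The chord is 2 |sin (x / 2)|, and sin y >= y / 2 for y <= 1/2 because the cosine is at least 1/2
    there. *)
Lemma cis_chord (a b : R) : Rabs (a - b) <= 1 -> Rabs (a - b) / 2 <= Cmod (cis a - cis b).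
Proof.
intros H. pose proof (cis_dist2 a b) as D. set (x := a - b) in *.
replace (cos x) with (cos (2 * (x / 2))) in D by (f_equal; field).
rewrite cos_2a_sin in D.
assert (S : forall y, 0 < y <= / 2 -> y / 2 <= sin y).
{ intros y Hy. destruct (MVT_cor2 sin cos 0 y) as [c [Ec Hc]]; [lra|intros; apply derivable_pt_lim_sin|].
  rewrite sin_0, !Rminus_0_r in Ec. rewrite Ec.
  assert (/ 2 <= cos c); [|nra]. pose proof PI2_3_2.
  replace (/ 2) with (cos (PI / 3)) by (rewrite cos_PI3; field).
  apply cos_decr_1; lra. }
pose proof (Cmod_ge_0 (cis a - cis b)%C).
assert (Q : Rabs x * Rabs x / 16 <= sin (x / 2) * sin (x / 2)).
{ destruct (Req_dec x 0) as [E|E].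
  - rewrite E, Rabs_R0. unfold Rdiv. rewrite !Rmult_0_l, sin_0. lra.
  - assert (E2 : sin (x / 2) * sin (x / 2) = sin (Rabs x / 2) * sin (Rabs x / 2)).
    { unfold Rabs. destruct (Rcase_abs x); [|reflexivity].
      replace (- x / 2) with (- (x / 2)) by field. rewrite sin_neg. ring. }
    rewrite E2. pose proof (Rabs_pos_lt x E). specialize (S (Rabs x / 2) ltac:(lra)). nra. }
pose proof (Rabs_pos x). nra.
Qed.

(** 1 - conj z w = (1 - |z|^2) + conj z (z - w) has modulus at most 2 x + |z - w|. By hypothesis c x
    <= 4 |z - w|, so c times it is at most 9 |z - w|. *)
Lemma separated_of_dist (z w : C) (c x : R) : 0 < c <= / 2 -> Cmod z <= 1 -> 1 - Cmod z <= x ->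
  c * x / 4 <= Cmod (z - w) -> c / 9 * Cmod (1 - Cconj z * w) <= Cmod (z - w).
Proof.
intros Hc Hz Hx H.
assert (E : (1 - Cconj z * w)%C = (RtoC (1 - Cmod z ^ 2) + Cconj z * (z - w))%C).
{ replace (RtoC (1 - Cmod z ^ 2)) with (1 - z * Cconj z)%C; [ring|].
  rewrite <- Cmod2_conj. now rewrite RtoC_minus. }
pose proof (Cmod_triangle (RtoC (1 - Cmod z ^ 2)) (Cconj z * (z - w))%C) as T.
rewrite <- E, Cmod_mult, Cmod_conj, Cmod_R in T. pose proof (Cmod_ge_0 z).
rewrite Rabs_pos_eq in T by nra.
pose proof (Cmod_ge_0 (z - w)%C). set (d := Cmod (z - w)) in *.
assert (T2 : Cmod (1 - Cconj z * w) <= 2 * x + d) by nra.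
assert (c / 9 * (2 * x + d) <= d) by nra. nra.
Qed.

(** * Part (b) *)

Lemma INR_dist (a b : nat) : a <> b -> 1 <= Rabs (INR a - INR b).
Proof.
intros H. destruct (Nat.lt_total a b) as [L|[L|L]]; [|contradiction|].
- apply le_INR in L. rewrite S_INR in L. rewrite Rabs_left1; lra.
- apply le_INR in L. rewrite S_INR in L. rewrite Rabs_pos_eq; lra.
Qed.

Definition count_profile (L : nat -> Prop) (N : nat -> nat) : Prop :=
  index_set L /\
  (forall M : nat, exists m : nat, (M <= m)%nat /\ L m) /\
  (forall m n : nat, L m -> L n -> (m <= n)%nat -> (N m <= N n)%nat) /\
  filterlim N (within L eventually) eventually /\
  (forall m n : nat, L m -> L n -> (m <= n)%nat -> density N n <= density N m) /\
  filterlim (density N) (within L eventually) (locally 0).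

(** Spacing is needed at every level of [L], largeness of Re g only from m0 on: the finitely many
    earlier levels cannot affect convergence. Angles stay in [0, 1], where chords are comparable to
    arcs. *)
Lemma cantor_configuration (L : nat -> Prop) (N : nat -> nat) :
  count_profile L N ->
  exists (g : C -> C) (ang : nat -> nat -> R) (m0 : nat) (c : R),
    0 < c <= / 2 /\
    (forall z, Cmod z < 1 -> exists l, cdiff g z l) /\
    (forall z, Cmod z < 1 -> 0 <= Re (g z)) /\
    forall m, L m ->
      (forall i, (i < N m)%nat -> 0 <= ang m i <= 1) /\
      (forall i j, (i < N m)%nat -> (j < N m)%nat -> i <> j -> c * / 2 ^ m <= Rabs (ang m i - ang m j)) /\
      ((m0 <= m)%nat -> forall i, (i < N m)%nat ->
         2 ^ m / (4 * INR (N m)) <= Re (g ((1 - / 2 ^ m)%R * cis (ang m i))%C)).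
Proof.
intros (HL & Hinf & Nmono & Nlim & Dmono & Dlim).
(* From m0 on the logarithm of N_m makes sense and N_m <= 2^m, so floor (log2 N_m) <= m digits
   suffice. *)
assert (Hm0 : exists m0, forall m, (m0 <= m)%nat -> L m -> (1 <= N m)%nat /\ density N m <= 1).
{ destruct (Nlim (fun n => (1 <= n)%nat) (ex_intro _ 1%nat (fun n Hn => Hn))) as [n1 H1].
  destruct (Dlim (fun x => Rabs (x - 0) < 1)) as [n2 H2].
  { exists (mkposreal 1 Rlt_0_1). intros y Hy. exact Hy. }
  exists (n1 + n2)%nat. intros m Hm Lm. split; [apply H1; [lia|exact Lm]|].
  specialize (H2 m ltac:(lia) Lm). simpl in H2. apply Rabs_def2 in H2. lra. }
destruct Hm0 as [m0 Hm0].
set (L' := fun m => L m /\ (m0 <= m)%nat).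
destruct (slow_profile L' (fun m => Nat.log2 (N m))) as (E & E0 & Estep & HE).
- intros n. destruct (Hinf (n + m0)%nat) as [l [H1 H2]]. exists l. unfold L'. repeat split; [lia|exact H2|lia].
- intros l [Hl Hl']. destruct (Hm0 l Hl' Hl) as [H1 H2].
  rewrite <- (Nat.log2_pow2 l) at 2 by lia. apply Nat.log2_le_mono.
  apply INR_le. rewrite pow_INR. simpl INR at 2. unfold density in H2.
  pose proof (pow_lt 2 l ltac:(lra)) as P.
  apply (Rmult_le_compat_r (2 ^ l)) in H2; [|lra].
  rewrite Rmult_assoc, Rinv_l in H2 by lra. replace (1 + 1) with 2 by ring. lra.
(* As N_m 2^-m is nonincreasing, N_l' <= 2^(l' - l) N_l: the logarithm grows no faster than the
   index. *)
- intros l l' [Hl Hl1] [Hl' Hl1'] Hll. split; [apply Nat.log2_le_mono; now apply Nmono|].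
  destruct (Hm0 l Hl1 Hl) as [H1 _].
  rewrite Nat.add_comm, <- Nat.log2_mul_pow2 by lia. apply Nat.log2_le_mono.
  apply INR_le. rewrite mult_INR, pow_INR. simpl INR at 3. replace (1 + 1) with 2 by ring.
  specialize (Dmono l l' Hl Hl' Hll). unfold density in Dmono.
  pose proof (pow_lt 2 l ltac:(lra)) as P. pose proof (pow_lt 2 l' ltac:(lra)) as P'.
  assert (Epow : 2 ^ l' = 2 ^ l * 2 ^ (l' - l)) by (rewrite <- pow_add; f_equal; lia).
  apply (Rmult_le_compat_r (2 ^ l')) in Dmono; [|lra].
  rewrite Rmult_assoc, Rinv_l, Rmult_1_r in Dmono by lra.
  eapply Rle_trans; [exact Dmono|]. right. rewrite Epow. field. lra.
- destruct (cantor_transform E E0 Estep) as (g & G1 & G2 & G3).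
  (* The two points of an interval are its left end and midpoint, in units of 2^-(m+1). They suffice
     because N_m < 2 times 2^(E m). *)
  set (num := fun m i => (2 * prefix E m (i / 2) + i mod 2)%nat).
  set (ang := fun m i => if le_dec m0 m then INR (num m i) * / 2 ^ S m else INR i / INR (N m)).
  (* Below m0 the angles i / N_m are spaced by 1 / N_m >= 2^-m / D, as the density is at most D; the
     summand 2 covers the spacing 2^-m / 2 of the Cantor levels. *)
  set (D := 2 + lsum (density N) (seq 0 m0)).
  assert (Dn : forall m, 0 <= density N m).
  { intros m. unfold density. pose proof (pos_INR (N m)). pose proof (half_pow_pos m). nra. }
  assert (D2 : 2 <= D).
  { unfold D. assert (0 <= lsum (density N) (seq 0 m0)) by (apply lsum_nonneg; intros; apply Dn). lra. }
  assert (HD : 0 < / D <= / 2).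
  { split; [apply Rinv_0_lt_compat; lra|apply Rinv_le_contravar; lra]. }
  assert (Epow : forall m, / 2 ^ S m = / 2 ^ m / 2) by (intros; rewrite <- Nat.add_1_r; apply half_pow_S).
  assert (Half : forall m i, L m -> (m0 <= m)%nat -> (i < N m)%nat -> (i / 2 < 2 ^ E m)%nat).
  { intros m i Hm Hm' Hi. rewrite (HE m (conj Hm Hm')).
    destruct (Nat.log2_spec (N m)) as [_ S2]; [lia|]. cbn [Nat.pow] in S2.
    apply Nat.Div0.div_lt_upper_bound. lia. }
  exists g, ang, m0, (/ D). split; [exact HD|]. split; [exact G1|]. split; [exact G2|].
  intros m Hm. unfold ang. pose proof (half_pow_pos m) as P. destruct (le_dec m0 m) as [Lm|Lm].
  + split; [|split].
    * intros i Hi. assert (B : (num m i <= 2 ^ S m)%nat).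
      { unfold num. pose proof (prefix_lt E m (i / 2)).
        pose proof (Nat.mod_upper_bound i 2 ltac:(lia)). cbn [Nat.pow]. lia. }
      apply le_INR in B. rewrite pow_INR in B. change (INR 2) with 2 in B.
      pose proof (pos_INR (num m i)). pose proof (half_pow_pos (S m)).
      split; [nra|]. apply (Rmult_le_reg_r (2 ^ S m)); [apply pow_lt; lra|].
      rewrite Rmult_assoc, Rinv_l by (apply pow_nonzero; lra). lra.
    * intros i j Hi Hj Hij.
      assert (Nn : num m i <> num m j).
      { unfold num. intros K. apply Hij.
        pose proof (Nat.mod_upper_bound i 2 ltac:(lia)). pose proof (Nat.mod_upper_bound j 2 ltac:(lia)).
        pose proof (Nat.div_mod_eq i 2). pose proof (Nat.div_mod_eq j 2).
        assert (K2 : prefix E m (i / 2) = prefix E m (j / 2)) by lia.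
        apply (prefix_inj E E0 Estep) in K2; auto. lia. }
      apply INR_dist in Nn. rewrite <- Rmult_minus_distr_r, Rabs_mult.
      pose proof (half_pow_pos (S m)). rewrite (Rabs_pos_eq (/ 2 ^ S m)) by lra.
      rewrite Epow in *. nra.
    * intros _ i Hi. destruct (Hm0 m Lm Hm) as [N1 _].
      set (x0 := INR (prefix E m (i / 2)) * / 2 ^ m).
      assert (Eang : INR (num m i) * / 2 ^ S m = x0 + INR (i mod 2) * (/ 2 ^ m / 2)).
      { unfold num, x0. rewrite Epow, plus_INR, mult_INR. change (INR 2) with 2. field. apply pow_nonzero; lra. }
      assert (Bm : 0 <= INR (i mod 2) <= 1).
      { split; [apply pos_INR|]. apply (le_INR _ 1). pose proof (Nat.mod_upper_bound i 2 ltac:(lia)). lia. }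
      assert (Hm1 := HL m Hm). pose proof (half_pow_le m Hm1).
      eapply Rle_trans; [|apply (G3 _ m (i / 2)%nat (2 ^ m / 4))].
      -- assert (P1 : INR (2 ^ E m) <= INR (N m)).
         { apply le_INR. rewrite (HE m (conj Hm Lm)). apply Nat.log2_spec. lia. }
         rewrite pow_INR in P1. change (INR 2) with 2 in P1.
         pose proof (pow_lt 2 (E m) ltac:(lra)) as P2. pose proof (pow_lt 2 m ltac:(lra)) as P3.
         replace (2 ^ m / 4 / 2 ^ E m) with (2 ^ m / (4 * 2 ^ E m)) by (field; lra).
         apply Rmult_le_compat_l; [lra|]. apply Rinv_le_contravar; lra.
      -- rewrite Cmod_polar; lra.
      -- intros x Hx. apply ker_Re_near; [exact Hm1|]. rewrite Eang. fold x0 in Hx. apply Rabs_le. nra.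
  + split; [|split; [|intros; lia]].
    * intros i Hi. assert (Q : INR i <= INR (N m)) by (apply le_INR; lia).
      assert (Q0 : 0 < INR (N m)) by (apply lt_0_INR; lia). pose proof (pos_INR i).
      split; [apply Rdiv_le_0_compat; lra|]. apply Rle_div_l; lra.
    * intros i j Hi Hj Hij. assert (Q0 : 0 < INR (N m)) by (apply lt_0_INR; lia).
      apply INR_dist in Hij.
      replace (INR i / INR (N m) - INR j / INR (N m)) with ((INR i - INR j) * / INR (N m)) by (unfold Rdiv; ring).
      rewrite Rabs_mult, (Rabs_pos_eq (/ INR (N m))) by (left; now apply Rinv_0_lt_compat).
      assert (DD : density N m <= D).
      { unfold D. assert (density N m <= lsum (density N) (seq 0 m0)); [|lra].
        eapply Rle_trans; [|apply (lsum_incl_le (density N) (m :: nil))].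
        - simpl. lra.
        - constructor; [intros []|constructor].
        - intros k [<-|[]]. apply in_seq. lia.
        - exact Dn. }
      unfold density in DD.
      apply Rle_trans with (1 * / INR (N m)); [|apply Rmult_le_compat_r; [left; now apply Rinv_0_lt_compat|exact Hij]].
      apply (Rmult_le_reg_r (D * INR (N m))); [nra|].
      replace (/ D * / 2 ^ m * (D * INR (N m))) with (INR (N m) * / 2 ^ m) by (field; split; [apply pow_nonzero|]; lra).
      replace (1 * / INR (N m) * (D * INR (N m))) with D by (field; lra). exact DD.
Qed.

(* Blocks of sizes [cnt 0, cnt 1, ...] are listed one after the other; the index [k]
   lies in block [lev k], which begins at [start (lev k)]. *)
Lemma block_enumeration (cnt : nat -> nat) :
  (forall M, exists m, (M <= m)%nat /\ (1 <= cnt m)%nat) ->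
  exists (start lev : nat -> nat), start O = O /\ (forall m, start (S m) = (start m + cnt m)%nat) /\
    forall k m, lev k = m <-> (start m <= k < start (S m))%nat.
Proof.
intros Hc.
set (start := fix st m := match m with O => O | S j => (st j + cnt j)%nat end).
assert (Mono : forall a b, (a <= b)%nat -> (start a <= start b)%nat).
{ intros a b H. induction H as [|b H IH]; [lia|]. change (start (S b)) with (start b + cnt b)%nat. lia. }
assert (Unb : forall k, exists m, (k < start (S m))%nat).
{ induction k as [|k [m IH]].
  - destruct (Hc O) as [m [_ H]]. exists m. change (0 < start m + cnt m)%nat. lia.
  - destruct (Hc (S m)) as [m' [H1 H2]]. exists m'. change (S k < start m' + cnt m')%nat.
    pose proof (Mono _ _ H1). lia. }
assert (Lev : forall k, exists m, (start m <= k < start (S m))%nat).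
{ intros k. destruct (least_nat (fun m => (k < start (S m))%nat) (Unb k)) as [m [H1 H2]].
  exists m. split; [|exact H1]. destruct m as [|m]; [simpl; lia|].
  destruct (le_lt_dec (start (S m)) k) as [H|H]; [exact H|]. specialize (H2 m H). lia. }
exists start, (fun k => pick (Lev k)).
split; [reflexivity|]. split; [reflexivity|]. intros k m.
assert (Hl : (start (pick (Lev k)) <= k < start (S (pick (Lev k))))%nat)
  by exact (pick_spec (Lev k)).
set (l := pick (Lev k)) in *. split.
- intros <-. exact Hl.
- intros Hm. destruct (Nat.lt_total l m) as [H|[H|H]]; [|exact H|].
  + pose proof (Mono (S l) m H). lia.
  + pose proof (Mono (S m) l H). lia.
Qed.

Lemma thin_sequence_of_counts (theta : R -> R) (L : nat -> Prop) (N : nat -> nat) :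
  count_profile L N ->
  (exists gamma : R, 0 < gamma /\ sum_finite L (term theta N gamma)) ->
  exists z : nat -> C,
    disk_sequence z /\ separated z /\ theta_thin theta z /\
    forall m : nat, L m -> count_in_Y z m (N m).
Proof.
intros HP [gamma [Hg Hsum]]. pose proof HP as (HL & Hinf & _ & Nlim & _).
destruct (cantor_configuration L N HP)
  as (g & ang & m0 & c & Hc & G1 & G2 & HA).
set (cnt := fun m => if excluded_middle_informative (L m) then N m else O).
destruct (block_enumeration cnt) as (start & lev & St0 & StS & Hlev).
{ intros M. destruct (Nlim (fun n => (1 <= n)%nat) (ex_intro _ 1%nat (fun n Hn => Hn))) as [n1 H1].
  destruct (Hinf (M + n1)%nat) as [m [Hm Lm]]. exists m. split; [lia|].
  unfold cnt. destruct (excluded_middle_informative (L m)); [|contradiction]. apply H1; [lia|exact Lm]. }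
set (z := fun k => ((1 - / 2 ^ lev k)%R * cis (ang (lev k) (k - start (lev k))%nat))%C).
assert (Llev : forall k, L (lev k) /\ (start (lev k) <= k)%nat /\ (k - start (lev k) < N (lev k))%nat).
{ intros k. assert (H := proj1 (Hlev k (lev k)) eq_refl). rewrite StS in H. unfold cnt in H.
  destruct (excluded_middle_informative (L (lev k))); [|lia]. repeat split; [assumption|lia|lia]. }
assert (Hd : forall k, 0 < / 2 ^ lev k <= / 2).
{ intros k. split; [apply half_pow_pos|]. apply half_pow_le, HL, Llev. }
assert (Mz : forall k, Cmod (z k) = 1 - / 2 ^ lev k).
{ intros k. specialize (Hd k). apply Cmod_polar. lra. }
assert (Yz : forall k, Y (lev k) (z k)).
{ intros k. unfold Y. rewrite Mz, half_pow_S. specialize (Hd k). lra. }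
assert (Smono : forall a b, (a <= b)%nat -> (start a <= start b)%nat).
{ intros a b H. induction H as [|b H IH]; [lia|]. rewrite StS. lia. }
(* On one level |z| >= 1/2 and a chord is at least half its arc, which gives the c x / 4 of
   [separated_of_dist]. *)
assert (Sep0 : forall n k, n <> k -> (lev n <= lev k)%nat ->
  c / 9 * Cmod (1 - Cconj (z n) * z k) <= Cmod (z n - z k)).
{ intros n k Hnk Hle. pose proof (Hd n) as Dn. pose proof (Hd k) as Dk.
  apply (separated_of_dist _ _ c (/ 2 ^ lev n) Hc); [rewrite Mz; lra|rewrite Mz; lra|].
  destruct (Nat.eq_dec (lev n) (lev k)) as [H|H].
  - destruct (Llev n) as (L1 & L2 & L3). destruct (Llev k) as (_ & K2 & K3).
    unfold z. rewrite <- H in *. set (m := lev n) in *.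
    destruct (HA m L1) as (A1 & A2 & _).
    replace (RtoC (1 - / 2 ^ m) * cis (ang m (n - start m)%nat) - RtoC (1 - / 2 ^ m) * cis (ang m (k - start m)%nat))%C
      with (RtoC (1 - / 2 ^ m) * (cis (ang m (n - start m)%nat) - cis (ang m (k - start m)%nat)))%C by ring.
    rewrite Cmod_mult, Cmod_R, Rabs_pos_eq by lra.
    specialize (A2 _ _ L3 K3 ltac:(lia)).
    assert (B : Rabs (ang m (n - start m)%nat - ang m (k - start m)%nat) <= 1).
    { pose proof (A1 _ L3). pose proof (A1 _ K3). apply Rabs_le. lra. }
    pose proof (cis_chord _ _ B).
    set (u := Cmod (cis (ang m (n - start m)%nat) - cis (ang m (k - start m)%nat))) in *.
    assert (0 <= u) by apply Cmod_ge_0.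
    assert (/ 2 * u <= (1 - / 2 ^ m) * u) by (apply Rmult_le_compat_r; lra). lra.
  (* On different levels the moduli alone differ by at least half of the larger distance to the
     circle. *)
  - pose proof (Cmod_triangle_sub (z n) (z k)) as T. rewrite !Mz in T. apply Rabs_le_between in T.
    assert (Q : / 2 ^ lev k <= / 2 ^ (lev n + 1)).
    { apply Rinv_le_contravar; [apply pow_lt; lra|]. apply Rle_pow; [lra|lia]. }
    rewrite half_pow_S in Q. nra. }
assert (Sep : forall n k, n <> k -> c / 9 * Cmod (1 - Cconj (z n) * z k) <= Cmod (z n - z k)).
{ intros n k Hnk. destruct (le_lt_dec (lev n) (lev k)) as [H|H]; [now apply Sep0|].
  rewrite (Cmod_sub_comm (z n)).
  replace (Cmod (1 - Cconj (z n) * z k)) with (Cmod (1 - Cconj (z k) * z n)); [apply Sep0; lia|].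
  rewrite <- Cmod_conj. f_equal. rewrite Cminus_conj, Cmult_conj, Cconj_conj.
  replace (Cconj 1) with (RtoC 1) by (apply C_ext; unfold Cconj; simpl; ring). ring. }
assert (Disk : forall k, disk (z k)).
{ intros k. unfold disk. rewrite Mz. specialize (Hd k). lra. }
exists z. split; [|split; [|split]].
- split; [exact Disk|]. apply is_lim_seq_spec. intros eps.
  destruct (pow_to_0 (/ 2) 1 (eps / 2)) as [M HM]; [lra|lra|apply is_pos_div_2|].
  exists (start M). intros k Hk. rewrite Mz.
  assert (HlM : (M <= lev k)%nat).
  { assert (H := proj1 (Hlev k (lev k)) eq_refl).
    destruct (le_lt_dec M (lev k)) as [Q|Q]; [exact Q|]. pose proof (Smono (S (lev k)) M Q). lia. }
  specialize (HM _ HlM). rewrite pow_inv in HM. specialize (Hd k). pose proof (cond_pos eps).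
  replace (1 - / 2 ^ lev k - 1) with (- / 2 ^ lev k) by ring. rewrite Rabs_Ropp, Rabs_pos_eq by lra. lra.
- unfold separated. match goal with |- Rbar_lt _ (Glb_Rbar ?S) => set (F := S) end.
  destruct (Glb_Rbar_correct F) as [_ GL].
  apply Rbar_lt_le_trans with (Finite (c / 9)); [simpl; lra|]. apply GL.
  intros d (n & k & Hnk & ->). simpl. specialize (Sep n k Hnk).
  assert (P := one_sub_conj_pos (z n) (z k) (Disk n) (Disk k)).
  rewrite Cmod_div by (now apply Cmod_gt_0).
  apply (proj1 (Rle_div_r _ _ _ P)). lra.
(* The factor 4 offsets the 4 in Re g >= 2^m / (4 N_m), so that |f| <= exp (- gamma 2^m / N_m) at
   the points of level m >= m0. *)
- set (f := fun w => cexp (RtoC (- (4 * gamma)) * g w)%C).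
  assert (Mf : forall w, Cmod (f w) = exp (- (4 * gamma) * Re (g w))).
  { intros w. unfold f. rewrite Cmod_cexp. f_equal. unfold Re, Im; simpl. ring. }
  assert (Mf1 : forall w, Cmod w < 1 -> Cmod (f w) <= 1).
  { intros w Hw. rewrite Mf, <- exp_0. specialize (G2 w Hw).
    destruct (Req_dec (Re (g w)) 0) as [E|E]; [rewrite E, Rmult_0_r; lra|].
    left. apply exp_increasing. nra. }
  exists f. split; [|split].
  + split; [|exists 1; exact Mf1].
    intros w Hw. destruct (G1 w Hw) as [l Hl].
    eexists. apply is_derive_cdiff.
    apply (cdiff_comp cexp (fun w => RtoC (- (4 * gamma)) * g w)%C); [apply cdiff_cexp|].
    apply (cdiff_mult (fun _ => RtoC (- (4 * gamma))) g); [apply cdiff_const|exact Hl].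
  + exists (RtoC 0). split; [unfold disk; rewrite Cmod_0; lra|]. apply cexp_neq_0.
  + set (a := fun k : nat => if Ceq_dec (z k) (RtoC 0) then 0
      else rho theta (1 - Cmod (z k)) * Cmod (f (z k))).
    assert (Ea : forall k, a k = rho theta (/ 2 ^ lev k) * Cmod (f (z k))).
    { intros k. unfold a. rewrite Mz. replace (1 - (1 - / 2 ^ lev k)) with (/ 2 ^ lev k) by ring.
      destruct (Ceq_dec (z k) 0) as [E|E]; [exfalso|reflexivity].
      pose proof (Mz k) as Q. rewrite E, Cmod_0 in Q. specialize (Hd k). lra. }
    assert (R0 : forall m, 0 <= rho theta (/ 2 ^ m)) by (intros; apply rho_nonneg; left; apply half_pow_pos).
    set (b0 := fun m => INR (N m) * rho theta (/ 2 ^ m)).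
    assert (b00 : forall m, 0 <= b0 m) by (intros m; unfold b0; apply Rmult_le_pos; [apply pos_INR|apply R0]).
    set (t0 := restrict L (term theta N gamma)).
    assert (T0 : forall m, 0 <= t0 m).
    { intros m. unfold t0, restrict. destruct (excluded_middle_informative (L m)); [|lra].
      unfold term. apply Rmult_le_pos; [apply (b00 m)|left; apply exp_pos]. }
    (* From m0 on a level costs at most its given term; before m0 only |f| <= 1 is used, at the cost
       of the finite sum of [b0]. *)
    assert (Blk : forall m, lsum a (seq (start m) (cnt m)) <= restrict (fun m => (m < m0)%nat) b0 m + t0 m).
    { intros m. unfold cnt. unfold t0 at 1, restrict.
      assert (Bp : 0 <= (if excluded_middle_informative (m < m0)%nat then b0 m else 0))
        by (destruct (excluded_middle_informative (m < m0)%nat); [apply b00|lra]).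
      destruct (excluded_middle_informative (L m)) as [Lm|Lm]; [|simpl; lra].
      assert (In_lev : forall k, In k (seq (start m) (N m)) -> lev k = m).
      { intros k Hk. apply in_seq in Hk. apply Hlev. rewrite StS. unfold cnt.
        destruct (excluded_middle_informative (L m)); [lia|contradiction]. }
      destruct (le_lt_dec m0 m) as [Hm|Hm].
      - apply Rle_trans with (term theta N gamma m); [|lra].
        replace (term theta N gamma m) with (INR (length (seq (start m) (N m))) *
          (rho theta (/ 2 ^ m) * exp (- (gamma * 2 ^ m / INR (N m))))).
        2:{ rewrite length_seq. unfold term. ring. }
        rewrite <- lsum_const. apply lsum_le. intros k Hk. assert (Hk' := In_lev k Hk).
        rewrite Ea, Hk'. apply Rmult_le_compat_l; [apply R0|].
        destruct (Llev k) as (_ & _ & K3). rewrite Hk' in K3.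
        destruct (HA m Lm) as (_ & _ & A3). specialize (A3 Hm _ K3).
        rewrite Mf. unfold z. rewrite Hk'.
        set (y := Re (g ((1 - / 2 ^ m)%R * cis (ang m (k - start m)%nat))%C)) in *.
        assert (N0 : 0 < INR (N m)) by (apply lt_0_INR; lia).
        assert (Ey : gamma * 2 ^ m / INR (N m) = 4 * gamma * (2 ^ m / (4 * INR (N m)))) by (field; lra).
        rewrite Ey.
        assert (Q : - (4 * gamma) * y <= - (4 * gamma * (2 ^ m / (4 * INR (N m))))) by nra.
        destruct Q as [Q|Q]; [left; now apply exp_increasing|right; now rewrite Q].
      - destruct (excluded_middle_informative (m < m0)%nat) as [_|F]; [|contradiction].
        apply Rle_trans with (b0 m); [|specialize (T0 m); unfold t0, restrict in T0;
          destruct (excluded_middle_informative (L m)); [lra|contradiction]].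
        replace (b0 m) with (INR (length (seq (start m) (N m))) * rho theta (/ 2 ^ m))
          by (rewrite length_seq; reflexivity).
        rewrite <- lsum_const. apply lsum_le. intros k Hk. rewrite Ea, (In_lev k Hk).
        rewrite <- (Rmult_1_r (rho theta (/ 2 ^ m))) at 2. apply Rmult_le_compat_l; [apply R0|].
        apply Mf1. apply Disk. }
    assert (Tot : forall M, lsum a (seq 0 (start M)) <= lsum b0 (seq 0 m0) + Series t0).
    { intros M.
      assert (Eq : lsum a (seq 0 (start M)) = lsum (fun m => lsum a (seq (start m) (cnt m))) (seq 0 M)).
      { induction M as [|M IH]; [rewrite St0; reflexivity|].
        rewrite StS, seq_app, lsum_app, IH, seq_S, lsum_app. simpl. ring. }
      rewrite Eq. eapply Rle_trans; [apply lsum_le; intros m _; apply Blk|].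
      rewrite lsum_plus. apply Rplus_le_compat.
      - rewrite restrict_lsum. apply lsum_incl_le; [apply NoDup_filter, seq_NoDup| |exact b00].
        intros m Hm. apply in_cfilter in Hm. apply in_seq. lia.
      - apply lsum_le_Series; [exact T0|exact Hsum|apply seq_NoDup]. }
    assert (a0 : forall k, 0 <= a k).
    { intros k. rewrite Ea. apply Rmult_le_pos; [apply R0|apply Cmod_ge_0]. }
    apply (ex_series_bounded a (lsum b0 (seq 0 m0) + Series t0)); [exact a0|].
    intros n. rewrite sum_n_lsum. eapply Rle_trans; [|apply (Tot (S (lev n)))].
    apply lsum_incl_le; [apply seq_NoDup| |exact a0].
    intros k Hk. apply in_seq in Hk. apply in_seq.
    assert (H := proj1 (Hlev n (lev n)) eq_refl). lia.
- intros m Lm. exists (seq (start m) (N m)). split; [apply seq_NoDup|]. split; [apply length_seq|].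
  intros k. rewrite in_seq.
  assert (Q : (start m <= k < start m + N m)%nat <-> lev k = m).
  { rewrite Hlev, StS. unfold cnt. destruct (excluded_middle_informative (L m)); [reflexivity|contradiction]. }
  rewrite Q. split.
  + intros <-. apply Yz.
  + intros H. exact (Y_disjoint _ _ _ (Yz k) H).
Qed.

Theorem proposition2p3 (theta : R -> R) (Htheta : admissible_weight theta) :
  (forall (z : nat -> C) (N : nat -> nat),
     disk_sequence z ->
     separated z ->
     (forall m : nat, (1 <= m)%nat -> count_in_Y z m (N m)) ->
     (forall (gamma : R) (J : nat -> Prop),
        0 < gamma ->
        index_set J ->
        sum_finite J (density N) ->
        sum_infinite (fun m => (1 <= m)%nat /\ ~ J m) (term theta N gamma)) ->
     ~ Lambda theta z)
  /\
  (forall (L : nat -> Prop) (N : nat -> nat),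
     index_set L ->
     (forall M : nat, exists m : nat, (M <= m)%nat /\ L m) ->
     (forall m n : nat, L m -> L n -> (m <= n)%nat -> (N m <= N n)%nat) ->
     filterlim N (within L eventually) eventually ->
     (forall m n : nat, L m -> L n -> (m <= n)%nat -> density N n <= density N m) ->
     filterlim (density N) (within L eventually) (locally 0) ->
     (exists gamma : R, 0 < gamma /\ sum_finite L (term theta N gamma)) ->
     exists z : nat -> C,
       disk_sequence z /\ separated z /\ theta_thin theta z /\
       forall m : nat, L m -> count_in_Y z m (N m)).
Proof.
split.
- intros z N Hz Hsep HN Hinf. exact (divergence_not_Lambda theta z N Htheta Hz Hsep HN Hinf).
- intros L N H1 H2 H3 H4 H5 H6. apply (thin_sequence_of_counts theta). repeat split; assumption.
Qed.
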